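(* Let $\mathcal{A}\subseteq\mathbb{C}^{n\times n}$ be spanned by $A_1,\dots,A_p$ with Gaussian integer entries of absolute value at most $M$, let $d$ be the minimum blow-up size of $\mathcal{A}$ and $k$ an upper bound on $\operatorname{ncrank}\mathcal{A}$, and let $c=n-\operatorname{ncrank}\mathcal{A}$. There is a randomized algorithm which, given $A_1,\dots,A_p,d,k$, outputs the minimum $c$-shrunk subspace of $\mathcal{A}$ with probability at least $1/2$, using $O(pd^4n^4)$ arithmetic operations over $\mathbb{Q}$, and such that its output and all intermediate vectors have Gaussian integer entries of magnitude at most $e^{O(n^2d^2\log(Mndk)+nd\log M)}$.
   Context: For a subspace $U\subseteq\mathbb{C}^n$, $\mathcal{A}(U)=\operatorname{span}\{Au:A\in\mathcal{A},u\in U\}$; $U$ is $c$-shrunk if $\dim U-\dim\mathcal{A}(U)\ge c$. $\operatorname{ncrank}\mathcal{A}=\min_U(n-\dim U+\dim\mathcal{A}(U))$, so $c=n-\operatorname{ncrank}\mathcal{A}$ is the largest shrinkage; the $c$-shrunk subspaces for this $c$ have a unique minimum (contained in all others), called the minimum $c$-shrunk subspace. Also $\operatorname{ncrank}\mathcal{A}=\sup_{d\ge1}\max\{\frac1d\operatorname{rk}(\sum_iA_i\otimes X_i):X_i\in\mathbb{C}^{d\times d}\}$, and the minimum blow-up size is the least $d$ attaining this supremum. *)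

(* Defs.v *)
From HB Require Import structures.
From mathcomp Require Import all_boot all_order all_algebra.
From mathcomp Require Import mxtens complex.
From mathcomp Require Import all_classical all_reals all_analysis.

Set Implicit Arguments.
Unset Strict Implicit.
Unset Printing Implicit Defensive.

Import Order.TTheory GRing.Theory Num.Theory.
Local Open Scope ring_scope.

(** * Matrix spaces, shrunk subspaces, noncommutative rank *)

Definition mxspan (F : fieldType) (n p : nat) (A : 'I_p -> 'M[F]_n) :
    {vspace 'M[F]_n} :=
  <<[seq A t | t <- enum 'I_p]>>%VS.

(* Spanning over bases of [AA] and [U] suffices: see [mxact_sub]. *)
Definition mxact (F : fieldType) (n : nat) (AA : {vspace 'M[F]_n})
    (U : {vspace 'cV[F]_n}) : {vspace 'cV[F]_n} :=
  <<[seq B *m u | B <- vbasis AA, u <- vbasis U]>>%VS.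

Lemma mxact_sub (F : fieldType) (n : nat) (AA : {vspace 'M[F]_n})
    (U W : {vspace 'cV[F]_n}) :
  (mxact AA U <= W)%VS <->
  (forall B u, B \in AA -> u \in U -> B *m u \in W).
Proof.
split=> [/span_subvP sW B u BA uU | sW]; last first.
  by apply/span_subvP => _ /allpairsP[[B u] [/= hB hu ->]]; apply: sW;
    exact: vbasis_mem.
rewrite (coord_vbasis BA) mulmx_suml; apply: rpred_sum => i _.
rewrite (coord_vbasis uU) mulmx_sumr; apply: rpred_sum => j _.
rewrite -scalemxAl -scalemxAr !rpredZ //; apply: sW.
by apply/allpairsP; exists ((vbasis AA)`_i, (vbasis U)`_j);
  split=> //=; rewrite mem_nth // size_tuple.
Qed.

Definition shrunk (F : fieldType) (n : nat) (AA : {vspace 'M[F]_n}) (c : nat)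
    (U : {vspace 'cV[F]_n}) : Prop :=
  (c + \dim (mxact AA U) <= \dim U)%N.

Definition min_shrunk (F : fieldType) (n : nat) (AA : {vspace 'M[F]_n})
    (c : nat) (U : {vspace 'cV[F]_n}) : Prop :=
  shrunk AA c U /\ forall V, shrunk AA c V -> (U <= V)%VS.

Definition ncrank_val (F : fieldType) (n : nat) (AA : {vspace 'M[F]_n}) :
    pred nat :=
  fun r => `[< exists U : {vspace 'cV[F]_n},
                 r = (n - \dim U + \dim (mxact AA U))%N >].

Lemma ncrank_val_ex (F : fieldType) (n : nat) (AA : {vspace 'M[F]_n}) :
  exists r, ncrank_val AA r.
Proof.
by exists (n - \dim (0 : {vspace 'cV[F]_n}) + \dim (mxact AA 0))%N;
  apply/asboolP; exists 0%VS.
Qed.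

(* [n - \dim U] is not truncated, as [\dim U <= n]. *)
Definition ncrank (F : fieldType) (n : nat) (AA : {vspace 'M[F]_n}) : nat :=
  ex_minn (ncrank_val_ex AA).

(** * Blow-ups *)

Definition blowup (F : fieldType) (n p d : nat) (A : 'I_p -> 'M[F]_n)
    (X : 'I_p -> 'M[F]_d) : 'M[F]_(n * d) :=
  \sum_(t < p) A t *t X t.

Definition blowup_ratios (R : realType) (n p : nat)
    (A : 'I_p -> 'M[R[i]]_n) : set R :=
  [set x | exists (d : nat) (X : 'I_p -> 'M[R[i]]_d),
             (0 < d)%N /\ x = (\rank (blowup A X))%:R / d%:R]%classic.

Definition blowup_attains (R : realType) (n p : nat)
    (A : 'I_p -> 'M[R[i]]_n) (d : nat) : Prop :=
  exists X : 'I_p -> 'M[R[i]]_d,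
    (\rank (blowup A X))%:R / d%:R = sup (blowup_ratios A).

Definition min_blowup_size (R : realType) (n p : nat)
    (A : 'I_p -> 'M[R[i]]_n) (d : nat) : Prop :=
  [/\ (0 < d)%N, blowup_attains A d &
      forall d' : nat, (0 < d')%N -> blowup_attains A d' -> (d <= d')%N].

(** * Gaussian integers *)

Definition gaussint (R : realType) (z : R[i]) : Prop :=
  exists a b : int, z = (a%:~R +i* b%:~R)%C.

Definition magnitude (R : realType) (z : R[i]) : R := Normc.normc z.

(** * Randomized programs

   Three kinds of storage: index registers (naturals), scalar registers
   (elements of Q(i)) and arrays of scalars.  The arrays hold the vectors the
   program works with; a program mentions only finitely many registers.
   A scalar influences control flow and indices only through the zero test
   [IfZero], and there is no instruction converting between indices and scalars.
   Scalars are interpreted in [R[i]] but, constants being Gaussian integers, a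
   run on an input in Q(i) stays in Q(i).  Division by zero yields zero, as
   in MathComp. *)

Inductive iexp : Type :=
| IVar of nat
| ICst of nat
| IAdd of iexp & iexp
| ISub of iexp & iexp
| IMul of iexp & iexp.

Inductive sop : Type := OAdd | OSub | OMul | ODiv.

Inductive cmd : Type :=
| Skip
| Seq of cmd & cmd
| ISet of nat & iexp
| SCst of nat & int & int           (* x := a + b i *)
| SOp of sop & nat & nat & nat      (* x := y op z *)
| SConj of nat & nat                (* x := conjugate of y *)
| Fetch of nat & nat & iexp          (* x := a[e] *)
| Store of nat & iexp & nat         (* a[e] := x *)
| Rand of nat & iexp                (* x := uniform in {0, ..., e} *)
| IfZero of nat & cmd & cmd
| IfLe of iexp & iexp & cmd & cmd
| For of nat & iexp & cmd.          (* for v = 0, ..., e - 1 do c *)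

(* [stored] records every value ever written into an array. *)
Record state (F : Type) : Type := State {
  ireg : nat -> nat;
  sreg : nat -> F;
  arr : nat -> nat -> F;
  cost : nat;
  stored : seq F }.

Definition upd (T : Type) (f : nat -> T) (x : nat) (v : T) : nat -> T :=
  fun y => if y == x then v else f y.

Definition set_ireg (F : Type) (s : state F) (x v : nat) : state F :=
  State (upd (ireg s) x v) (sreg s) (arr s) (cost s) (stored s).

Definition set_sreg (F : Type) (s : state F) (x : nat) (v : F) : state F :=
  State (ireg s) (upd (sreg s) x v) (arr s) (cost s) (stored s).

Definition store (F : Type) (s : state F) (a e : nat) (v : F) : state F :=
  State (ireg s) (sreg s) (upd (arr s) a (upd (arr s a) e v)) (cost s)
        (v :: stored s).

Definition tick (F : Type) (w : nat) (s : state F) : state F :=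
  State (ireg s) (sreg s) (arr s) (w + cost s) (stored s).

Fixpoint ieval (r : nat -> nat) (e : iexp) : nat :=
  match e with
  | IVar x => r x
  | ICst m => m
  | IAdd e1 e2 => (ieval r e1 + ieval r e2)%N
  | ISub e1 e2 => (ieval r e1 - ieval r e2)%N
  | IMul e1 e2 => (ieval r e1 * ieval r e2)%N
  end.

Definition sop_eval (R : realType) (o : sop) (y z : R[i]) : R[i] :=
  match o with
  | OAdd => y + z
  | OSub => y - z
  | OMul => y * z
  | ODiv => y / z
  end.

(* Number of operations over Q realizing the operation over Q(i), e.g.
   (a + b i) / (c + d i) = ((a c + b d) + (b c - a d) i) / (c^2 + d^2). *)
Definition sop_cost (o : sop) : nat :=
  match o with
  | OAdd | OSub => 2
  | OMul => 6
  | ODiv => 11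
  end.

(* A node [Draw m f] draws [j] uniformly among the [m.+1] elements of
   ['I_m.+1] and goes on with [f j]. *)
Inductive rtree (T : Type) : Type :=
| Done of T
| Draw m of ('I_m.+1 -> rtree T).

Fixpoint rbind (S T : Type) (t : rtree S) (g : S -> rtree T) : rtree T :=
  match t with
  | Done s => g s
  | Draw m f => Draw (fun j => rbind (f j) g)
  end.

Fixpoint prob (T : Type) (t : rtree T) (E : T -> Prop) : rat :=
  match t with
  | Done s => (`[< E s >] : nat)%:R
  | Draw m f => (\sum_(j < m.+1) prob (f j) E) / m.+1%:R
  end.

Fixpoint always (T : Type) (t : rtree T) (E : T -> Prop) : Prop :=
  match t with
  | Done s => E s
  | Draw m f => forall j, always (f j) E
  end.

(* Every executed instruction is charged, including index arithmetic, memory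
   accesses, tests, random draws and loop overhead; [cost] therefore bounds the
   number of arithmetic operations over Q. *)
Fixpoint exec (R : realType) (c : cmd) (s : state R[i]) : rtree (state R[i]) :=
  match c with
  | Skip => Done s
  | Seq c1 c2 => rbind (exec c1 s) (exec c2)
  | ISet x e => Done (tick 1 (set_ireg s x (ieval (ireg s) e)))
  | SCst x a b => Done (tick 1 (set_sreg s x (a%:~R +i* b%:~R)%C))
  | SOp o x y z =>
      Done (tick (sop_cost o)
                 (set_sreg s x (sop_eval o (sreg s y) (sreg s z))))
  | SConj x y => Done (tick 1 (set_sreg s x (conjc (sreg s y))))
  | Fetch x a e => Done (tick 1 (set_sreg s x (arr s a (ieval (ireg s) e))))
  | Store a e x => Done (tick 1 (store s a (ieval (ireg s) e) (sreg s x)))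
  | Rand x e =>
      @Draw _ (ieval (ireg s) e)
        (fun j => Done (tick 1 (set_sreg s x (nat_of_ord j)%:R)))
  | IfZero x c1 c2 =>
      if sreg s x == 0 then exec c1 (tick 2 s) else exec c2 (tick 2 s)
  | IfLe e1 e2 c1 c2 =>
      if (ieval (ireg s) e1 <= ieval (ireg s) e2)%N
      then exec c1 (tick 1 s) else exec c2 (tick 1 s)
  | For v e c =>
      iteri (ieval (ireg s) e)
        (fun j t => rbind t (fun s' => exec c (tick 1 (set_ireg s' v j))))
        (Done (tick 1 s))
  end.

(* Input: index registers 0, 1, 2, 3 contain n, p, d, k, and array 0 contains the
   entry (i, j) of A_t at position (t n + i) n + j. *)
Definition input_ireg (n p d k : nat) : nat -> nat :=
  fun x => nth 0%N [:: n; p; d; k] x.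

Definition input_arr (F : fieldType) (n p : nat) (A : 'I_p -> 'M[F]_n) :
    nat -> nat -> F :=
  fun a e => if a == 0%N then
    \sum_(t < p) \sum_(i < n) \sum_(j < n)
      A t i j *+ (e == (t * n + i) * n + j)%N
  else 0.

Definition input (R : realType) (n p d k : nat) (A : 'I_p -> 'M[R[i]]_n) :
    state R[i] :=
  State (input_ireg n p d k) (fun=> 0) (input_arr A) 0 [::].

(* Output: index register 4 contains the number of vectors, and array 1 contains
   the coordinate j of the l-th vector at position l n + j. *)
Definition output (R : realType) (n : nat) (s : state R[i]) :
    seq 'cV[R[i]]_n :=
  [seq \col_(j < n) arr s 1 (l * n + j)%N | l <- iota 0 (ireg s 4)].

(* Values occurring in the output or, at any time, in a vector of the run. *)
Definition vector_entry (R : realType) (n : nat) (s : state R[i]) (z : R[i]) :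
    Prop :=
  z \in stored s \/ exists2 v, v \in output n s & exists j, z = v j 0.

(* Main.v *)
Require Import Defs.
From HB Require Import structures.
From mathcomp Require Import all_boot all_order all_algebra.
From mathcomp Require Import mxtens complex.
From mathcomp Require Import all_classical all_reals all_analysis.
From mathcomp Require Import perm zify ring.
Set Implicit Arguments.
Unset Strict Implicit.
Unset Printing Implicit Defensive.
Import Order.TTheory GRing.Theory Num.Theory.
Local Open Scope ring_scope.

(** Let [N = n d] and let [B] be an [N * N] blow-up attaining the supremum.  Together with
    [X] every doubled tuple [[X, Y], [0, X]] attains it, and this forces the Wong sequence
    of [B] (start with [ker B], then take preimages under [B] of images under all
    blow-ups) to stay in the image of [B].  Hence [rank B = d * ncrank], and the smallest
    subspace [K] containing [ker B] with [C K <= B K] for all blow-ups [C] is [U (x) C^d],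
    where [U] is the minimum [c]-shrunk subspace.

    The program keeps at most [n^2] linearly independent [A_t]'s and draws random blow-ups
    [B = C_0, C_1, ..., C_N].  The spaces [F_0 = ker B] and
    [F_s = { x | B x + C_s x' = 0 for some x' in F_(s-1) }] increase generically until they
    reach [U (x) C^d], at the latest for [s = N].  Revealing the random integers one after
    the other, each of them spoils a still possible success for at most [N^2] of its values,
    so a range of size [4 N^5] gives probability [1/2].

    The systems are solved by inserting one row after the other into a projection onto
    the solution space.  Only a window of width [2 N] is stored, but the projection is a part
    of the one of a virtual system of order [O(N^2)] with integer coefficients; so its
    denominator and its numerators are minors of that system, which bounds them. *)

(** * Fraction-free elimination *)

(** The budget is [p N^4]. Solving the whole chain as one linear system of order [N^2] would cost
    about [N^6]; since [F_s] depends on [F_(s-1)] only, each of the about [N^2] row insertions can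
    be done in [O(N^2)] operations. One random matrix per step has to do the work of all blow-ups.
    That it can is seen by comparing the maximal dimensions of chains of each length: once these
    stagnate they do so forever, all chains of maximal dimension then give the same space, and this
    space is closed under all blow-ups. The pivot is always the last possible one, so that the
    unknowns of the previous step are eliminated first and can leave the window without disturbing
    the projection on the others. Discarding dependent [A_t] keeps [p] out of the number of draws,
    hence out of their range and out of the magnitudes. *)

Section Elimination.
Variable F : fieldType.

(** A vanishing column belongs to a pivot variable, a unit row to a free one. Such a [Q] projects
    onto the solution space along the pivot coordinates, and its nonzero columns are a reduced
    echelon basis of the image; the output is read off from this shape. *)
Definition reflecting W (Q : 'M[F]_W) :=
  forall c, col c Q = 0 \/ row c Q = row c 1%:M.

(** The rank-one correction that cuts the image of [Q] down to the hyperplane [v x = 0],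
    compensating along the column [c]. *)
Definition deflate W (Q : 'M[F]_W) (v : 'rV[F]_W) (c : 'I_W) : 'M[F]_W :=
  Q - ((v *m Q) 0 c)^-1 *: (col c Q *m (v *m Q)).

Lemma reflecting_idem W (Q : 'M[F]_W) : reflecting Q -> Q *m Q = Q.
Proof.
move=> rQ; apply/matrixP=> i j; rewrite mxE.
rewrite (eq_bigr (fun c => Q i c * (c == j)%:R)); last first.
  move=> c _; case: (rQ c) => [/colP/(_ i)|/rowP/(_ j)]; rewrite !mxE.
    by move=> ->; rewrite !mul0r.
  by move=> ->.
by rewrite (bigD1 j) //= eqxx mulr1 big1 ?addr0 // => c /negPf->; rewrite mulr0.
Qed.

Lemma deflateE W (Q : 'M[F]_W) v c i j :
  deflate Q v c i j = Q i j - ((v *m Q) 0 c)^-1 * (Q i c * (v *m Q) 0 j).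
Proof. by rewrite !mxE big_ord1 !mxE. Qed.

(** The column of the pivot [c] cancels. A zero column of [Q] gives a zero entry of [v *m Q], so it
    stays zero; the unit row at another free index vanishes at [c], so it is not changed. *)
Lemma deflate_reflecting W (Q : 'M[F]_W) v c :
  reflecting Q -> (v *m Q) 0 c != 0 -> reflecting (deflate Q v c).
Proof.
move=> rQ yc c'; have [->|c'c] := eqVneq c' c.
  left; apply/colP=> i; rewrite [LHS]mxE deflateE [RHS]mxE.
  by rewrite mulrCA mulVf // mulr1 subrr.
case: (rQ c') => [/colP c0|/rowP r1].
  left; apply/colP=> i; rewrite mxE deflateE.
  have -> : Q i c' = 0 by have := c0 i; rewrite !mxE.
  rewrite [(v *m Q) 0 c']mxE big1 ?mulr0 ?subr0 ?mxE // => k _.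
  by have := c0 k; rewrite !mxE => ->; rewrite mulr0.
right; apply/rowP=> j; rewrite mxE deflateE.
have := r1 c; rewrite !mxE (negPf c'c) => ->; rewrite mul0r mulr0 subr0.
by have := r1 j; rewrite !mxE.
Qed.

Lemma deflate_fixed W (Q : 'M[F]_W) v c (x : 'cV[F]_W) :
  reflecting Q -> (v *m Q) 0 c != 0 ->
  deflate Q v c *m x = x <-> Q *m x = x /\ v *m x = 0.
Proof.
move=> rQ yc; have QQ := reflecting_idem rQ.
have cE : col c Q = Q *m delta_mx c 0 by rewrite -colE.
have QD : Q *m deflate Q v c = deflate Q v c.
  by rewrite mulmxBr QQ -scalemxAr /deflate cE !mulmxA QQ.
have vD : v *m deflate Q v c = 0.
  rewrite /deflate cE mulmxBr -scalemxAr !mulmxA -colE -mulmxA.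
  rewrite [col c (v *m Q)]mx11_scalar mul_scalar_mx [_ 0 0]mxE scalerA mulVf //.
  by rewrite scale1r subrr.
split=> [fx|[Qx vx]].
  by split; rewrite -fx mulmxA ?QD // vD mul0mx.
by rewrite mulmxBl Qx -scalemxAl -!mulmxA Qx vx !mulmx0 scaler0 subr0.
Qed.

Lemma fixed_kernel W (Q : 'M[F]_W) (v : 'rV[F]_W) (x : 'cV[F]_W) :
  v *m Q = 0 -> Q *m x = x -> v *m x = 0.
Proof. by move=> vQ <-; rewrite mulmxA vQ mul0mx. Qed.

(* The virtual matrix [V] collects the rows used as pivots since the beginning;
   [Q] is the part, seen through the window [w], of the projection
   [1 - E (V E)^-1 V] whose denominator is the minor [\det (V E)]. *)
Definition pivmx k D (piv : 'I_k -> 'I_D) : 'M[F]_(D, k) :=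
  \matrix_(i, b) (i == piv b)%:R.

Definition complproj k D (V : 'M[F]_(k, D)) (piv : 'I_k -> 'I_D) : 'M[F]_D :=
  1%:M - pivmx piv *m invmx (V *m pivmx piv) *m V.

(** The virtual system is existentially quantified because the program never stores it. By the last
    clause the rows of the projection inside the window vanish outside it, so products with rows
    supported on the window can be computed from [Q] alone. *)
Definition windowed (okE : F -> Prop) D W (dl : F) (Q : 'M[F]_W) : Prop :=
  exists (w : 'I_W -> 'I_D) k (V : 'M[F]_(k, D)) (piv : 'I_k -> 'I_D),
  [/\ injective w, forall a j, okE (V a j),
      V *m pivmx piv \in unitmx, dl = \det (V *m pivmx piv) &
      (forall i j, Q i j = complproj V piv (w i) (w j)) /\
      (forall i x, x \notin codom w -> complproj V piv (w i) x = 0)].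

(** [V Q = 0] says [(V E) Z = V], which determines [Z]. An updated projection is recognised in this
    way without inverting the bordered matrix. *)
Lemma complproj_uniq k D (V : 'M[F]_(k, D)) (piv : 'I_k -> 'I_D) Q Z :
  V *m pivmx piv \in unitmx -> Q = 1%:M - pivmx piv *m Z -> V *m Q = 0 ->
  Q = complproj V piv.
Proof.
move=> uVE -> /eqP; rewrite mulmxBr mulmx1 subr_eq0 mulmxA => /eqP VZ.
rewrite /complproj -mulmxA; congr (_ - _ *m _).
by rewrite {2}VZ mulKmx.
Qed.

Lemma det_schur k (a : 'M[F]_1) (b : 'rV[F]_k) (c : 'cV[F]_k) (M : 'M[F]_k) :
  M \in unitmx ->
  \det (block_mx a b c M) = (a - b *m invmx M *m c) 0 0 * \det M.
Proof.
move=> uM.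
have -> : block_mx a b c M =
    block_mx (a - b *m invmx M *m c) b 0 M *m block_mx 1%:M 0 (invmx M *m c) 1%:M.
  rewrite mulmx_block !mulmx1 !mulmx0 !add0r mulmxA subrK.
  by rewrite mulmxA mulmxV // mul1mx.
rewrite det_mulmx det_ublock det_lblock !det1 !mulr1.
by rewrite {1}[a - _]mx11_scalar det_scalar1.
Qed.

(** Bordering [V E] by the new row and the new pivot column multiplies the determinant by a Schur
    complement, and this is exactly the entry of [v *m Q] at the pivot. So the product of the pivot
    entries remains a minor of the virtual system. *)
Lemma windowed_deflate (okE : F -> Prop) D W dl (Q : 'M[F]_W) (v : 'rV[F]_W) c :
  okE 0 -> (forall i, okE (v 0 i)) -> (v *m Q) 0 c != 0 ->
  windowed okE D dl Q ->
  windowed okE D (dl * (v *m Q) 0 c) (deflate Q v c).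
Proof.
move=> ok0 okv yc [w [k [V [piv [injw okV uVE -> [QE Qout]]]]]].
set Qf := complproj V piv in QE Qout.
(* The inserted row, extended by zero outside the window. *)
pose vf : 'rV[F]_D := \row_x \sum_(i | w i == x) v 0 i.
have vfw i : vf 0 (w i) = v 0 i.
  by rewrite mxE (big_pred1 i) // => j; rewrite /= (inj_eq injw).
have vfout x : x \notin codom w -> vf 0 x = 0.
  move=> xw; rewrite mxE big_pred0 // => i; apply/negP=> /eqP wi.
  by rewrite -wi codom_f in xw.
have sumw (f : 'I_D -> F) : (forall x, x \notin codom w -> f x = 0) ->
    \sum_x f x = \sum_i f (w i).
  move=> f0; rewrite (bigID (mem (codom w))) /= [X in _ + X]big1 // addr0.
  rewrite -big_uniq; last by rewrite /= map_inj_uniq ?enum_uniq.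
  by rewrite big_map big_enum.
have yf j : (vf *m Qf) 0 (w j) = (v *m Q) 0 j.
  rewrite mxE sumw; last by move=> x /vfout->; rewrite mul0r.
  by rewrite mxE; apply: eq_bigr => i _; rewrite vfw QE.
have yfout x : x \notin codom w -> (vf *m Qf) 0 x = 0.
  move=> xw; rewrite mxE sumw; last by move=> z /vfout->; rewrite mul0r.
  by rewrite big1 // => i _; rewrite Qout // mulr0.
pose piv' (b : 'I_(1 + k)) := if fintype.split b is inr b' then piv b' else w c.
pose V' : 'M[F]_(1 + k, D) := col_mx vf V.
have E'E : pivmx piv' = row_mx (delta_mx (w c) 0) (pivmx piv).
  apply/matrixP=> i b; rewrite !mxE /piv'; case: (fintype.split b) => b'.
    by rewrite !mxE (ord1 b') eqxx andbT.
  by rewrite !mxE.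
have VE' : V' *m pivmx piv' = block_mx (vf *m delta_mx (w c) 0) (vf *m pivmx piv)
                                  (V *m delta_mx (w c) 0) (V *m pivmx piv).
  by rewrite E'E mul_col_row.
have dE : \det (V' *m pivmx piv') = \det (V *m pivmx piv) * (v *m Q) 0 c.
  rewrite VE' det_schur // mulrC -yf; congr (_ * _).
  rewrite -!mulmxA -mulmxBr -[X in X - _]mul1mx !mulmxA -mulmxBl.
  by rewrite -/(complproj V piv) -/Qf mulmxA -colE mxE.
have uVE' : V' *m pivmx piv' \in unitmx.
  by rewrite unitmxE dE unitrM -unitmxE uVE unitfE.
have VQf : V *m Qf = 0.
  by rewrite mulmxBr mulmx1 !mulmxA mulmxV // mul1mx subrr.
have [Z0 EZ] : exists Z0, pivmx piv *m Z0 = 1%:M - Qf.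
  exists (invmx (V *m pivmx piv) *m V).
  by rewrite /Qf /complproj opprB addrC subrK !mulmxA.
clearbody Qf.
have Qf'E : deflate Qf vf (w c) = complproj V' piv'.
  set s := ((vf *m Qf) 0 (w c))^-1.
  apply: (complproj_uniq (Z := col_mx (s *: (vf *m Qf))
             (Z0 - Z0 *m delta_mx (w c) 0 *m (s *: (vf *m Qf)))) uVE').
    rewrite E'E mul_row_col mulmxBr !mulmxA EZ /deflate -/s colE.
    rewrite !mulmxBl !mul1mx -!scalemxAr.
    move: (delta_mx _ _ *m _) (Qf *m _ *m _) {EZ} => a b.
    by apply/matrixP=> i j; rewrite !mxE; ring.
  have dV : V' *m deflate Qf vf (w c) = col_mx (vf *m deflate Qf vf (w c))
                                               (V *m deflate Qf vf (w c)).
    by rewrite mul_col_mx.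
  rewrite dV -[RHS]col_mx0; congr col_mx.
    rewrite mulmxBr -scalemxAr colE !mulmxA -colE -mulmxA.
    rewrite [col _ (vf *m Qf)]mx11_scalar mul_scalar_mx [_ 0 0]mxE scalerA mulVf ?yf //.
    by rewrite scale1r subrr.
  by rewrite mulmxBr VQf -scalemxAr colE !mulmxA VQf !mul0mx scaler0 subrr.
exists w, _, V', piv'; split=> //.
  move=> a j; rewrite mxE; case: (fintype.split a) => a'; last exact: okV.
  rewrite (ord1 a'); have [/codomP[i ->]|/vfout->//] := boolP (j \in codom w).
  by rewrite vfw.
split=> [i j|i x xw]; rewrite -Qf'E !deflateE.
  by rewrite !yf !QE.
by rewrite (Qout _ _ xw) (yfout _ xw) !mulr0 subrr.
Qed.

Lemma windowed_init (okE : F -> Prop) W : windowed okE W 1 (1%:M : 'M[F]_W).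
Proof.
pose p0 (b : 'I_0) : 'I_W := match b with Ordinal _ h => False_rect _ (notF h) end.
have E0 (M : 'M[F]_0) : M = 1%:M by apply/matrixP=> -[].
have Q1 : complproj (0 : 'M[F]_(0, W)) p0 = 1%:M.
  by rewrite /complproj mulmx0 subr0.
exists id, 0%N, 0, p0; split=> //.
- by move=> [].
- by rewrite [_ *m _]E0 unitmx1.
- by rewrite det_mx00.
- by rewrite Q1; split=> // i x /codomP[]; exists x.
Qed.

(** The fresh unknowns are new coordinates on which [V] is zero, so the projection is the identity
    there. The old second half leaves the window; as the upper right block is zero, the rows that
    remain do not look at it. *)
Lemma windowed_shift (okE : F -> Prop) D N dl (Q11 Q21 Q22 : 'M[F]_N) :
  okE 0 ->
  windowed okE D dl (block_mx Q11 (0 : 'M[F]_N) Q21 Q22) ->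
  windowed okE (D + N) dl (block_mx (1%:M : 'M[F]_N) (0 : 'M[F]_N) (0 : 'M[F]_N) Q11).
Proof.
move=> ok0 [w [k [V [piv [injw okV uVE -> [QE Qout]]]]]].
pose w' (i : 'I_(N + N)) :=
  match fintype.split i with inl j => rshift D j | inr j => lshift N (w (lshift N j)) end.
pose V' : 'M[F]_(k, D + N) := row_mx V 0.
pose piv' b := lshift N (piv b).
have E'E : pivmx piv' = col_mx (pivmx piv) 0.
  apply/matrixP=> i b; rewrite !mxE /piv'; case: splitP => i' ii'.
    by rewrite !mxE -!val_eqE /= ii'.
  by rewrite !mxE -!val_eqE /= ii' gtn_eqF // ltn_addr.
have VE' : V' *m pivmx piv' = V *m pivmx piv.
  by rewrite E'E mul_row_col mul0mx addr0.
have Qf'E : complproj V' piv' = block_mx (complproj V piv) 0 0 1%:M.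
  rewrite /complproj VE' E'E mul_col_mx mul_col_row !mulmx0 !mul0mx.
  by rewrite scalar_mx_block opp_block_mx add_block_mx !oppr0 !addr0.
exists w', k, V', piv'; rewrite VE'; split=> //.
- move=> i j; rewrite /w'; case: splitP => i' ii'; case: splitP => j' jj' /eqP.
  + rewrite (inj_eq (@rshift_inj _ _)) => /eqP ij.
    by apply/val_inj; rewrite /= ii' jj' ij.
  + by rewrite -val_eqE /= gtn_eqF // ltn_addr.
  + by rewrite -val_eqE /= ltn_eqF // ltn_addr.
  + rewrite (inj_eq (@lshift_inj _ _)) (inj_eq injw) (inj_eq (@lshift_inj _ _)).
    by move=> /eqP ij; apply/val_inj; rewrite /= ii' jj' ij.
- by move=> a j; rewrite mxE; case: (fintype.split j) => j'; rewrite ?mxE.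
- rewrite Qf'E; split=> [i j|i x].
    rewrite /w' -[i in LHS]splitK -[j in LHS]splitK.
    case: (fintype.split i) => i'; case: (fintype.split j) => j' /=.
    + by rewrite block_mxEul block_mxEdr.
    + by rewrite block_mxEur block_mxEdl !mxE.
    + by rewrite block_mxEdl block_mxEur !mxE.
    + by rewrite block_mxEdr block_mxEul -QE block_mxEul.
  rewrite -[x]splitK /w'; case: (fintype.split i) => i'; case: (fintype.split x) => x' /= xw.
  + by rewrite block_mxEdl mxE.
  + rewrite block_mxEdr mxE; have [ix|//] := eqVneq i' x'; case/codomP: xw.
    by exists (lshift N x'); rewrite /w' (unsplitK (inl x')).
  + rewrite block_mxEul; have [/codomP[z zE]|] := boolP (x' \in codom w); last exact: Qout.
    rewrite zE -QE -[z]splitK; move: zE; rewrite -{1}[z]splitK.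
    case: (fintype.split z) => z' /= zE; last by rewrite block_mxEur mxE.
    case/codomP: xw; exists (rshift N z').
    by rewrite /w' (unsplitK (inr z')) zE.
  + by rewrite block_mxEur mxE.
Qed.

(** The unknowns preceding the first step are forced to be zero by the rows of an identity matrix,
    whose minor is 1. *)
Lemma windowed_start (okE : F -> Prop) N : okE 0 -> okE 1 ->
  windowed okE (N + N) 1 (block_mx (1%:M : 'M[F]_N) (0 : 'M[F]_N) (0 : 'M[F]_N) (0 : 'M[F]_N)).
Proof.
move=> ok0 ok1.
pose V : 'M[F]_(N, N + N) := row_mx 0 1%:M.
pose piv (b : 'I_N) := rshift N b.
have EE : pivmx piv = col_mx 0 1%:M.
  apply/matrixP=> i b; rewrite !mxE /piv; case: splitP => i' ii'.
    by rewrite !mxE -val_eqE /= ii' ltn_eqF // ltn_addr.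
  by rewrite !mxE -!val_eqE /= ii' eqn_add2l.
have VE : V *m pivmx piv = 1%:M by rewrite EE mul_row_col mul0mx add0r mulmx1.
have QE : complproj V piv = block_mx 1%:M 0 0 0.
  rewrite /complproj VE invmx1 mulmx1 EE mul_col_row !mulmx0 !mul0mx mulmx1.
  by rewrite scalar_mx_block opp_block_mx add_block_mx !oppr0 !addr0 subrr.
exists id, N, V, piv; rewrite VE unitmx1 det1 QE; split=> //.
- by move=> a j; rewrite mxE; case: (fintype.split j) => j'; rewrite mxE //; case: eqP.
- by split=> // i x /codomP[]; exists x.
Qed.

End Elimination.

Lemma fact_leq_exp n : (n`! <= n ^ n)%N.
Proof.
have -> : (n ^ n = \prod_(i < n) n)%N by rewrite prod_nat_const card_ord.
rewrite fact_prod big_add1 big_mkord.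
by apply: leq_prod => i _; exact: ltn_ord.
Qed.

(** * Integrality and size of minors and of projection numerators *)

Section MinorBounds.
Variables (F : fieldType) (R : realFieldType) (G : F -> Prop) (nm : F -> R).
Hypotheses (G0 : G 0) (G1 : G 1) (GD : forall x y, G x -> G y -> G (x + y)).
Hypotheses (GN : forall x, G x -> G (- x)) (GM : forall x y, G x -> G y -> G (x * y)).
Hypotheses (nm0 : nm 0 = 0) (nm1 : nm 1 = 1) (nm_ge0 : forall x, 0 <= nm x).
Hypotheses (nmD : forall x y, nm (x + y) <= nm x + nm y).
Hypotheses (nmN : forall x, nm (- x) = nm x) (nmM : forall x y, nm (x * y) = nm x * nm y).

Lemma G_sum (I : Type) (r : seq I) (P : pred I) (f : I -> F) :
  (forall i, P i -> G (f i)) -> G (\sum_(i <- r | P i) f i).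
Proof. by move=> Gf; apply: big_ind. Qed.

Lemma nm_sum (I : finType) (f : I -> F) (b : R) :
  (forall i, nm (f i) <= b) -> nm (\sum_i f i) <= #|I|%:R * b.
Proof.
move=> fb; have -> : #|I|%:R * b = \sum_(i : I) b by rewrite sumr_const mulr_natl.
elim/big_ind2: _ => [|x1 x2 y1 y2 h1 h2|i _]; rewrite ?nm0 ?fb //.
by apply: le_trans (nmD _ _) _; apply: lerD.
Qed.

Lemma nm_sign (b : bool) : nm ((-1) ^+ b) = 1.
Proof. by case: b; rewrite ?expr1 ?expr0 ?nmN nm1. Qed.

Lemma G_det n (A : 'M[F]_n) : (forall i j, G (A i j)) -> G (\det A).
Proof.
move=> GA; apply: G_sum => s _; apply: GM.
  by case: (odd_perm s); rewrite ?expr1 ?expr0; [apply: GN|].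
by apply: big_ind => //.
Qed.

Lemma nm_det n (A : 'M[F]_n) (H : R) :
  (forall i j, nm (A i j) <= H) -> nm (\det A) <= n`!%:R * H ^+ n.
Proof.
move=> AH; rewrite -card_Sn.
apply: nm_sum => s; rewrite nmM nm_sign mul1r.
have -> : H ^+ n = \prod_(i < n) H by rewrite prodr_const card_ord.
have -> : nm (\prod_(i < n) A i (s i)) = \prod_(i < n) nm (A i (s i)).
  by elim/big_rec2: _ => [|i x y _ <-]; rewrite ?nm1 ?nmM.
by apply: ler_prod => i _; rewrite nm_ge0 AH.
Qed.

(** Cramer's rule writes a numerator as [\det M] times an entry of the identity, minus a sum of
    cofactors times entries of [V]. The first part is at most [k! H^k] and the sum over the [k]
    pivots at most [k] times that, which gives [(k+1)! H^k]. *)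
Lemma windowed_bounds (H : R) D W dl (Q : 'M[F]_W) (Z := (D.+1 ^ D.+1)%:R * H ^+ D) :
  1 <= H -> windowed (fun z => G z /\ nm z <= H) D dl Q ->
  [/\ dl != 0, G dl, nm dl <= Z &
      forall i j, G (dl * Q i j) /\ nm (dl * Q i j) <= Z].
Proof.
move=> H1 [w [k [V [piv [_ okV uVE -> [QE _]]]]]].
set M := V *m pivmx F piv in uVE *.
have H0 : 0 <= H by apply: le_trans H1.
have ME a b : M a b = V a (piv b).
  rewrite mxE (bigD1 (piv b)) //= mxE eqxx mulr1 big1 ?addr0 // => x /negPf.
  by rewrite mxE => ->; rewrite mulr0.
have okM a b : G (M a b) /\ nm (M a b) <= H by rewrite ME.
have kD : (k <= D)%N.
  rewrite -(mxrank_unit uVE); apply: leq_trans (mxrankM_maxl _ _) _.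
  exact: rank_leq_col.
have GM' : G (\det M) by apply: G_det => a b; case: (okM a b).
have nM : nm (\det M) <= k`!%:R * H ^+ k by apply: nm_det => a b; case: (okM a b).
have kZ : k.+1%:R * (k`!%:R * H ^+ k) <= Z.
  rewrite mulrA -natrM -factS /Z ler_pM ?ler0n ?exprn_ge0 //.
    rewrite ler_nat; apply: leq_trans (fact_leq_exp _) _.
    apply: (@leq_trans (D.+1 ^ k.+1)); first by rewrite leq_exp2r.
    by rewrite leq_pexp2l.
  by apply: ler_weXn2l.
have b0 : 0 <= k`!%:R * H ^+ k by rewrite mulr_ge0 ?exprn_ge0 ?ler0n.
split=> //.
- by rewrite -unitfE -unitmxE.
- by apply: le_trans nM _; apply: le_trans kZ; rewrite ler_peMl // ler1n.
move=> i j; rewrite QE; set x := w i; set y := w j.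
have -> : \det M * complproj V piv x y =
    \det M * (x == y)%:R + - \sum_b \sum_a pivmx F piv x b * (\adj M b a * V a y).
  rewrite /complproj /invmx -/M uVE -mulmxA -scalemxAl -scalemxAr mxE mulrDr.
  rewrite !mxE; congr (_ + _); rewrite mulrN mulrA.
  rewrite divff ?mul1r; last by rewrite -unitfE -unitmxE.
  congr (- _); apply: eq_bigr => b _.
  by rewrite [(_ *m V) b y]mxE mulr_sumr.
have okE b : G (pivmx F piv x b) /\ nm (pivmx F piv x b) <= 1.
  by rewrite mxE; case: eqP => _ /=; rewrite ?nm1 ?nm0 ?ler01.
have Gadj b a : G (\adj M b a).
  rewrite mxE; apply: GM; first by elim: (_ + _)%N => [|m IHm];
    rewrite ?expr0 ?exprS //; apply: GM => //; apply: GN.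
  by apply: G_det => a' b'; rewrite mxE mxE; apply: (okM _ _).1.
split.
  apply: GD; first by apply: GM => //; case: eqP.
  apply/GN/G_sum => b _; apply: G_sum => a _; apply: GM; first by case: (okE b).
  by apply: GM => //; case: (okV a y).
apply: le_trans (nmD _ _) _; apply: le_trans kZ; rewrite -natr1 mulrDl mul1r addrC.
apply: lerD; last first.
  apply: le_trans nM.
  rewrite nmM -[leRHS]mulr1 ler_wpM2l //; case: eqP; rewrite ?nm1 ?nm0 ?ler01 //.
rewrite nmN; apply: le_trans (nm_sum (b := k`!%:R * H ^+ k) _) _; last by rewrite card_ord.
move=> b; have k0 : (0 < k)%N := leq_ltn_trans (leq0n b) (ltn_ord b).
have -> : k`!%:R * H ^+ k = k%:R * (k.-1`!%:R * H ^+ k.-1 * H).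
  by rewrite -[in LHS](prednK k0) factS natrM exprSr prednK // !mulrA.
apply: le_trans (nm_sum (b := k.-1`!%:R * H ^+ k.-1 * H) _) _; last by rewrite card_ord.
move=> a; rewrite !nmM -[leRHS]mul1r ler_pM ?mulr_ge0 //; first by case: (okE b).
rewrite ler_pM //; last by case: (okV a y).
rewrite mxE nmM -signr_odd nm_sign mul1r; apply: nm_det => a' b'.
by rewrite mxE mxE; apply: (okM _ _).2.
Qed.

End MinorBounds.

(** * Blow-ups attaining the supremum *)

Section RowSpaces.
Variable F : fieldType.

Lemma sub_preim q1 q2 m n (Y : 'M[F]_(q1, m)) (K : 'M[F]_(q2, m)) (B : 'M[F]_(m, n)) :
  (kermx B <= K)%MS -> (Y *m B <= K *m B)%MS -> (Y <= K)%MS.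
Proof.
move=> kK /submxP[D YB]; rewrite -[Y](subrK (D *m K)) addmx_sub ?submxMl //.
by apply: submx_trans kK; apply/sub_kermxP; rewrite mulmxBl YB mulmxA subrr.
Qed.

Lemma rank_adds_gt q q' n (M : 'M[F]_(q, n)) (x : 'M[F]_(q', n)) :
  ~~ (x <= M)%MS -> (\rank M < \rank (M + x)%MS)%N.
Proof.
move=> xM; rewrite ltn_neqAle mxrankS ?addsmxSl // andbT; apply: contra xM => /eqP rE.
have [_] := mxrank_leqif_sup (addsmxSl M x); rewrite rE eqxx => /esym.
exact: submx_trans (addsmxSr M x).
Qed.

(** As [S] is an arbitrary predicate, the spanning rows are found classically: while a vector of [S]
    is missing, it is added, and the codimension drops. *)
Lemma exists_span n (S : 'rV[F]_n -> Prop) :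
  exists q (M : 'M[F]_(q, n)), (forall i, S (row i M)) /\ forall x, S x -> (x <= M)%MS.
Proof.
suff main k : forall q (M : 'M[F]_(q, n)), (forall i, S (row i M)) ->
    (n - \rank M <= k)%N ->
    exists q (M : 'M[F]_(q, n)), (forall i, S (row i M)) /\ forall x, S x -> (x <= M)%MS.
  by apply: (main n 0%N 0); rewrite ?leq_subr // => -[].
elim: k => [|k IHk] q M SM rM; have [[x [Sx /negP xM]]|noX] :=
    pselect (exists x, S x /\ ~ (x <= M)%MS);
  try by exists q, M; split=> // x Sx; have [//|xM] := boolP (x <= M)%MS;
         case: noX; exists x; split=> //; apply/negP.
all: have := rank_adds_gt xM; rewrite addsmxE => M_lt.
all: have := rank_leq_col (col_mx M x).
  by move=> rx; lia.
move=> rx; apply: (IHk _ (col_mx M x)); last by lia.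
move=> i; rewrite -(splitK i); case: (fintype.split i) => j /=.
  by rewrite -(row_usubmx (m1 := q)) col_mxKu.
by rewrite -(row_dsubmx (m2 := 1)) col_mxKd (ord1 j) row_id.
Qed.

Lemma rank_ublock_ge n (B C : 'M[F]_n) :
  (\rank B + \rank B <= \rank (block_mx B C 0 B))%N.
Proof.
set M := block_mx _ _ _ _; pose P : 'M[F]_(n + n, n) := col_mx 1%:M 0.
rewrite -(mxrank_mul_ker M P) leq_add //.
  by rewrite mul_block_col !mulmx1 !mulmx0 !addr0 rank_col_mx0.
rewrite -[\rank B in X in (X <= _)%N](rank_row_0mx n) mxrankS // sub_capmx.
apply/andP; split; last by apply/sub_kermxP; rewrite mul_row_col mul0mx mulmx0 addr0.
have -> : row_mx 0 B = row_mx 0 1%:M *m M.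
  by rewrite mul_row_block !mul0mx !mul1mx !add0r.
exact: submxMl.
Qed.

(** The first block column has rank [\rank B]. The vectors of the row space that vanish there
    include [(0, B)] and, because [x B = 0], also [(0, x C)], which adds a dimension. *)
Lemma rank_ublock_gt n (B C : 'M[F]_n) (x : 'rV[F]_n) :
  x *m B = 0 -> ~~ (x *m C <= B)%MS ->
  (\rank B + \rank B < \rank (block_mx B C 0 B))%N.
Proof.
move=> xB xC; set M := block_mx _ _ _ _; pose P : 'M[F]_(n + n, n) := col_mx 1%:M 0.
rewrite -(mxrank_mul_ker M P) -addnS leq_add //.
  by rewrite mul_block_col !mulmx1 !mulmx0 !addr0 rank_col_mx0.
apply: (@leq_trans (\rank (B + x *m C)%MS)).
  exact: rank_adds_gt.
rewrite addsmxE -(rank_row_0mx n) mxrankS // sub_capmx.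
apply/andP; split; last by apply/sub_kermxP; rewrite mul_row_col mul0mx mulmx0 addr0.
have -> : row_mx 0 (col_mx B (x *m C)) = col_mx (row_mx 0 1%:M) (row_mx x 0) *m M.
  rewrite mul_col_mx !mul_row_block !mul0mx !mul1mx ?mulmx0 ?addr0 ?add0r xB.
  by rewrite -block_mxEv block_mxEh col_mx0.
exact: submxMl.
Qed.

End RowSpaces.

(** * Subspaces closed under blow-ups, and Wong sequences *)

Section Blowups.
Variables (F : fieldType) (n p : nat) (a : 'I_p -> 'M[F]_n).

(* Subspaces are row spaces acted upon from the right, so that [a t] stands for
   the transpose of the matrix [A_t] of the input. *)
Definition act (U : 'M[F]_n) : 'M[F]_n := (\sum_(t < p) U *m a t)%MS.

Lemma act_subP q (U : 'M[F]_n) (W : 'M[F]_(q, n)) :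
  reflect (forall t, (U *m a t <= W)%MS) (act U <= W)%MS.
Proof. by apply: (iffP sumsmx_subP) => h t; [apply: h|move=> _; apply: h]. Qed.

Definition slice d (b : 'I_d) : 'M[F]_(n * d, n) :=
  \matrix_(k, j) (k == mxtens_index (j, b))%:R.

(** The smallest [S] such that [S (x) C^d] contains [K]. *)
Definition slices d q (K : 'M[F]_(q, n * d)) : 'M[F]_n :=
  (\sum_(b < d) <<K *m slice b>>)%MS.

Lemma mxtens_index_eq m d (i i' : 'I_m) (b b' : 'I_d) :
  (mxtens_index (i, b) == mxtens_index (i', b')) = (i == i') && (b == b').
Proof. by rewrite (can_eq (@mxtens_indexK m d)). Qed.

Lemma mul_sliceT d q (S : 'M[F]_(q, n)) (b b' : 'I_d) i j :
  (S *m (slice b)^T) i (mxtens_index (j, b')) = S i j *+ (b == b').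
Proof.
rewrite mxE (bigD1 j) //= big1 => [|k kj]; rewrite !mxE mxtens_index_eq.
  by rewrite addr0 eqxx /= mulr_natr eq_sym.
by rewrite eq_sym (negPf kj) mulr0.
Qed.

Lemma mul_slice d q (K : 'M[F]_(q, n * d)) (b : 'I_d) i j :
  (K *m slice b) i j = K i (mxtens_index (j, b)).
Proof.
rewrite mxE (bigD1 (mxtens_index (j, b))) //= big1 => [|k kj]; rewrite !mxE.
  by rewrite eqxx mulr1 addr0.
by rewrite (negPf kj) mulr0.
Qed.

Lemma slice_sum d q (K : 'M[F]_(q, n * d)) :
  K = \sum_b K *m slice b *m (slice b)^T.
Proof.
apply/matrixP=> i k; case: (mxtens_indexP k) => j b; rewrite summxE.
rewrite (bigD1 b) //= big1 => [|b' b'b]; rewrite mul_sliceT mul_slice.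
  by rewrite addr0 eqxx.
by rewrite (negPf b'b).
Qed.

Lemma tens_row d q (S : 'M[F]_(q, n)) i (b : 'I_d) :
  row (mxtens_index (i, b)) (S *t (1%:M : 'M[F]_d)) = row i (S *m (slice b)^T).
Proof.
apply/rowP=> k; case: (mxtens_indexP k) => j b'.
by rewrite [LHS]mxE tensmxE [RHS]mxE mul_sliceT mxE mulr_natr.
Qed.

Lemma tens1_subP d q q' (S : 'M[F]_(q, n)) (V : 'M[F]_(q', n * d)) :
  reflect (forall b : 'I_d, (S *m (slice b)^T <= V)%MS) (S *t (1%:M : 'M[F]_d) <= V)%MS.
Proof.
apply: (iffP row_subP) => h.
  by move=> b; apply/row_subP=> i; rewrite -tens_row.
by move=> k; case: (mxtens_indexP k) => i b; rewrite tens_row (submx_trans _ (h b)) ?row_sub.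
Qed.

Lemma tens_sub d q q' k (S : 'M[F]_(q, n)) (S' : 'M[F]_(q', n)) (X : 'M[F]_(k, d)) :
  (S <= S')%MS -> (S *t X <= S' *t (1%:M : 'M[F]_d))%MS.
Proof.
by case/submxP=> D ->; rewrite -[X]mulmx1 -tensmx_mul submxMl.
Qed.

Lemma tens_subE d q q' (S : 'M[F]_(q, n)) (S' : 'M[F]_(q', n)) : (0 < d)%N ->
  (S *t (1%:M : 'M[F]_d) <= S' *t (1%:M : 'M[F]_d))%MS = (S <= S')%MS.
Proof.
move=> d0; apply/idP/idP; last exact: tens_sub.
move/tens1_subP/(_ (Ordinal d0)); rewrite -[X in (X <= _)%MS]mulmx1.
case/submxP=> D; rewrite mulmx1 => DE.
have : S *m (slice (Ordinal d0))^T *m slice (Ordinal d0) = S.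
  by apply/matrixP=> i j; rewrite mul_slice mul_sliceT eqxx.
move=> <-; rewrite DE -mulmxA mulmx_sub //; apply/row_subP=> k.
case: (mxtens_indexP k) => i b.
have -> : row (mxtens_index (i, b)) ((S' *t 1%:M) *m slice (Ordinal d0)) =
    row i S' *+ (b == Ordinal d0).
  by apply/rowP=> j; rewrite mxE mul_slice tensmxE mulmxnE !mxE mulr_natr.
by case: eqP => _; rewrite ?sub0mx ?row_sub.
Qed.

Lemma tens11 m d : (1%:M : 'M[F]_m) *t (1%:M : 'M[F]_d) = 1%:M.
Proof.
apply/matrixP=> i j; case: (mxtens_indexP i) => i1 i2; case: (mxtens_indexP j) => j1 j2.
by rewrite tensmxE !mxE mxtens_index_eq -natrM mulnb.
Qed.

Lemma rank_tens1 d q (S : 'M[F]_(q, n)) : \rank (S *t (1%:M : 'M[F]_d)) = (\rank S * d)%N.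
Proof.
have -> : \rank (S *t (1%:M : 'M[F]_d)) = \rank (row_base S *t (1%:M : 'M[F]_d)).
  by apply/eqP; rewrite eqn_leq !mxrankS ?tens_sub ?eq_row_base.
apply/eqP; rewrite -/(row_free _); apply/row_freeP.
have /row_freeP[D SD] := row_base_free S.
by exists (D *t 1%:M); rewrite tensmx_mul SD mulmx1 tens11.
Qed.

Lemma sub_slices d q (K : 'M[F]_(q, n * d)) :
  (K <= slices K *t (1%:M : 'M[F]_d))%MS.
Proof.
rewrite {1}[K]slice_sum; apply: summx_sub => b _.
have /tens1_subP/(_ b) := submx_refl (slices K *t (1%:M : 'M[F]_d)).
apply: submx_trans; apply: submxMr.
by apply: submx_trans (sumsmx_sup b _ _) => //; rewrite genmxE.
Qed.

Local Notation bl := (blowup a).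

Lemma tens_delta (A : 'M[F]_n) d (b b' : 'I_d) :
  A *t delta_mx b b' = slice b *m A *m (slice b')^T.
Proof.
apply/matrixP=> i j; case: (mxtens_indexP i) => i1 i2; case: (mxtens_indexP j) => j1 j2.
rewrite tensmxE mul_sliceT mxE [RHS](_ : _ = (slice b *m A) (mxtens_index (i1, i2)) j1 *+ (b' == j2)) //.
rewrite mxE (bigD1 i1) //= big1 => [|k ki]; rewrite !mxE mxtens_index_eq.
  rewrite addr0 eqxx /= [b' == _]eq_sym.
  by case: (i2 == b); case: (j2 == b'); rewrite ?(mulr1, mulr0, mul1r, mul0r, mulr0n, mulr1n).
by rewrite eq_sym (negPf ki) mul0r.
Qed.

(** Tuples with a single nonzero member, a matrix unit, move the slice [b] of [K] by one [a t] into
    any slice [b']; these images span the left side. *)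
Lemma act_slices_sub d q q' (K : 'M[F]_(q, n * d)) (V : 'M[F]_(q', n * d)) :
  (forall X, (K *m bl X <= V)%MS) -> (act (slices K) *t (1%:M : 'M[F]_d) <= V)%MS.
Proof.
move=> KV; apply/tens1_subP=> b'.
suff main t : (slices K *m a t *m (slice b')^T <= V)%MS.
  rewrite /act; elim/big_rec: _ => [|t x _ IH]; first by rewrite mul0mx sub0mx.
  by rewrite addsmxMr addsmx_sub main.
rewrite -mulmxA /slices sumsmxMr_gen; apply/sumsmx_subP=> b _.
rewrite genmxE (eqmxMr _ (genmxE _)).
pose X t' : 'M[F]_d := if t' == t then delta_mx b b' else 0.
have := KV X; rewrite /blowup (bigD1 t) //= big1 ?addr0 => [|t' t't]; last first.
  by rewrite /X (negPf t't) tensmx0.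
by rewrite /X eqxx tens_delta !mulmxA.
Qed.

Lemma tens_bl_sub d (S : 'M[F]_n) (X : 'I_p -> 'M[F]_d) :
  (S *t (1%:M : 'M[F]_d) *m bl X <= act S *t (1%:M : 'M[F]_d))%MS.
Proof.
rewrite mulmx_sumr; apply: summx_sub => t _.
by rewrite tensmx_mul mul1mx tens_sub //; exact/act_subP.
Qed.

Definition blowup_closed d (X0 : 'I_p -> 'M[F]_d) q (K : 'M[F]_(q, n * d)) :=
  (kermx (bl X0) <= K)%MS /\ forall X, (K *m bl X <= K *m bl X0)%MS.

(** Let [S = slices K]. Matrix units put [act S (x) C^d] inside [K B], and [B] maps [S (x) C^d] into
    [act S (x) C^d]. Since [K] contains [ker B], it contains every vector whose image lies in [K B],
    hence [S (x) C^d]. *)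
Lemma closed_tens d (X0 : 'I_p -> 'M[F]_d) q (K : 'M[F]_(q, n * d)) : blowup_closed X0 K ->
  (K :=: slices K *t (1%:M : 'M[F]_d))%MS /\
  (K *m bl X0 :=: act (slices K) *t (1%:M : 'M[F]_d))%MS.
Proof.
case=> kK cK; have aK := act_slices_sub cK.
have sK : (slices K *t (1%:M : 'M[F]_d) <= K)%MS.
  by apply: (sub_preim kK); apply: submx_trans (tens_bl_sub _ _) aK.
split; apply/eqmxP; first by rewrite sub_slices sK.
rewrite aK andbT; apply: submx_trans (tens_bl_sub _ X0).
by rewrite submxMr ?sub_slices.
Qed.

(** Rank and nullity of [B] restricted to [K], whose kernel is all of [ker B]; both [K] and [K B]
    are tensor products with [C^d]. *)
Lemma closed_rank d (X0 : 'I_p -> 'M[F]_d) q (K : 'M[F]_(q, n * d)) : blowup_closed X0 K ->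
  (\rank (slices K) * d + \rank (bl X0) = \rank (act (slices K)) * d + n * d)%N.
Proof.
move=> cK; have [KE KBE] := closed_tens cK; have := mxrank_mul_ker K (bl X0).
have -> : \rank (K :&: kermx (bl X0))%MS = (n * d - \rank (bl X0))%N.
  by rewrite -mxrank_ker; apply/eqP; rewrite eqn_leq !mxrankS ?capmxSr // sub_capmx submx_refl cK.1.
rewrite KBE [in RHS]KE !rank_tens1 => <-.
by rewrite -addnA subnK // rank_leq_row.
Qed.

(** A vector of [K] whose image lies in [K' B] belongs to [K'], because [K'] contains [ker B]. *)
Lemma closed_cap d (X0 : 'I_p -> 'M[F]_d) (K K' : 'M[F]_(n * d)) :
  blowup_closed X0 K -> blowup_closed X0 K' -> blowup_closed X0 (K :&: K')%MS.
Proof.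
move=> [kK cK] [kK' cK']; split=> [|X]; first by rewrite sub_capmx kK kK'.
have /submxP[D DE] : ((K :&: K')%MS *m bl X <= K *m bl X0)%MS.
  by apply: submx_trans (cK X); rewrite submxMr ?capmxSl.
have h : (D *m K <= K :&: K')%MS.
  rewrite sub_capmx submxMl; apply: (sub_preim kK'); rewrite -mulmxA -DE.
  by apply: submx_trans (cK' X); rewrite submxMr ?capmxSr.
by rewrite DE mulmxA submxMr.
Qed.

Lemma closed_min d (X0 : 'I_p -> 'M[F]_d) (K0 : 'M[F]_(n * d)) : blowup_closed X0 K0 ->
  exists2 K : 'M[F]_(n * d), blowup_closed X0 K &
    forall K' : 'M[F]_(n * d), blowup_closed X0 K' -> (K <= K')%MS.
Proof.
move=> cK0; pose Pr r := `[< exists2 K : 'M[F]_(n * d), blowup_closed X0 K & \rank K = r >].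
have exr : exists r, Pr r by exists (\rank K0); apply/asboolP; exists K0.
case: (ex_minnP exr) => r /asboolP[K cK rK] rmin; exists K => // K' cK'.
have := rmin (\rank (K :&: K')%MS); rewrite -rK => rle.
have : (K <= K :&: K')%MS.
  have [_ <-] := mxrank_leqif_sup (capmxSl K K').
  rewrite eqn_leq mxrankS ?capmxSl // rle //; apply/asboolP.
  by exists (K :&: K')%MS => //; exact: closed_cap.
by rewrite sub_capmx => /andP[].
Qed.

Definition is_ncrank r :=
  (exists U : 'M[F]_n, r = (n - \rank U + \rank (act U))%N) /\
  forall U : 'M[F]_n, (r <= n - \rank U + \rank (act U))%N.

Definition is_min_shrunk c (U : 'M[F]_n) :=
  (c + \rank (act U) <= \rank U)%N /\
  forall V : 'M[F]_n, (c + \rank (act V) <= \rank V)%N -> (U <= V)%MS.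

Lemma bl_rank_le r d (X : 'I_p -> 'M[F]_d) : is_ncrank r -> (\rank (bl X) <= r * d)%N.
Proof.
case=> -[U ->] _; have := mxrank_mul_min (U *t (1%:M : 'M[F]_d)) (bl X).
have := mxrankS (tens_bl_sub U X); rewrite !rank_tens1.
have : (\rank U * d <= n * d)%N by rewrite leq_mul2r rank_leq_col orbT.
rewrite mulnDl mulnBl; move: (\rank (bl X)) (\rank (_ *m _)).
by move: (\rank U * d)%N (\rank (act U) * d)%N (n * d)%N => u v m x y; lia.
Qed.

Lemma is_ncrank_le r : is_ncrank r -> (r <= n)%N.
Proof. by case=> _ /(_ 0); rewrite /act big1 ?mxrank0 ?subn0 ?addn0 // => t _; rewrite mul0mx. Qed.

Lemma closed_is_ncrank r d (X0 : 'I_p -> 'M[F]_d) (K : 'M[F]_(n * d)) :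
  is_ncrank r -> blowup_closed X0 K -> \rank (bl X0) = (r * d)%N.
Proof.
move=> hr cK; apply/eqP; rewrite eqn_leq bl_rank_le //=.
have := closed_rank cK; case: hr => _ /(_ (slices K)).
by have := rank_leq_col (slices K); nia.
Qed.

(** [B] maps [V (x) C^d] into [act V (x) C^d] and so loses at least [(n - r) d] dimensions, which is
    the dimension of [ker B]. Equality throughout puts [ker B] inside and makes the image all of
    [act V (x) C^d], which contains the images under every blow-up. *)
Lemma shrunk_closed r d (X0 : 'I_p -> 'M[F]_d) (V : 'M[F]_n) :
  is_ncrank r -> \rank (bl X0) = (r * d)%N ->
  (n - r + \rank (act V) <= \rank V)%N -> blowup_closed X0 (V *t (1%:M : 'M[F]_d)).
Proof.
move=> hr rB sV; have rn := is_ncrank_le hr.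
have aV := tens_bl_sub V X0; have rkB := mxrank_ker (bl X0).
have := mxrank_mul_ker (V *t (1%:M : 'M[F]_d)) (bl X0); rewrite rank_tens1 => rV.
have := mxrankS aV; rewrite rank_tens1 => raV.
have rcap := mxrankS (capmxSr (V *t (1%:M : 'M[F]_d)) (kermx (bl X0))).
have sVd : (n * d - r * d + \rank (act V) * d <= \rank V * d)%N.
  by rewrite -mulnBl -mulnDl leq_mul2r sV orbT.
have ecap : \rank (V *t (1%:M : 'M[F]_d) :&: kermx (bl X0))%MS = \rank (kermx (bl X0)).
  move: rcap rkB rV raV sVd; rewrite rB.
  move: (\rank (kermx _)) (\rank (_ :&: _)%MS) (\rank (_ *m _)).
  by move: (\rank V * d)%N (\rank (act V) * d)%N (n * d)%N (r * d)%N => *; lia.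
split.
  have [_ ] := mxrank_leqif_sup (capmxSr (V *t (1%:M : 'M[F]_d)) (kermx (bl X0))).
  by rewrite ecap eqxx sub_capmx => /esym/andP[].
move=> X; apply: submx_trans (tens_bl_sub V X) _.
by have [_ <-] := mxrank_leqif_sup aV; rewrite rank_tens1 eqn_leq raV /=;
move: rkB rV sVd; rewrite ecap rB;
move: (\rank (kermx _)) (\rank (_ *m _));
move: (\rank V * d)%N (\rank (act V) * d)%N (n * d)%N (r * d)%N => *; lia.
Qed.

Lemma closed_shrunk r d (X0 : 'I_p -> 'M[F]_d) (K : 'M[F]_(n * d)) :
  (0 < d)%N -> is_ncrank r -> blowup_closed X0 K ->
  (n - r + \rank (act (slices K)) <= \rank (slices K))%N.
Proof.
move=> d0 hr cK; have := closed_rank cK; rewrite (closed_is_ncrank hr cK).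
by have := is_ncrank_le hr; nia.
Qed.

Lemma min_shrunk_closed r d (X0 : 'I_p -> 'M[F]_d) U :
  (0 < d)%N -> is_ncrank r -> \rank (bl X0) = (r * d)%N -> is_min_shrunk (n - r) U ->
  blowup_closed X0 (U *t (1%:M : 'M[F]_d)) /\
  forall K : 'M[F]_(n * d), blowup_closed X0 K -> (U *t (1%:M : 'M[F]_d) <= K)%MS.
Proof.
move=> d0 hr rB [sU mU]; split; first exact: shrunk_closed hr rB sU.
move=> K cK; have [KE _] := closed_tens cK; rewrite KE tens_sub //.
exact: mU (closed_shrunk d0 hr cK).
Qed.

Lemma exists_min_shrunk r d (X0 : 'I_p -> 'M[F]_d) (K0 : 'M[F]_(n * d)) :
  (0 < d)%N -> is_ncrank r -> blowup_closed X0 K0 -> exists U, is_min_shrunk (n - r) U.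
Proof.
move=> d0 hr cK0; have [K cK mK] := closed_min cK0.
exists (slices K); split; first exact: closed_shrunk hr cK.
move=> V sV; have cV := shrunk_closed hr (closed_is_ncrank hr cK0) sV.
have [KE _] := closed_tens cK; rewrite -(tens_subE _ _ d0) -KE.
apply: submx_trans (mK <<V *t 1%:M>>%MS _) _; last by rewrite genmxE.
case: cV => kV cV; split; first by rewrite genmxE.
by move=> X; rewrite !(eqmxMr _ (genmxE _)).
Qed.

(** The comparison of the ratios of rank and size, cross-multiplied so that it makes sense over any
    field and needs no supremum. *)
Definition attaining d (X0 : 'I_p -> 'M[F]_d) :=
  forall d' (X : 'I_p -> 'M[F]_d'), (\rank (bl X) * d <= \rank (bl X0) * d')%N.

Fixpoint wong d (X0 : 'I_p -> 'M[F]_d) l (x : 'rV[F]_(n * d)) : Prop :=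
  if l is l'.+1 then exists X x', wong X0 l' x' /\ x *m bl X0 = x' *m bl X
  else x *m bl X0 = 0.

Definition noX d (t : 'I_p) : 'M[F]_d := 0.

Definition dblX d (P Q R S : 'I_p -> 'M[F]_d) t : 'M[F]_(d + d) :=
  block_mx (P t) (Q t) (R t) (S t).

(** The tensor indexing interleaves the two halves of [C^(2d)]. Only after this permutation does a
    blow-up by block matrices become a block matrix of blow-ups. *)
Definition dbl_perm d : 'M[F]_(n * d + n * d, n * (d + d)) :=
  col_mx ((1%:M : 'M[F]_n) *t (row_mx 1%:M 0 : 'M[F]_(d, d + d)))
         ((1%:M : 'M[F]_n) *t (row_mx 0 1%:M : 'M[F]_(d, d + d))).

Lemma tensmxDr q q' (A : 'M[F]_n) (X Y : 'M[F]_(q, q')) :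
  A *t (X + Y) = A *t X + A *t Y :> 'M[F]_(n * q, n * q').
Proof.
apply/matrixP=> i j; case: (mxtens_indexP i) => i1 i2; case: (mxtens_indexP j) => j1 j2.
by rewrite [RHS]mxE !tensmxE mxE mulrDr.
Qed.

Lemma dbl_permK d : (dbl_perm d)^T *m dbl_perm d = 1%:M.
Proof.
rewrite tr_col_mx !trmx_tens mul_row_col !tensmx_mul !trmx1 !mulmx1.
rewrite !tr_row_mx !trmx1 !trmx0 !mul_col_row ?mulmx1 ?mulmx0 ?mul0mx.
by rewrite -tensmxDr // add_block_mx !addr0 !add0r -scalar_mx_block tens11.
Qed.

Lemma dbl_perm_bl d (P Q R S : 'I_p -> 'M[F]_d) :
  dbl_perm d *m bl (dblX P Q R S) *m (dbl_perm d)^T =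
  block_mx (bl P) (bl Q) (bl R) (bl S).
Proof.
have E (A : 'M[F]_n) (e1 e2 : 'M[F]_(d, d + d)) t :
    (1%:M *t e1) *m (A *t dblX P Q R S t) *m (1%:M *t e2)^T =
    A *t (e1 *m dblX P Q R S t *m e2^T).
  by rewrite trmx_tens trmx1 !tensmx_mul !mul1mx mulmx1.
have Es (e1 e2 : 'M[F]_(d, d + d)) :
    (1%:M *t e1) *m bl (dblX P Q R S) *m (1%:M *t e2)^T =
    \sum_t a t *t (e1 *m dblX P Q R S t *m e2^T).
  by rewrite mulmx_sumr mulmx_suml; apply: eq_bigr => t _; exact: E.
rewrite /dbl_perm tr_col_mx mul_col_mx mul_col_row !Es.
by congr block_mx; apply: eq_bigr => t _; rewrite /dblX mul_row_block tr_row_mx mul_row_col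
  !trmx1 !trmx0 !mul1mx !mul0mx !mulmx1 !mulmx0 ?addr0 ?add0r.
Qed.

Lemma dbl_bl d (P Q R S : 'I_p -> 'M[F]_d) (x y : 'rV[F]_(n * d)) :
  row_mx x y *m dbl_perm d *m bl (dblX P Q R S) =
  row_mx (x *m bl P + y *m bl R) (x *m bl Q + y *m bl S) *m dbl_perm d.
Proof.
rewrite -mul_row_block -(dbl_perm_bl P Q R S) !mulmxA.
by rewrite -[RHS]mulmxA dbl_permK mulmx1.
Qed.

Lemma bl0 d : bl (noX d) = 0.
Proof. by rewrite /blowup big1 // => t _; rewrite tensmx0. Qed.

Lemma dbl_attaining d (X0 Y : 'I_p -> 'M[F]_d) : attaining X0 ->
  attaining (dblX X0 Y (noX _) X0).
Proof.
move=> aX d' X; have := aX d' X.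
have : (\rank (bl X0) + \rank (bl X0) <= \rank (bl (dblX X0 Y (noX _) X0)))%N.
  apply: leq_trans (rank_ublock_ge (bl X0) (bl Y)) _.
  rewrite -(bl0 d) -dbl_perm_bl; apply: leq_trans (mxrankM_maxl _ _) _; exact: mxrankM_maxr.
by nia.
Qed.

Lemma blD d (X Y : 'I_p -> 'M[F]_d) : bl (fun t => X t + Y t) = bl X + bl Y.
Proof.
by rewrite -big_split /=; apply: eq_bigr => t _; exact: tensmxDr.
Qed.

Lemma blZ d (X : 'I_p -> 'M[F]_d) c : bl (fun t => c *: X t) = c *: bl X.
Proof.
rewrite scaler_sumr; apply: eq_bigr => t _.
apply/matrixP=> i j; case: (mxtens_indexP i) => i1 i2; case: (mxtens_indexP j) => j1 j2.
by rewrite [RHS]mxE !tensmxE mxE mulrCA.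
Qed.

(* A Wong sequence of length [l + 1] for [X0] is one of length [l] for the doubled
   blow-up [[X0, Y], [0, X0]], which attains the supremum if [X0] does. *)
Lemma wong_dbl d (X0 : 'I_p -> 'M[F]_d) l y : wong X0 l.+1 y ->
  exists Y x P, y *m bl X0 = x *m bl P /\
    wong (dblX X0 Y (noX _) X0) l (row_mx x y *m dbl_perm d).
Proof.
elim: l y => [|l IHl] y.
  case=> X [x [xB yB]]; exists (fun t => - 1 *: X t), x, X; split=> //=.
  rewrite dbl_bl bl0 blZ xB mulmx0 addr0 yB -scalemxAr scaleN1r addNr.
  by rewrite row_mx0 mul0mx.
case=> X' [x' [wx' yB]]; have [Y [x [P [x'B wx]]]] := IHl _ wx'.
exists Y, x', X'; split=> //.
exists (dblX P (noX _) (noX _) (fun t => Y t + X' t)), (row_mx x x' *m dbl_perm d).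
split=> //; rewrite !dbl_bl !bl0 !mulmx0 !addr0 add0r x'B blD mulmxDr yB.
by [].
Qed.

(** Induction on the length for all [d] and [X0] at once, as [wong_dbl] trades one step for a
    doubled size. At length 0, a vector leaving the image would give a doubled blow-up of more than
    twice the rank of [B]. *)
Lemma wong_sub l d (X0 : 'I_p -> 'M[F]_d) x X : (0 < d)%N -> attaining X0 ->
  wong X0 l x -> (x *m bl X <= bl X0)%MS.
Proof.
elim: l d X0 x X => [|l IHl] d X0 x X d0 aX.
  move=> /= xB; apply: contraT => xX; have := rank_ublock_gt xB xX.
  rewrite -[X in block_mx _ _ X _](bl0 d) -dbl_perm_bl => /leq_trans/(_ (mxrankM_maxl _ _)).
  move=> /leq_trans/(_ (mxrankM_maxr _ _)); have := aX _ (dblX X0 X (noX _) X0); nia.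
move=> /wong_dbl[Y [x' [P [_ wx]]]].
(* With [X] in the lower left corner, [(x', x)] is sent to [(x X, 0)]; the first halves of the
   vectors in the image of the doubled blow-up lie in the image of [B]. *)
have := IHl _ _ _ (dblX (noX _) (noX _) X (noX _)) _ (dbl_attaining Y aX) wx.
rewrite addn_gt0 d0 => /(_ isT)/submxP[z].
rewrite dbl_bl bl0 !mulmx0 !add0r -[z]mulmx1 -dbl_permK mulmxA.
rewrite -[z *m _]hsubmxK dbl_bl bl0 mulmx0 addr0.
move/(congr1 (mulmxr (dbl_perm d)^T)); rewrite /= -!mulmxA.
have -> : dbl_perm d *m (dbl_perm d)^T = 1%:M.
  rewrite tr_col_mx mul_col_row !trmx_tens !tensmx_mul !trmx1 !mulmx1.
  rewrite !tr_row_mx !trmx1 !trmx0 !mul_row_col ?mulmx1 ?mulmx0 ?mul0mx ?addr0 ?add0r.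
  by rewrite !tens11 !tensmx0 -scalar_mx_block.
by rewrite !mulmx1 => /eq_row_mx[-> _]; rewrite submxMl.
Qed.

(** The span of all Wong vectors is closed: length 0 gives [ker B], and by [wong_sub] every blow-up
    of a Wong vector has a preimage under [B], which is a Wong vector again. *)
Lemma attaining_closed d (X0 : 'I_p -> 'M[F]_d) : (0 < d)%N -> attaining X0 ->
  exists K : 'M[F]_(n * d), blowup_closed X0 K.
Proof.
move=> d0 aX.
have [q [M [wM sM]]] := exists_span (fun x => exists l, wong X0 l x).
exists (genmx M); split.
  rewrite genmxE; apply/row_subP=> i; apply: sM; exists 0%N.
  by rewrite /= -row_mul mulmx_ker row0.
move=> X; rewrite !(eqmxMr _ (genmxE _)); apply/row_subP=> i; rewrite row_mul.
case: (wM i) => l wl; have /submxP[y yE] := wong_sub X d0 aX wl.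
by rewrite yE submxMr //; apply: sM; exists l.+1, X, (row i M).
Qed.

End Blowups.

Lemma rank_witness (F : fieldType) q n (A : 'M[F]_(q, n)) r : (r <= \rank A)%N ->
  exists (L : 'M[F]_(r, q)) (K : 'M[F]_(n, r)), L *m A *m K = 1%:M.
Proof.
move=> rA.
exists (pid_mx r *m invmx (col_ebase A)), (invmx (row_ebase A) *m pid_mx r).
rewrite -{2}(mulmx_ebase A) !mulmxA mulmxKV ?col_ebase_unit //.
rewrite mulmxK ?row_ebase_unit // !mul_pid_mx -(pid_mx_1 F r).
by congr pid_mx; have := rank_leq_row A; have := rank_leq_col A; lia.
Qed.

Lemma size_det_le (F : fieldType) r dg (A : 'M[{poly F}]_r) :
  (forall i j, (size (A i j) <= dg.+1)%N) -> (size (\det A) <= (r * dg).+1)%N.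
Proof.
move=> sA; apply: leq_trans (size_sum _ _ _) _; apply/bigmax_leqP => s _.
rewrite size_Msign; apply: leq_trans (size_prod_leq _ _) _; rewrite card_ord.
have : (\sum_(i < r) size (A i (s i)) <= \sum_(i < r) dg.+1)%N by apply: leq_sum.
rewrite sum_nat_const card_ord mulnS.
by move: (\sum_(i < r) _)%N (r * dg)%N => z w; lia.
Qed.

(** * Generic chains *)

Section PolyFamilies.
Variables (F : numFieldType) (N : nat).

Lemma count_roots (p : {poly F}) m : p != 0 ->
  (#|[pred j : 'I_m | (p.[(j : nat)%:R] == 0)%R]| <= (size p).-1)%N.
Proof.
move=> p0; set S := [pred j | _].
have := @max_poly_roots F p [seq (nat_of_ord j)%:R | j <- enum S] p0.
rewrite size_map -cardE => h; rewrite -ltnS prednK ?size_poly_gt0 // h //.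
  by apply/allP=> _ /mapP[j jS ->]; move: jS; rewrite mem_enum.
by rewrite map_inj_uniq ?enum_uniq // => i j /eqP; rewrite eqr_nat => /eqP/val_inj.
Qed.

Lemma exists_nonroot (p : {poly F}) : p != 0 -> exists2 e : F, e != 0 & p.[e] != 0.
Proof.
(* The factor ['X] excludes the parameter 0, by which [maximal_closed] has to divide. *)
move=> p0; have Xp0 : 'X * p != 0 by rewrite mulf_neq0 // polyX_eq0.
set m := (size ('X * p)); have := count_roots m.+1 Xp0; rewrite -/m => cm.
have [j] : exists j : 'I_m.+1, ('X * p).[(j : nat)%:R] != 0.
  apply/existsP; apply: contraTT cm; rewrite negb_exists => /forallP all0.
  rewrite -ltnNge (eq_card (B := predT)) ?card_ord; last first.
    by move=> j; rewrite !inE; have := all0 j; rewrite negbK.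
  by case: (m).
by rewrite hornerM hornerX mulf_eq0 negb_or => /andP[j0 pj]; exists (j : nat)%:R.
Qed.

Definition evmx q (M : 'M[{poly F}]_(q, N)) (e : F) : 'M[F]_(q, N) :=
  map_mx (horner_eval e) M.

(** Only row spaces are compared, so the polynomial matrix may have another number of rows; this is
    what makes sums of subspaces stay polynomial. *)
Definition polyfam dg q' (V : F -> 'M[F]_(q', N)) :=
  exists q (M : 'M[{poly F}]_(q, N)),
    (forall i j, (size (M i j) <= dg.+1)%N) /\ forall e, (V e :=: evmx M e)%MS.

(** Constant matrices [L] and [K] compress the family to size [r] so that it is the identity at
    [e0]. The determinant of the compression is a polynomial with value 1 at [e0], and where it does
    not vanish the rank is at least [r]. *)
Lemma polyfam_rank dg q' (V : F -> 'M[F]_(q', N)) e0 r :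
  polyfam dg V -> (r <= \rank (V e0))%N ->
  exists2 p : {poly F}, p != 0 /\ (size p <= (r * dg).+1)%N &
    forall e, p.[e] != 0 -> (r <= \rank (V e))%N.
Proof.
case=> q [M [sM VE]]; rewrite VE => /rank_witness[L [K LK]].
pose A := map_mx polyC L *m M *m map_mx polyC K.
have AE e : map_mx (horner_eval e) A = L *m evmx M e *m K.
  have mapC m n (Y : 'M[F]_(m, n)) : map_mx (horner_eval e) (map_mx polyC Y) = Y.
    by apply/matrixP=> i j; rewrite !mxE /horner_eval hornerC.
  by rewrite !map_mxM !mapC.
have dE e : (\det A).[e] = \det (L *m evmx M e *m K).
  by rewrite -AE det_map_mx.
exists (\det A) => [|e].
  split; first by apply/eqP=> A0; have := dE e0; rewrite A0 LK det1 horner0 => /eqP;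
    rewrite eq_sym oner_eq0.
  apply: size_det_le => i j; rewrite mxE; apply: leq_trans (size_sum _ _ _) _.
  apply/bigmax_leqP=> k _; rewrite [map_mx _ _ k j]mxE mulrC mul_polyC.
  apply: leq_trans (size_scale_leq _ _) _; rewrite mxE.
  apply: leq_trans (size_sum _ _ _) _; apply/bigmax_leqP=> k' _.
  by rewrite [map_mx _ _ i k']mxE mul_polyC; apply: leq_trans (size_scale_leq _ _) _.
rewrite dE VE => dn0.
have /mxrank_unit <- : L *m evmx M e *m K \in unitmx by rewrite unitmxE unitfE.
by apply: leq_trans (mxrankM_maxl _ _) _; exact: mxrankM_maxr.
Qed.

Lemma polyfam_affine q (A0 A1 : 'M[F]_(q, N)) : polyfam 1 (fun e => A0 + e *: A1).
Proof.
exists q, (map_mx polyC A0 + 'X *: map_mx polyC A1); split=> [i j|e].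
  rewrite !mxE; apply: leq_trans (size_polyD _ _) _; rewrite geq_max.
  rewrite (leq_trans (size_polyC_leq1 _)) //= mulrC mul_polyC.
  by rewrite (leq_trans (size_scale_leq _ _)) // size_polyX.
apply/eqmxP; rewrite (_ : evmx _ e = A0 + e *: A1) ?submx_refl //.
by apply/matrixP=> i j; rewrite !mxE /horner_eval hornerD hornerM hornerX !hornerC.
Qed.

Lemma polyfam_const dg q (K : 'M[F]_(q, N)) : polyfam dg (fun=> K).
Proof.
exists q, (map_mx polyC K); split=> [i j|e].
  by rewrite mxE (leq_trans (size_polyC_leq1 _)).
apply/eqmxP; rewrite (_ : evmx _ e = K) ?submx_refl //.
by apply/matrixP=> i j; rewrite !mxE /horner_eval hornerC.
Qed.

Lemma polyfam_adds dg q1 q2 (V1 : F -> 'M[F]_(q1, N)) (V2 : F -> 'M[F]_(q2, N)) :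
  polyfam dg V1 -> polyfam dg V2 -> polyfam dg (fun e => V1 e + V2 e)%MS.
Proof.
case=> r1 [M1 [s1 E1]] [r2 [M2 [s2 E2]]]; exists (r1 + r2)%N, (col_mx M1 M2).
split=> [i j|e]; first by rewrite mxE; case: (fintype.split i).
rewrite /evmx map_col_mx; apply: eqmx_trans (adds_eqmx (E1 e) (E2 e)) _.
exact: addsmxE.
Qed.

Lemma polyfam_mul dg q (V : F -> 'M[F]_(q, N)) (A0 A1 G : 'M[F]_N) :
  polyfam dg V -> polyfam dg.+1 (fun e => V e *m (A0 + e *: A1) *m G).
Proof.
case=> r [M [sM ME]].
pose A := map_mx polyC (A0 *m G) + 'X *: map_mx polyC (A1 *m G).
have AE e : map_mx (horner_eval e) A = (A0 + e *: A1) *m G.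
  rewrite mulmxDl -scalemxAl; apply/matrixP=> i j.
  by rewrite /A mxE !mxE /horner_eval hornerD hornerM hornerX !hornerC.
have sA i j : (size (A i j) <= 2)%N.
  rewrite mxE [X in _ + X]mxE ![map_mx _ _ i j]mxE.
  apply: leq_trans (size_polyD _ _) _; rewrite geq_max.
  rewrite (leq_trans (size_polyC_leq1 _)) //= mulrC mul_polyC.
  by rewrite (leq_trans (size_scale_leq _ _)) // size_polyX.
exists r, (M *m A); split=> [i j|e].
  rewrite mxE; apply: leq_trans (size_sum _ _ _) _; apply/bigmax_leqP=> k _.
  apply: leq_trans (size_mul_leq _ _) _; have := sM i k; have := sA k j.
  by move: (size (M i k)) (size (A k j)) => x y; lia.
by rewrite /evmx map_mxM AE -mulmxA; apply: eqmxMr.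
Qed.

End PolyFamilies.

(** * Chains of maximal dimension reach the smallest closed subspace *)

Section Chains.
Variables (F : numFieldType) (N : nat) (B : 'M[F]_N).

(** The pseudo-inverse keeps the step linear in [C], so that chains along a line of matrices form a
    polynomial family. The step is the full preimage of [K *m C] under [B] once [K *m C] lies in the
    image of [B]. *)
Definition chain_step (K C : 'M[F]_N) : 'M[F]_N :=
  (kermx B + K *m C *m pinvmx B)%MS.

Definition chain (s : seq 'M[F]_N) : 'M[F]_N := foldl chain_step (kermx B) s.

Lemma chain_rcons s C : chain (rcons s C) = chain_step (chain s) C.
Proof. by rewrite /chain -cats1 foldl_cat. Qed.

Lemma chain_stepS K K' C : (K <= K')%MS -> (chain_step K C <= chain_step K' C)%MS.
Proof. by move=> KK'; rewrite addsmxS // !submxMr. Qed.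

Lemma chain_catl s s' : (chain s' <= chain (s ++ s'))%MS.
Proof.
rewrite /chain foldl_cat; have : (kermx B <= foldl chain_step (kermx B) s)%MS.
  by elim/last_ind: s => [|s C _]; rewrite //= foldl_rcons addsmxSl.
move: (kermx B) (foldl _ _ _) => K K'.
by elim: s' K K' => //= C s' IH K K' KK'; apply/IH/chain_stepS.
Qed.

Lemma kermx_chain s : (kermx B <= chain s)%MS.
Proof. by have := chain_catl s [::]; rewrite cats0. Qed.

Lemma chain_stepB K : (kermx B <= K)%MS -> (chain_step K B :=: K)%MS.
Proof.
move=> kK; have KB : K *m B *m pinvmx B *m B = K *m B by rewrite mulmxKpV ?submxMl.
apply/eqmxP; rewrite addsmx_sub kK /=; apply/andP; split.
  by apply: (sub_preim kK); rewrite KB.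
rewrite -{1}[K](subrK (K *m B *m pinvmx B)) addmx_sub_adds //.
by apply/sub_kermxP; rewrite mulmxBl KB subrr.
Qed.

(** A step with [B] itself changes nothing, so constant chains can be used as base points of lines
    and to pad a chain. *)
Lemma chain_nseqB s k : (chain (s ++ nseq k B) :=: chain s)%MS.
Proof.
elim: k => [|k IHk]; first by rewrite cats0.
have -> : s ++ nseq k.+1 B = rcons (s ++ nseq k B) B.
  by rewrite -cats1 -catA; congr (_ ++ _); elim: k {IHk} => //= k ->.
by rewrite chain_rcons; apply: eqmx_trans (chain_stepB (kermx_chain _)) IHk.
Qed.

Definition line_seq (l : seq ('M[F]_N * 'M[F]_N)) (e : F) := [seq c.1 + e *: c.2 | c <- l].

Lemma polyfam_chain l : polyfam (size l) (fun e => chain (line_seq l e)).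
Proof.
elim/last_ind: l => [|l c IHl]; first exact: polyfam_const.
have -> : (fun e => chain (line_seq (rcons l c) e)) =
    (fun e => kermx B + chain (line_seq l e) *m (c.1 + e *: c.2) *m pinvmx B)%MS.
  by apply/funext=> e; rewrite /line_seq map_rcons chain_rcons.
by rewrite size_rcons; apply: polyfam_adds; [exact: polyfam_const|exact: polyfam_mul].
Qed.

Variables (CC : 'M[F]_N -> Prop) (Us : 'M[F]_N).
Hypotheses (CB : CC B) (CL : forall c C D, CC C -> CC D -> CC (C + c *: (D - C))).
Hypotheses (kU : (kermx B <= Us)%MS) (cU : forall C, CC C -> (Us *m C <= Us *m B)%MS).
Hypothesis mU : forall K : 'M[F]_N, (kermx B <= K)%MS ->
  (forall C, CC C -> (K *m C <= K *m B)%MS) -> (Us <= K)%MS.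

Definition allC (s : seq 'M[F]_N) := forall C, C \in s -> CC C.

Lemma allC_rcons s C : allC (rcons s C) <-> allC s /\ CC C.
Proof.
split=> [h|[hs hC] D].
  by split=> [D Ds|]; apply: h; rewrite mem_rcons inE ?Ds ?orbT ?eqxx.
by rewrite mem_rcons inE => /orP[/eqP->//|/hs].
Qed.

Lemma allC_cons s C : allC (C :: s) <-> allC s /\ CC C.
Proof.
split=> [h|[hs hC] D].
  by split=> [D Ds|]; apply: h; rewrite inE ?Ds ?orbT ?eqxx.
by rewrite inE => /orP[/eqP->//|/hs].
Qed.

Lemma allC_cat s s' : allC s -> allC s' -> allC (s ++ s').
Proof. by move=> h h' C; rewrite mem_cat => /orP[/h|/h']. Qed.

Lemma chain_Us s : allC s -> (chain s <= Us)%MS.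
Proof.
elim/last_ind: s => [_|s C IHs /allC_rcons[/IHs sU /cU CU]]; first exact: kU.
rewrite chain_rcons addsmx_sub kU /=; apply: (sub_preim kU).
have h : (chain s *m C <= Us *m B)%MS by apply: submx_trans CU; rewrite submxMr.
by rewrite mulmxKpV // (submx_trans h) ?submxMl.
Qed.

Let dims t r := `[< exists s, [/\ size s = t, allC s & \rank (chain s) = r] >].

Let dims_ex t : exists r, dims t r.
Proof.
exists (\rank (chain (nseq t B))); apply/asboolP; exists (nseq t B).
by rewrite size_nseq; split=> // C; rewrite mem_nseq => /andP[_ /eqP->].
Qed.

Let dims_le t r : dims t r -> (r <= N)%N.
Proof. by move/asboolP=> [s [_ _ <-]]; exact: rank_leq_col. Qed.

Definition maxdim t := ex_maxn (dims_ex t) (@dims_le t).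

Lemma maxdim_ex t : exists s, [/\ size s = t, allC s & \rank (chain s) = maxdim t].
Proof. by rewrite /maxdim; case: ex_maxnP => r /asboolP. Qed.

Lemma maxdim_ge t s : size s = t -> allC s -> (\rank (chain s) <= maxdim t)%N.
Proof.
move=> st hs; rewrite /maxdim; case: ex_maxnP => r _; apply.
by apply/asboolP; exists s.
Qed.

Lemma maxdim_mono t : (maxdim t <= maxdim t.+1)%N.
Proof.
have [s [st hs <-]] := maxdim_ex t.
apply: leq_trans (mxrankS (chain_catl [:: B] s)) _.
by apply: maxdim_ge; [rewrite /= st|apply/allC_cons].
Qed.

Definition segment (s s' : seq 'M[F]_N) := zip s [seq c.2 - c.1 | c <- zip s s'].

Lemma size_segment s s' : size s = size s' -> size (segment s s') = size s.
Proof. by move=> ss; rewrite /segment size_zip size_map size_zip ss !minnn. Qed.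

Lemma segment0 s s' : size s = size s' -> line_seq (segment s s') 0 = s.
Proof.
elim: s s' => [|c s IHs] [|c' s'] //= [ss]; rewrite /line_seq /= scale0r addr0.
by rewrite -[in RHS](IHs _ ss).
Qed.

Lemma segment1 s s' : size s = size s' -> line_seq (segment s s') 1 = s'.
Proof.
elim: s s' => [|c s IHs] [|c' s'] //= [ss]; rewrite /line_seq /= scale1r addrC subrK.
by rewrite -[in RHS](IHs _ ss).
Qed.

Lemma segmentC s s' e : size s = size s' -> allC s -> allC s' ->
  allC (line_seq (segment s s') e).
Proof.
elim: s s' => [|c s IHs] [|c' s'] //= [ss] /allC_cons[hs hc] /allC_cons[hs' hc'].
by apply/allC_cons; split; [exact: IHs|exact: CL].
Qed.

Lemma generic2 dg1 dg2 (V1 V2 : F -> 'M[F]_N) e1 e2 r1 r2 :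
  polyfam dg1 V1 -> polyfam dg2 V2 ->
  (r1 <= \rank (V1 e1))%N -> (r2 <= \rank (V2 e2))%N ->
  exists2 e : F, e != 0 & (r1 <= \rank (V1 e))%N /\ (r2 <= \rank (V2 e))%N.
Proof.
move=> p1 p2 /(polyfam_rank p1)[q1 [q10 _] h1] /(polyfam_rank p2)[q2 [q20 _] h2].
have [e e0] := exists_nonroot (mulf_neq0 q10 q20).
by rewrite hornerM mulf_eq0 negb_or => /andP[/h1 ? /h2 ?]; exists e.
Qed.

Lemma eqmx_rank q1 q2 (K : 'M[F]_(q1, N)) (K' : 'M[F]_(q2, N)) :
  (K <= K')%MS -> (\rank K' <= \rank K)%N -> (K :=: K')%MS.
Proof.
move=> KK' r; apply/eqmxP; rewrite KK' /=.
by have [_ <-] := mxrank_leqif_sup KK'; rewrite eqn_leq mxrankS.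
Qed.

(** Write an optimal chain of length [t + 2] as [D1, mid, Dl] and move [mid] along a line towards an
    optimal chain of length [t]. A generic point [m] keeps both dimensions. Prepending [D1] to [m]
    then gains nothing, so dropping it leaves a chain of length [t + 1] and of the same
    dimension. *)
Lemma stagnates t : maxdim t = maxdim t.+1 -> maxdim t.+1 = maxdim t.+2.
Proof.
move=> mt; apply/eqP; rewrite eqn_leq maxdim_mono /=.
have [[|D1 s'] [//= [] ss' /allC_cons[hs' hD1] rs]] := maxdim_ex t.+2.
case/lastP: s' ss' hs' rs => [//|mid Dl]; rewrite size_rcons => -[smid].
move=> /allC_rcons[hmid hDl] rs.
have [c [sc hc rc]] := maxdim_ex t.
have mc : size mid = size c by rewrite smid sc.
pose l1 : seq ('M[F]_N * 'M[F]_N) := rcons ((D1, 0) :: segment mid c) (Dl, 0).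
have fam1 := polyfam_chain l1.
have fam2 := polyfam_chain (segment mid c).
have lE e : line_seq l1 e =
    rcons (D1 :: line_seq (segment mid c) e) Dl.
  by rewrite /line_seq map_rcons /= !scaler0 !addr0.
have [e _ [r1 r2]] : exists2 e : F, e != 0 &
    (maxdim t.+2 <= \rank (chain (line_seq l1 e)))%N /\
    (maxdim t <= \rank (chain (line_seq (segment mid c) e)))%N.
  by apply: (generic2 fam1 fam2 (e1 := 0) (e2 := 1)); rewrite ?lE ?segment0 ?segment1 ?rc // -rs.
set m := line_seq _ e in lE r2.
have hm : allC m by exact: segmentC.
have sm : size m = t by rewrite size_map size_segment.
apply: leq_trans r1 _; rewrite lE -/m chain_rcons.
have E : (chain m :=: chain (D1 :: m))%MS.
  apply: eqmx_rank; first exact: (chain_catl [:: D1] m).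
  apply: leq_trans r2; rewrite mt; apply: maxdim_ge; first by rewrite /= sm.
  by apply/allC_cons.
have: (chain_step (chain (D1 :: m)) Dl <= chain_step (chain m) Dl)%MS.
  by apply: chain_stepS; rewrite E.
move=> /mxrankS h; apply: leq_trans h _; rewrite -chain_rcons.
by apply: maxdim_ge; [rewrite size_rcons sm|apply/allC_rcons].
Qed.

Lemma stagnates_forever t k : maxdim t = maxdim t.+1 -> maxdim (t + k) = maxdim t.
Proof.
move=> mt; suff : maxdim (t + k) = maxdim t /\ maxdim (t + k) = maxdim (t + k).+1 by case.
elim: k => [|k [IH1 IH2]]; first by rewrite addn0.
by rewrite addnS -IH2 IH1; split=> //; rewrite -IH1 IH2; exact: stagnates.
Qed.

(** A generic [m] on the line from [B, ..., B] to [s] is maximal, and prepending [s] or [s'] to it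
    cannot enlarge its space; so both prolonged chains have the space of [m]. At [m = B, ..., B]
    they have the spaces of [s] and [s'], and the dimension of their sum there cannot exceed the
    generic one. *)
Lemma maximal_unique t s s' : maxdim t = maxdim t.+1 ->
  size s = t -> allC s -> \rank (chain s) = maxdim t ->
  size s' = t -> allC s' -> \rank (chain s') = maxdim t ->
  (chain s :=: chain s')%MS.
Proof.
move=> mt ss hs rs ss' hs' rs'.
have sB : size (nseq t B) = size s by rewrite size_nseq ss.
have hB : allC (nseq t B) by move=> C; rewrite mem_nseq => /andP[_ /eqP->].
set l := segment (nseq t B) s.
pose const (r : seq 'M[F]_N) : seq ('M[F]_N * 'M[F]_N) := [seq (C, 0) | C <- r].
have constE r e : line_seq (const r ++ l) e = r ++ line_seq l e.
  rewrite /line_seq map_cat; congr (_ ++ _); rewrite -map_comp -[RHS]map_id.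
  by apply: eq_map => C /=; rewrite scaler0 addr0.
have fam1 := polyfam_chain l.
have famS r : size r = t -> polyfam (t + t) (fun e => chain (r ++ line_seq l e)).
  move=> sr; have := polyfam_chain (const r ++ l).
  rewrite size_cat size_map sr size_segment // size_nseq.
  by have -> : (fun e => chain (line_seq (const r ++ l) e)) =
    (fun e => chain (r ++ line_seq l e)) by apply/funext=> e; rewrite constE.
have fam2 := polyfam_adds (famS _ ss) (famS _ ss').
have max2 r e : size r = t -> allC r -> (maxdim t <= \rank (chain (line_seq l e)))%N ->
    (chain (line_seq l e) :=: chain (r ++ line_seq l e))%MS.
  move=> sr hr re; apply: eqmx_rank; first exact: chain_catl.
  apply: leq_trans re; rewrite -(stagnates_forever t mt); apply: maxdim_ge.
    by rewrite size_cat sr size_map size_segment ?size_nseq.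
  by apply: allC_cat => //; apply: segmentC.
have r0 : (\rank (chain s + chain s')%MS <= maxdim t)%N.
  rewrite leqNgt; apply/negP=> gt.
  have [e _ [r1 r2]] : exists2 e : F, e != 0 & (maxdim t <= \rank (chain (line_seq l e)))%N /\
      (maxdim t < \rank (chain (s ++ line_seq l e) + chain (s' ++ line_seq l e))%MS)%N.
    apply: (generic2 fam1 fam2 (e1 := 1) (e2 := 0)); first by rewrite segment1 // rs.
    by rewrite segment0 // (adds_eqmx (chain_nseqB _ _) (chain_nseqB _ _)).
  move: r2; rewrite -(adds_eqmx (max2 _ _ ss hs r1) (max2 _ _ ss' hs' r1)) (elimT addsmx_idPl (submx_refl _)).
  rewrite ltnNge; case/negP; apply: maxdim_ge; first by rewrite size_map size_segment ?size_nseq.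
  exact: segmentC.
have E1 : (chain s :=: chain s + chain s')%MS.
  by apply: eqmx_rank; rewrite ?addsmxSl // rs.
have E2 : (chain s' :=: chain s + chain s')%MS.
  by apply: eqmx_rank; rewrite ?addsmxSr // rs'.
exact: eqmx_trans E1 (eqmx_sym E2).
Qed.

(** It suffices that the space [K] of [s] is closed. Appending [B], or [B + e (C - B)] with a
    generic [e != 0], gives maximal chains of length [t + 1], which share the space [K] by
    uniqueness. So the combination maps [K] into [K B], and dividing by [e] shows the same for
    [C]. *)
Lemma maximal_closed t s : maxdim t = maxdim t.+1 ->
  size s = t -> allC s -> \rank (chain s) = maxdim t -> (Us <= chain s)%MS.
Proof.
move=> mt ss hs rs; apply: mU => [|C hC]; first exact: kermx_chain.
pose l1 : seq ('M[F]_N * 'M[F]_N) := rcons [seq (D, 0) | D <- s] (B, C - B).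
have fam := polyfam_chain l1.
have lE e : line_seq l1 e = rcons s (B + e *: (C - B)).
  rewrite /line_seq map_rcons -map_comp; congr rcons; rewrite -[RHS]map_id.
  by apply: eq_map => D /=; rewrite scaler0 addr0.
have sB := chain_stepB (kermx_chain s).
have [e e0 [r1 _]] : exists2 e : F, e != 0 &
    (maxdim t <= \rank (chain (line_seq l1 e)))%N /\
    (0 <= \rank (chain (line_seq l1 e)))%N.
  by apply: (generic2 fam fam (e1 := 0) (e2 := 0)) => //; rewrite lE scale0r addr0 chain_rcons sB rs.
have hD : CC (B + e *: (C - B)) by exact: CL.
have r1E : \rank (chain (rcons s (B + e *: (C - B)))) = maxdim t.+1.
  apply/eqP; rewrite eqn_leq -{2}mt -lE r1 andbT lE; apply: maxdim_ge.
    by rewrite size_rcons ss.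
  by apply/allC_rcons.
have E := @maximal_unique t.+1 (rcons s (B + e *: (C - B))) (rcons s B) (stagnates mt).
have {}E : (chain (rcons s (B + e *: (C - B))%R) :=: chain s)%MS.
  apply: (eqmx_trans (B := chain (rcons s B))); last by rewrite chain_rcons.
  apply: E; rewrite ?size_rcons ?ss //.
  - by apply/allC_rcons.
  - by apply/allC_rcons.
  - by rewrite chain_rcons sB rs mt.
set K := chain s in sB E *.
have KU : (K <= Us)%MS by exact: chain_Us.
have subB D : CC D -> (K *m D <= B)%MS.
  move=> /cU h; apply: (submx_trans (submxMr _ KU)); apply: (submx_trans h).
  exact: submxMl.
have : (K *m (B + e *: (C - B))%R *m pinvmx B <= K)%MS.
  by rewrite -E chain_rcons addsmxSr.
move/(submxMr B); rewrite mulmxKpV ?subB // mulmxDr -scalemxAr mulmxBr => h.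
have KC : K *m C = e^-1 *: ((K *m B + e *: (K *m C - K *m B)) - K *m B) + K *m B.
  by rewrite [K *m B + _]addrC addrK scalerA mulVf // scale1r subrK.
rewrite KC addmx_sub // scalemx_sub // addmx_sub // eqmx_opp //.
Qed.

Theorem chain_reaches : exists s, [/\ size s = N, allC s & (Us <= chain s)%MS].
Proof.
(* Otherwise the maximal dimensions would increase strictly [N + 1] times, beyond [N]. *)
have [t tN mt] : exists2 t, (t <= N)%N & maxdim t = maxdim t.+1.
  apply: contrapT => no.
  suff : (N.+1 <= maxdim N.+1)%N.
    by have [s [_ _ <-]] := maxdim_ex N.+1; rewrite ltnNge rank_leq_col.
  have : forall k, (k <= N.+1)%N -> (k <= maxdim k)%N.
    elim=> // k IHk kN; apply: leq_ltn_trans (IHk (ltnW kN)) _.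
    rewrite ltn_neqAle maxdim_mono andbT; apply/eqP=> mk; apply: no.
    by exists k.
  exact.
have mN : maxdim N = maxdim N.+1.
  have := stagnates_forever (N - t) mt; have := stagnates_forever (N - t).+1 mt.
  by rewrite addnS subnKC // => -> ->.
have [s [sN hs rs]] := maxdim_ex N.
by exists s; split=> //; apply: maximal_closed mN sN hs rs.
Qed.

End Chains.

(** The same iteration on column vectors, the preimage being expressed by a linear system; these are
    the systems that the program solves. *)
Fixpoint in_chain (F : fieldType) N (Cs : nat -> 'M[F]_N) s (x : 'cV[F]_N) : Prop :=
  if s is s'.+1 then exists x0, in_chain Cs s' x0 /\ Cs 0 *m x + Cs s *m x0 = 0
  else Cs 0 *m x = 0.

(** * Good random numbers and the count of bad values *)

Section Random.
Variables (F : numFieldType) (n m d : nat) (a : 'I_m -> 'M[F]_n).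
Hypothesis d0 : (0 < d)%N.
Local Notation N := (n * d)%N.

Definition didx s l b b' := (((s * m + l) * d + b) * d + b')%N.

(** The indices are swapped because [a] holds transposed matrices; the program uses the transpose of
    this one. *)
Definition drawX (x : nat -> F) s (l : 'I_m) : 'M[F]_d := \matrix_(b', b) x (didx s l b b').

Definition drawC x s : 'M[F]_N := blowup a (drawX x s).

Definition setv (x : nat -> F) k v : nat -> F := fun e => if e == k then v else x e.

Definition drawD k s : 'M[F]_N := blowup a (fun l => \matrix_(b', b) (didx s l b b' == k)%:R).

Lemma drawC_setv x k v s : drawC (setv x k v) s = drawC (setv x k 0) s + v *: drawD k s.
Proof.
rewrite /drawC /drawD -blZ -blD; apply: eq_bigr => l _; congr (_ *t _).
apply/matrixP=> b' b; rewrite !mxE /setv; case: eqP => _.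
  by rewrite mulr1 add0r.
by rewrite mulr0 addr0.
Qed.

Lemma drawC_ext x y s :
  (forall e, (e < s.+1 * (m * d * d))%N -> x e = y e) -> drawC x s = drawC y s.
Proof.
move=> xy; apply: eq_bigr => l _; congr (_ *t _); apply/matrixP=> b' b; rewrite !mxE.
apply: xy; rewrite /didx.
have h1 : ((s * m + l) < s.+1 * m)%N by rewrite mulSn addnC ltn_add2r.
have h2 : ((s * m + l) * d + b < s.+1 * m * d)%N.
  by apply: (@leq_trans ((s * m + l).+1 * d)); rewrite ?leq_mul2r ?h1 ?orbT // mulSn addnC ltn_add2r.
rewrite !mulnA; apply: (@leq_trans (((s * m + l) * d + b).+1 * d)).
  by rewrite mulSn addnC ltn_add2r.
by rewrite leq_mul2r h2 orbT.
Qed.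

Lemma exists_draw x (Y : nat -> 'I_m -> 'M[F]_d) :
  exists2 y : nat -> F, forall e, (e < m * d * d)%N -> y e = x e &
    forall s, drawC y s.+1 = blowup a (Y s).
Proof.
pose y e := if (e < m * d * d)%N then x e else
  if insub (e %/ d %/ d %% m)%N is Some l then
    if insub (e %/ d %% d)%N is Some b then
      if insub (e %% d)%N is Some b' then Y (e %/ d %/ d %/ m).-1 l b' b else 0
    else 0
  else 0.
exists y => [e eK|s]; first by rewrite /y eK.
apply: eq_bigr => l _; congr (_ *t _); apply/matrixP=> b' b; rewrite mxE /y.
have m0 : (0 < m)%N := leq_ltn_trans (leq0n l) (ltn_ord l).
have e1 : (didx s.+1 l b b' %% d = b')%N by rewrite modnMDl modn_small.
have e2 : (didx s.+1 l b b' %/ d = (s.+1 * m + l) * d + b)%N.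
  by rewrite divnMDl // divn_small // addn0.
have e3 : (((s.+1 * m + l) * d + b) %% d = b)%N by rewrite modnMDl modn_small.
have e4 : (((s.+1 * m + l) * d + b) %/ d = s.+1 * m + l)%N.
  by rewrite divnMDl // divn_small // addn0.
have e5 : ((s.+1 * m + l) %% m = l)%N by rewrite modnMDl modn_small.
have e6 : ((s.+1 * m + l) %/ m = s.+1)%N by rewrite divnMDl // divn_small // addn0.
rewrite e1 e2 e3 e4 e5 e6 !valK ifF //; apply/negbTE; rewrite -leqNgt /didx.
have : (m * d * d <= (s.+1 * m + l) * d * d)%N.
  by rewrite !leq_mul2r mulSn -addnA leq_addr !orbT.
by rewrite mulnDl; lia.
Qed.

Variables (r : nat) (U : 'M[F]_n).
Hypotheses (hr : is_ncrank a r) (hU : is_min_shrunk a (n - r) U).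

Definition drawchain x := chain (drawC x 0) [seq drawC x s | s <- iota 1 N].

(** If the first blow-up has maximal rank, the chain stays inside [U (x) C^d], so the inequality
    amounts to equality of the two spaces. *)
Definition good x := \rank (drawC x 0) = (r * d)%N /\ (\rank U * d <= \rank (drawchain x))%N.

Lemma good_ext x y : (forall e, (e < N.+1 * (m * d * d))%N -> x e = y e) -> good x -> good y.
Proof.
move=> xy; have E s : (s <= N)%N -> drawC x s = drawC y s.
  by move=> sN; apply: drawC_ext => e h; apply: xy; apply: leq_trans h _; rewrite leq_mul2r ltnS sN orbT.
rewrite /good /drawchain E //.
suff -> : [seq drawC x s | s <- iota 1 N] = [seq drawC y s | s <- iota 1 N] by [].
by apply/eq_in_map => s; rewrite mem_iota => /andP[_ h]; apply: E; lia.
Qed.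

(** [chain_reaches] applies: blow-ups are stable under affine combinations, and by the rank
    hypothesis [U (x) C^d] is the smallest closed subspace. The matrices it yields are encoded as
    random numbers after the first block. *)
Lemma good_complete x : \rank (drawC x 0) = (r * d)%N ->
  exists2 y, forall e, (e < m * d * d)%N -> y e = x e & good y.
Proof.
move=> rB; have [[kU cU] mU] := min_shrunk_closed d0 hr rB hU.
pose CC (C : 'M[F]_N) := exists Y, C = blowup a Y.
have CB : CC (drawC x 0) by exists (drawX x 0).
have CL c C D : CC C -> CC D -> CC (C + c *: (D - C)).
  case=> Y -> [Z ->]; exists (fun t => Y t + c *: (Z t + -1 *: Y t)).
  by rewrite blD blZ blD blZ scaleN1r.
have [s [sN hs Us]] : exists s, [/\ size s = N, allC CC s &
    (<<U *t (1%:M : 'M[F]_d)>> <= chain (drawC x 0) s)%MS].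
  apply: chain_reaches CB CL _ _ _.
  - by rewrite genmxE.
  - by move=> C [Y ->]; rewrite !(eqmxMr _ (genmxE _)).
  - move=> K kK cK; rewrite genmxE; apply: mU; split=> // X; apply: cK.
    by exists X.
have /boolp.choice[Y YE] : forall k, exists Y : 'I_m -> 'M[F]_d,
    (k < N)%N -> nth 0 s k = blowup a Y.
  move=> k; have [kN|_] := ltnP k N; last by exists (fun=> 0).
  by have [|Y e] := hs (nth 0 s k); [rewrite mem_nth // sN|exists Y].
have [y yx yE] := exists_draw x Y; exists y => //.
have y0 : drawC y 0 = drawC x 0 by apply: drawC_ext => e; rewrite mul1n => /yx.
split; first by rewrite y0.
rewrite /drawchain y0 -rank_tens1 -(mxrank_gen (U *t 1%:M)).
suff -> : [seq drawC y s0 | s0 <- iota 1 N] = s by exact: mxrankS.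
apply: (@eq_from_nth _ 0); first by rewrite size_map size_iota sN.
move=> k; rewrite size_map size_iota => kN.
by rewrite (nth_map 0%N) ?size_iota // nth_iota // add1n yE YE.
Qed.

Lemma rankU_le : (\rank U * d <= N)%N.
Proof. by rewrite leq_mul2r rank_leq_col orbT. Qed.

Lemma rd_le : (r * d <= N)%N.
Proof. by rewrite leq_mul2r (is_ncrank_le hr) orbT. Qed.

(* The numbers before position [k] being kept, those at [k] which admit no good
   completion are roots of a nonzero polynomial of degree at most [N * N]. *)
Lemma good_step x k E : good x ->
  (#|[pred j : 'I_E.+1 | ~~ `[< exists y, [/\ forall e, (e < k)%N -> y e = x e,
        y k = (nat_of_ord j)%:R & good y] >]]| <= N * N)%N.
Proof.
case=> rB rC.
have setvx : setv x k (x k) = x by apply/funext=> e; rewrite /setv; case: eqP => [->|].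
have count (p : {poly F}) b : p != 0 -> (size p <= b.+1)%N -> (b <= N * N)%N ->
    (forall j : nat, p.[j%:R] != 0 -> exists y, [/\ forall e, (e < k)%N -> y e = x e,
        y k = j%:R & good y]) ->
    (#|[pred j : 'I_E.+1 | ~~ `[< exists y, [/\ forall e, (e < k)%N -> y e = x e,
        y k = (nat_of_ord j)%:R & good y] >]]| <= N * N)%N.
  move=> p0 sp bN hp; apply: leq_trans bN; apply: (@leq_trans (size p).-1); last by lia.
  apply: leq_trans (count_roots E.+1 p0); apply: subset_leq_card; apply/fintype.subsetP=> j.
  rewrite !inE; apply: contraR => /hp h; exact/asboolP.
(* While the first blow-up is being drawn only its rank has to survive, a condition of degree at
   most [r d]; the later numbers may be chosen afresh. *)
have [kK|Kk] := ltnP k (m * d * d).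
  have fam := polyfam_affine (drawC (setv x k 0) 0) (drawD k 0).
  have [|p [p0 sp] hp] := polyfam_rank (e0 := x k) (r := (r * d)%N) fam.
    by rewrite -drawC_setv setvx rB.
  apply: (count p (r * d * 1)%N) => //.
    rewrite muln1; apply: leq_trans rd_le _; have [->|] := posnP N; first by [].
    by move=> N0; rewrite -{1}[N]muln1 leq_mul2l N0 orbT.
  move=> j /hp; rewrite -drawC_setv => rj.
  have [|y yx gy] := @good_complete (setv x k j%:R).
    by apply/eqP; rewrite eqn_leq rj andbT bl_rank_le.
  exists y; split=> // [e ek|]; rewrite yx ?/setv ?eqxx //.
    by rewrite ltn_eqF.
  exact: ltn_trans ek kK.
(* From here on the numbers after [k] are kept. Varying the number [k] moves the matrices along
   lines, so the chain has degree at most [N] and its minors of order [\rank U * d] have degree at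
   most [\rank U * d * N]. *)
pose l := [seq (drawC (setv x k 0) s, drawD k s) | s <- iota 1 N].
have fam := polyfam_chain (drawC x 0) l.
have lE v : line_seq l v = [seq drawC (setv x k v) s | s <- iota 1 N].
  by rewrite /line_seq -map_comp; apply: eq_map => s /=; rewrite -drawC_setv.
have C0 v : drawC (setv x k v) 0 = drawC x 0.
  by apply: drawC_ext => e; rewrite mul1n /setv => eK; rewrite ltn_eqF // (leq_trans eK).
have [|p [p0 sp] hp] := polyfam_rank (e0 := x k) (r := (\rank U * d)%N) fam.
  by rewrite lE setvx.
rewrite size_map size_iota in sp.
apply: (count p (\rank U * d * N)%N) => //; first by rewrite leq_mul2r rankU_le orbT.
move=> j /hp; rewrite lE => rj; exists (setv x k j%:R); split.
- by move=> e ek; rewrite /setv ltn_eqF.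
- by rewrite /setv eqxx.
- by split; rewrite /drawchain ?C0.
Qed.

Lemma exists_good : (exists X : 'I_m -> 'M[F]_d, \rank (blowup a X) = (r * d)%N) ->
  exists x, good x.
Proof.
case=> X rX; have [x0 _ x0E] := exists_draw (fun=> 0) (fun=> X).
(* [exists_draw] prescribes the blow-ups from index 1 on; shifting by one block makes [X] the first
   one. *)
have [|x _ gx] := @good_complete (fun e => x0 (e + m * d * d)%N); last by exists x.
rewrite -rX -(x0E 0%N); congr (\rank _); apply: eq_bigr => l _; congr (_ *t _).
apply/matrixP=> b' b; rewrite !mxE; congr (x0 _); rewrite /didx.
by rewrite mul0n add0n mul1n !mulnDl; lia.
Qed.

(** All spaces of the chain stay inside [U (x) C^d], whose images under the blow-ups lie in the
    image of [B]; so the pseudo-inverse yields true preimages and both iterations agree. Goodness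
    turns the final inclusion into an equality. *)
Lemma in_chain_tens x Cs : (forall s, (s <= N)%N -> (Cs s)^T = drawC x s) -> good x ->
  forall v, in_chain Cs N v <-> (v^T <= U *t (1%:M : 'M[F]_d))%MS.
Proof.
move=> CsE [rB rC]; have [[kU cU] mU] := min_shrunk_closed d0 hr rB hU.
set B := drawC x 0 in rB kU cU mU rC.
have subU s : (s <= N)%N ->
    (chain B [seq drawC x s | s <- iota 1 s] <= U *t (1%:M : 'M[F]_d))%MS.
  elim: s => [|s IHs] sN; first exact: kU.
  rewrite -[s.+1]addn1 iotaD map_cat cats1 chain_rcons addsmx_sub kU /=.
  have h : (chain B [seq drawC x s | s <- iota 1 s] *m drawC x (1 + s) <=
            U *t (1%:M : 'M[F]_d) *m B)%MS.
    apply: submx_trans (submxMr _ (IHs (ltnW sN))) _; exact: (cU (drawX x (1 + s))).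
  by apply: (sub_preim kU); rewrite mulmxKpV // (submx_trans h) // submxMl.
have main s v : (s <= N)%N ->
    in_chain Cs s v <-> (v^T <= chain B [seq drawC x s | s <- iota 1 s])%MS.
  elim: s v => [|s IHs] v sN.
    rewrite /= /chain /= -/(kermx B).
    have -> : (Cs 0 *m v = 0) <-> (v^T *m B = 0).
      by rewrite /B -CsE // -trmx_mul; split=> [->|/(congr1 trmx)]; rewrite ?trmx0 // trmxK.
    by split=> [/sub_kermxP|/sub_kermxP].
  have -> : iota 1 s.+1 = iota 1 s ++ [:: (1 + s)%N] by rewrite -[s.+1]addn1 iotaD.
  rewrite map_cat cats1 chain_rcons /chain_step.
  set K := chain B _; set C := drawC x (1 + s).
  have eqE (x0 : 'cV[F]_N) : Cs 0 *m v + Cs s.+1 *m x0 = 0 <-> v^T *m B = - (x0^T *m C).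
    rewrite /B /C -!CsE // -!trmx_mul; split=> [/eqP|/(congr1 trmx)].
      by rewrite addr_eq0 => /eqP->; rewrite linearN.
    by rewrite linearN /= !trmxK => ->; rewrite addNr.
  split=> [[x0 [/IHs hx0 /eqE e]]|/sub_addsmxP[[D1 D2] /= vE]].
    have x0K : (x0^T <= K)%MS by apply: hx0; exact: ltnW.
    have x0C : x0^T *m C *m pinvmx B *m B = x0^T *m C.
      by apply: mulmxKpV; rewrite -[_ *m C]opprK -e eqmx_opp submxMl.
    rewrite -[v^T](addrK (x0^T *m C *m pinvmx B)) addmx_sub_adds //.
      by apply/sub_kermxP; rewrite mulmxDl e x0C addNr.
    by rewrite eqmx_opp !submxMr.
  have KC : K *m C *m pinvmx B *m B = K *m C.
    apply: mulmxKpV; apply: (submx_trans (submxMr _ (subU s (ltnW sN)))).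
    by apply: submx_trans (cU (drawX x (1 + s))) _; rewrite submxMl.
  (* The sign comes from the system [C_0 x + C_s x0 = 0]. *)
  exists (- (D2 *m K))^T; split.
    by apply/IHs; [exact: ltnW|rewrite trmxK eqmx_opp submxMl].
  apply/eqE; rewrite trmxK vE mulmxDl -(mulmxA D1) mulmx_ker mulmx0 add0r.
  by rewrite -(mulmxA D2) KC mulNmx opprK (mulmxA D2).
move=> v; rewrite main //.
have E : (chain B [seq drawC x s | s <- iota 1 N] :=: U *t (1%:M : 'M[F]_d))%MS.
  by apply: eqmx_rank; [exact: subU|rewrite rank_tens1].
by rewrite E.
Qed.

End Random.

(** * Reasoning about programs *)

Lemma prob_ge0 S (t : rtree S) E : 0 <= prob t E.
Proof.
elim: t => [s|m f IH] /=; first by rewrite ler0n.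
by rewrite divr_ge0 ?ler0n // sumr_ge0.
Qed.

Section Trees.
Variables S T : Type.

Lemma always_rbind (t : rtree S) (g : S -> rtree T) E :
  always t (fun s => always (g s) E) -> always (rbind t g) E.
Proof. by elim: t => //= m f IH h j; apply: IH. Qed.

Lemma always_mono (t : rtree S) (E E' : S -> Prop) :
  (forall s, E s -> E' s) -> always t E -> always t E'.
Proof. by move=> EE'; elim: t => [s /EE'|m f IH h j] //=; apply: IH. Qed.

Lemma always_and (t : rtree S) (E E' : S -> Prop) :
  always t E -> always t E' -> always t (fun s => E s /\ E' s).
Proof. by elim: t => //= m f IH h h' j; apply: IH. Qed.

Lemma avg_ge m (f : 'I_m.+1 -> rat) q : (forall j, q <= f j) ->
  q <= (\sum_(j < m.+1) f j) / m.+1%:R.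
Proof.
move=> qf; rewrite ler_pdivlMr ?ltr0n //.
have -> : q * m.+1%:R = \sum_(j < m.+1) q by rewrite sumr_const card_ord mulr_natr.
exact: ler_sum.
Qed.

Lemma prob_rbind_always (t : rtree S) (g : S -> rtree T) P E q :
  always t P -> (forall s, P s -> q <= prob (g s) E) -> q <= prob (rbind t g) E.
Proof.
by move=> + h; elim: t => [s /h|m f IH hf] //=; apply: avg_ge => j; apply: IH.
Qed.

(** The failure probabilities of two consecutive stages add up. *)
Lemma prob_rbind_ge (t : rtree S) (g : S -> rtree T) P E eps : 0 <= eps ->
  (forall s, P s -> 1 - eps <= prob (g s) E) -> prob t P - eps <= prob (rbind t g) E.
Proof.
move=> eps0 h; elim: t => [s|m f IH] /=.
  case: asboolP => [/h //|_]; rewrite sub0r; by apply: le_trans (prob_ge0 _ _); rewrite oppr_le0.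
have -> : (\sum_(j < m.+1) prob (f j) P) / m.+1%:R - eps =
    (\sum_(j < m.+1) (prob (f j) P - eps)) / m.+1%:R.
  rewrite sumrB sumr_const card_ord mulrBl; congr (_ - _).
  by rewrite -[eps *+ _]mulr_natr mulfK ?pnatr_eq0.
by rewrite ler_pM2r ?invr_gt0 ?ltr0n //; apply: ler_sum.
Qed.

Lemma prob_always (t : rtree S) E : always t E -> 1 <= prob t E.
Proof.
elim: t => [s Es|m f IH hf] /=; first by rewrite asboolT.
by apply: avg_ge => j; apply: IH.
Qed.
End Trees.

Section Logic.
Variable R : realType.
Local Notation st := (state R[i]).

Fixpoint imod (c : cmd) : seq nat :=
  match c with
  | Seq c1 c2 | IfZero _ c1 c2 | IfLe _ _ c1 c2 => imod c1 ++ imod c2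
  | ISet x _ => [:: x]
  | For v _ c => v :: imod c
  | _ => [::]
  end.

Fixpoint smod (c : cmd) : seq nat :=
  match c with
  | Seq c1 c2 | IfZero _ c1 c2 | IfLe _ _ c1 c2 => smod c1 ++ smod c2
  | SCst x _ _ | SOp _ x _ _ | SConj x _ | Fetch x _ _ | Rand x _ => [:: x]
  | For _ _ c => smod c
  | _ => [::]
  end.

Fixpoint amod (c : cmd) : seq nat :=
  match c with
  | Seq c1 c2 | IfZero _ c1 c2 | IfLe _ _ c1 c2 => amod c1 ++ amod c2
  | Store a _ _ => [:: a]
  | For _ _ c => amod c
  | _ => [::]
  end.

(** Read off from the syntax of [c], so that specifications need only mention what changes. *)
Definition frame (c : cmd) (s s' : st) :=
  [/\ forall x, x \notin imod c -> ireg s' x = ireg s x,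
      forall x, x \notin smod c -> sreg s' x = sreg s x &
      forall a, a \notin amod c -> arr s' a = arr s a].

Lemma frame_sub c c' s s' : {subset imod c <= imod c'} -> {subset smod c <= smod c'} ->
  {subset amod c <= amod c'} -> frame c s s' -> frame c' s s'.
Proof.
by move=> ic sc ac [h1 h2 h3]; split=> x xc; [apply: h1|apply: h2|apply: h3];
  apply: contra xc; [apply: ic|apply: sc|apply: ac].
Qed.

Lemma frame_trans c s1 s2 s3 : frame c s1 s2 -> frame c s2 s3 -> frame c s1 s3.
Proof.
move=> [h1 h2 h3] [g1 g2 g3]; split=> x xc.
- by rewrite g1 // h1.
- by rewrite g2 // h2.
- by rewrite g3 // h3.
Qed.

Lemma always_iteri n (f : nat -> st -> rtree st) s (I : nat -> st -> Prop) :
  I 0%N s -> (forall j s', (j < n)%N -> I j s' -> always (f j s') (I j.+1)) ->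
  always (iteri n (fun j t => rbind t (f j)) (Done s)) (I n).
Proof.
move=> I0; elim: n => [|n IHn] If //=; apply: always_rbind.
apply: always_mono (IHn _) => [s' Is'|j s' jn]; first exact: If.
by apply: If; rewrite ltnS ltnW.
Qed.

Lemma mem_catl (T : eqType) (s1 s2 : seq T) : {subset s1 <= s1 ++ s2}.
Proof. by move=> x xs; rewrite mem_cat xs. Qed.

Lemma mem_catr (T : eqType) (s1 s2 : seq T) : {subset s2 <= s1 ++ s2}.
Proof. by move=> x xs; rewrite mem_cat xs orbT. Qed.

Lemma exec_frame c (s : st) : always (exec c s) (frame c s).
Proof.
have updN (T : Type) (f : nat -> T) x v y : y \notin [:: x] -> upd f x v y = f y.
  by rewrite inE /upd => /negPf->.
elim: c s => //=; try by move=> *; split=> //= ? ?; rewrite ?updN.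
- move=> c1 IH1 c2 IH2 s; apply: always_rbind.
  apply: always_mono (IH1 s) => s1 h1; apply: always_mono (IH2 s1) => s2 h2.
  apply: (@frame_trans _ _ s1); [apply: frame_sub h1|apply: frame_sub h2];
    (exact: mem_catl || exact: mem_catr).
- move=> x c1 IH1 c2 IH2 s; case: ifP => _.
    by apply: always_mono (IH1 _) => s1; apply: frame_sub; exact: mem_catl.
  by apply: always_mono (IH2 _) => s1; apply: frame_sub; exact: mem_catr.
- move=> e1 e2 c1 IH1 c2 IH2 s; case: ifP => _.
    by apply: always_mono (IH1 _) => s1; apply: frame_sub; exact: mem_catl.
  by apply: always_mono (IH2 _) => s1; apply: frame_sub; exact: mem_catr.
- move=> v e c IH s.
  apply: (always_iteri (I := fun=> frame (For v e c) s)) => // j s' _ h.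
  apply: always_mono (IH _) => s1 h1; apply: frame_trans h _.
  case: h1 => h1 h2 h3; split=> x /= xc; [|exact: h2|exact: h3].
  move: xc; rewrite inE negb_or => /andP[xv xc].
  by rewrite h1 //= updN // inE.
Qed.

(** The frame of the whole loop is available in every iteration, so the invariant need not repeat
    that untouched registers and arrays keep their values. *)
Lemma exec_for v e c (s : st) (I : nat -> st -> Prop) Q :
  I 0%N (tick 1 s) ->
  (forall j s', (j < ieval (ireg s) e)%N -> frame (For v e c) s s' -> I j s' ->
     always (exec c (tick 1 (set_ireg s' v j))) (I j.+1)) ->
  (forall s', frame (For v e c) s s' -> I (ieval (ireg s) e) s' -> Q s') ->
  always (exec (For v e c) s) Q.
Proof.
move=> I0 IS IQ /=.
have fI : frame (For v e c) s (tick 1 s) /\ I 0%N (tick 1 s) by [].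
apply: always_mono; last first.
  apply: (always_iteri (I := fun j s' => frame (For v e c) s s' /\ I j s')) fI _.
  move=> j s' jn [fs' Is']; apply: always_and; last exact: IS.
  apply: always_mono (exec_frame _ _) => s1 h1; apply: frame_trans fs' _.
  case: h1 => h1 h2 h3; split=> x /= xc; [|exact: h2|exact: h3].
  by move: xc; rewrite inE negb_or => /andP[xv xc]; rewrite h1 //= /upd (negPf xv).
by move=> s' [fs' Is']; apply: IQ.
Qed.

Lemma exec_seq c1 c2 (s : st) Q :
  always (exec c1 s) (fun s1 => frame c1 s s1 -> always (exec c2 s1) Q) ->
  always (exec (Seq c1 c2) s) Q.
Proof.
move=> h; apply: always_rbind.
by apply: always_mono (always_and h (exec_frame c1 s)) => s1 []; apply.
Qed.

Fixpoint evars (e : iexp) : seq nat :=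
  match e with
  | IVar x => [:: x]
  | ICst _ => [::]
  | IAdd e1 e2 | ISub e1 e2 | IMul e1 e2 => evars e1 ++ evars e2
  end.

Fixpoint bvars (c : cmd) : seq nat :=
  match c with
  | Seq c1 c2 | IfZero _ c1 c2 | IfLe _ _ c1 c2 => bvars c1 ++ bvars c2
  | For _ e c => evars e ++ bvars c
  | _ => [::]
  end.

(** Both branches of a test are charged, and all loop bounds are evaluated in the fixed valuation
    [r]; [exec_cost] therefore asks that no register in a loop bound is ever written. *)
Fixpoint cbound (r : nat -> nat) (c : cmd) : nat :=
  match c with
  | Skip => 0
  | Seq c1 c2 => cbound r c1 + cbound r c2
  | SOp o _ _ _ => sop_cost o
  | IfZero _ c1 c2 => 2 + (cbound r c1 + cbound r c2)
  | IfLe _ _ c1 c2 => 1 + (cbound r c1 + cbound r c2)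
  | For _ e c => 1 + ieval r e * (1 + cbound r c)
  | _ => 1
  end.

Lemma ieval_eq (r r' : nat -> nat) e : (forall x, x \in evars e -> r x = r' x) ->
  ieval r e = ieval r' e.
Proof.
elim: e => //= [x h|e1 IH1 e2 IH2 h|e1 IH1 e2 IH2 h|e1 IH1 e2 IH2 h];
  first by apply: h; rewrite inE.
all: by rewrite IH1 ?IH2 // => x hx; apply: h; rewrite mem_cat hx ?orbT.
Qed.

Lemma exec_cost c (r : nat -> nat) (s : st) :
  (forall x, x \in bvars c -> x \notin imod c) ->
  (forall x, x \in bvars c -> ireg s x = r x) ->
  always (exec c s) (fun s' => (cost s' <= cbound r c + cost s)%N).
Proof.
elim: c s => //=.
- move=> c1 IH1 c2 IH2 s dj rs; apply: always_rbind.
  have h1 : always (exec c1 s) (fun s1 => (cost s1 <= cbound r c1 + cost s)%N).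
    apply: IH1 => x xb; last by apply: rs; rewrite mem_cat xb.
    by have := dj x; rewrite !mem_cat xb negb_or => /(_ isT)/andP[].
  apply: always_mono (always_and h1 (exec_frame c1 s)) => s1 [cs1 [f1 _ _]].
  have h2 : always (exec c2 s1) (fun s2 => (cost s2 <= cbound r c2 + cost s1)%N).
    have dj2 x : x \in bvars c2 -> (x \notin imod c1) && (x \notin imod c2).
      by move=> xb; rewrite -negb_or -mem_cat; apply: dj; rewrite mem_cat xb orbT.
    apply: IH2 => x xb; have /andP[x1 x2] := dj2 _ xb => //.
    by rewrite f1 //; apply: rs; rewrite mem_cat xb orbT.
  by apply: always_mono h2 => s2; lia.
- move=> x c1 IH1 c2 IH2 s dj rs; case: ifP => _.
    apply: always_mono (IH1 (tick 2 s) _ _) => [s1 /=|y yb|y yb]; first by lia.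
      by have := dj y; rewrite !mem_cat yb negb_or => /(_ isT)/andP[].
    by apply: rs; rewrite mem_cat yb.
  apply: always_mono (IH2 (tick 2 s) _ _) => [s1 /=|y yb|y yb]; first by lia.
    by have := dj y; rewrite !mem_cat yb orbT negb_or => /(_ isT)/andP[].
  by apply: rs; rewrite mem_cat yb orbT.
- move=> e1 e2 c1 IH1 c2 IH2 s dj rs; case: ifP => _.
    apply: always_mono (IH1 (tick 1 s) _ _) => [s1 /=|y yb|y yb]; first by lia.
      by have := dj y; rewrite !mem_cat yb negb_or => /(_ isT)/andP[].
    by apply: rs; rewrite mem_cat yb.
  apply: always_mono (IH2 (tick 1 s) _ _) => [s1 /=|y yb|y yb]; first by lia.
    by have := dj y; rewrite !mem_cat yb orbT negb_or => /(_ isT)/andP[].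
  by apply: rs; rewrite mem_cat yb orbT.
- move=> v e c IH s dj rs.
  have eE : ieval (ireg s) e = ieval r e.
    by apply: ieval_eq => x xe; apply: rs; rewrite mem_cat xe.
  apply: (@exec_for v e c s (fun j s' => (cost s' <= 1 + j * (1 + cbound r c) + cost s)%N)).
  - by [].
  - move=> j s' jn [f1 _ _] cs'.
    apply: always_mono (IH (tick 1 (set_ireg s' v j)) _ _) => [s1 /=|y yb|y yb].
    + by rewrite mulSn; lia.
    + by have := dj y; rewrite mem_cat yb orbT inE negb_or => /(_ isT)/andP[].
    + have : y \notin v :: imod c by apply: dj; rewrite mem_cat yb orbT.
      rewrite inE negb_or => /andP[yv yc]; rewrite /= /upd (negPf yv) f1 ?inE ?negb_or ?yv //.
      by apply: rs; rewrite mem_cat yb orbT.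
  - by move=> s' _; rewrite eE.
Qed.

(** A cell holds a stored value or its initial one, which transfers the bounds on stored values to
    whatever an array contains, the output included. *)
Definition archived (s s' : st) :=
  (forall z, z \in stored s -> z \in stored s') /\
  (forall a e, arr s' a e \in stored s' \/ arr s' a e = arr s a e).

Lemma archived_trans s1 s2 s3 : archived s1 s2 -> archived s2 s3 -> archived s1 s3.
Proof.
move=> [h1 h2] [g1 g2]; split=> [z /h1/g1//|a e].
by case: (g2 a e) => [|->]; [left|case: (h2 a e) => [/g1|->]; [left|right]].
Qed.

Lemma archivedE (s s1 s2 : st) : arr s1 = arr s -> stored s1 = stored s ->
  archived s1 s2 -> archived s s2.
Proof. by move=> ea es [h1 h2]; split=> [z|a e]; rewrite -?es -?ea; [apply: h1|apply: h2]. Qed.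

Lemma exec_archived c (s : st) : always (exec c s) (archived s).
Proof.
elim: c s => //=; try by move=> *; split=> //= *; right.
- move=> c1 IH1 c2 IH2 s; apply: always_rbind.
  apply: always_mono (IH1 s) => s1 h1; apply: always_mono (IH2 s1) => s2.
  exact: archived_trans.
- move=> a e x s; split=> [z zs|a' e'] /=; first by rewrite inE zs orbT.
  rewrite /upd; case: eqP => [->|_]; last by right.
  by case: eqP => [_|_]; [left; rewrite inE eqxx|right].
- by move=> x c1 IH1 c2 IH2 s; case: ifP => _;
    [apply: always_mono (IH1 _)|apply: always_mono (IH2 _)] => s1; exact: archivedE.
- by move=> e1 e2 c1 IH1 c2 IH2 s; case: ifP => _;
    [apply: always_mono (IH1 _)|apply: always_mono (IH2 _)] => s1; exact: archivedE.
- move=> v e c IH s.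
  apply: (always_iteri (I := fun=> archived s)) => [|j s' _ h].
    by split=> //= *; right.
  by apply: always_mono (IH _) => s1 h1; apply: archived_trans h _; apply: archivedE h1.
Qed.

Lemma exec_prim c1 c2 (s s1 : st) Q : exec c1 s = Done s1 ->
  always (exec c2 s1) Q -> always (exec (Seq c1 c2) s) Q.
Proof. by move=> /= ->. Qed.

Lemma exec_last c (s s1 : st) Q : exec c s = Done s1 -> Q s1 -> always (exec c s) Q.
Proof. by move=> ->. Qed.

Lemma exec_ifz x c1 c2 (s : st) Q :
  (sreg s x = 0 -> always (exec c1 (tick 2 s)) Q) ->
  (sreg s x != 0 -> always (exec c2 (tick 2 s)) Q) -> always (exec (IfZero x c1 c2) s) Q.
Proof. by move=> h1 h2 /=; case: eqVneq => [/h1|/h2]. Qed.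

Lemma exec_ifle e1 e2 c1 c2 (s : st) Q :
  ((ieval (ireg s) e1 <= ieval (ireg s) e2)%N -> always (exec c1 (tick 1 s)) Q) ->
  ((ieval (ireg s) e2 < ieval (ireg s) e1)%N -> always (exec c2 (tick 1 s)) Q) ->
  always (exec (IfLe e1 e2 c1 c2) s) Q.
Proof. by move=> h1 h2 /=; case: leqP => [/h1|/h2]. Qed.

End Logic.

(** * The program *)

Local Notation "c1 ;; c2" := (Seq c1 c2) (at level 61, right associativity).
Local Notation ix e1 W e2 := (IAdd (IMul e1 W) e2).
Local Notation "$ x" := (IVar x) (at level 1, format "$ x").
Local Notation eN := (IMul $0 $2).

(* Index registers: 4 counts the output vectors, 5 the selected matrices [A'_l], 11 is
   the last pivot, 14 the width of the window; scalar register 0 is the common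
   denominator of the current projection.
   Arrays: 2 the row being inserted, 3 its product with the projection, 4 the projection
   multiplied by its denominator, 5 the [A'_l], 6 the random numbers, 7 the blow-ups. *)
Definition dot_entry : cmd :=
  For 8 $14 (Fetch 2 2 $8 ;; Fetch 3 4 (ix $8 $14 $9) ;; SOp OMul 2 2 3 ;; SOp OAdd 1 1 2).
Definition dot_row : cmd :=
  For 9 $14 (SCst 1 0 0 ;; dot_entry ;; Store 3 $9 1).
(** The last nonzero entry is taken, because in a block of the chain the unknowns of the previous
    step come last and must be eliminated first. The value [$14], the width, signals that there is
    no pivot. *)
Definition find_pivot : cmd :=
  ISet 11 $14 ;; For 9 $14 (Fetch 2 3 $9 ;; IfZero 2 Skip (ISet 11 $9)).
(** Dividing by the old denominator is exact, as in Bareiss elimination: the new numerators are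
    integral because they again belong to a projection with a minor as denominator. *)
Definition update_row : cmd :=
  For 9 $14 (Fetch 3 4 (ix $8 $14 $9) ;; Fetch 2 3 $9 ;; SOp OMul 3 5 3 ;;
             SOp OMul 2 4 2 ;; SOp OSub 3 3 2 ;; SOp ODiv 3 3 0 ;;
             Store 4 (ix $8 $14 $9) 3).
(** The entry in the pivot column is saved in register 4 before its row is overwritten, and the old
    denominator is kept until all rows are done. Adding the zero of register 6 serves to copy a
    register. *)
Definition update : cmd :=
  Fetch 5 3 $11 ;; For 8 $14 (Fetch 4 4 (ix $8 $14 $11) ;; update_row) ;;
  SCst 6 0 0 ;; SOp OAdd 0 5 6.
Definition insert : cmd :=
  dot_row ;; find_pivot ;; IfLe (IAdd $11 (ICst 1)) $14 update Skip.

Ltac step := eapply exec_prim; [reflexivity|].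
Ltac fin := eapply exec_last; [reflexivity|].
Arguments exec : simpl never.

Section Insert.
Variables (R : realType) (ok : R[i] -> Prop).
Local Notation F := R[i].
Local Notation st := (state F).

Definition stored_ok (s : st) := forall z, z \in stored s -> ok z.

Lemma stored_ok_cons (l : seq F) v : (forall z, z \in l -> ok z) -> ok v ->
  forall z, z \in v :: l -> ok z.
Proof. by move=> h hv z /=; rewrite inE => /orP[/eqP->|/h]. Qed.

Definition mxarr W (f : nat -> F) : 'M[F]_W := \matrix_(i, j) f (i * W + j)%N.
Definition rowarr W (f : nat -> F) : 'rV[F]_W := \row_j f j.

Lemma flat_eq W i j i' j' : (j < W)%N -> (j' < W)%N ->
  ((i * W + j)%N == (i' * W + j')%N) = (i == i') && (j == j').
Proof.
move=> jW j'W; apply/eqP/andP => [E|[/eqP-> /eqP->]] //.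
have W0 : (0 < W)%N by apply: leq_ltn_trans jW.
have := congr1 (divn^~ W) E; have := congr1 (modn^~ W) E.
by rewrite !modnMDl !modn_small // !divnMDl // !divn_small // !addn0 => -> ->.
Qed.

Lemma dot_entry_spec (s : st) W j : ireg s 14 = W -> ireg s 9 = j ->
  sreg s 1 = 0 -> stored_ok s ->
  always (exec dot_entry s) (fun s' => stored_ok s' /\
    sreg s' 1 = \sum_(i < W) arr s 2 i * arr s 4 (i * W + j)%N).
Proof.
move=> sW sj s0 oks.
apply: (exec_for (I := fun k s' => stored_ok s' /\
    sreg s' 1 = \sum_(0 <= i < k) arr s 2 i * arr s 4 (i * W + j)%N)).
- by rewrite big_nil.
- move=> k s' _ [f1 f2 f3] [oks' IH]; step; step; step; fin; split=> //.
  by rewrite big_nat_recr //= /upd /= IH !f3 // !f1 // sW sj.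
- by move=> s' _ [oks' ->]; rewrite /= sW big_mkord.
Qed.

Lemma dot_row_spec (s : st) W : ireg s 14 = W -> stored_ok s ->
  (forall j, ok ((rowarr W (arr s 2) *m mxarr W (arr s 4)) 0 j)) ->
  always (exec dot_row s) (fun s' => stored_ok s' /\
    rowarr W (arr s' 3) = rowarr W (arr s 2) *m mxarr W (arr s 4)).
Proof.
move=> sW oks okY.
have YE (j : 'I_W) : (rowarr W (arr s 2) *m mxarr W (arr s 4)) 0 j =
    \sum_(i < W) arr s 2 i * arr s 4 (i * W + j)%N.
  by rewrite mxE; apply: eq_bigr => i _; rewrite !mxE.
apply: (exec_for (I := fun k s' => stored_ok s' /\ forall j, (j < k)%N ->
    arr s' 3 j = \sum_(i < W) arr s 2 i * arr s 4 (i * W + j)%N)).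
- by [].
- move=> k s' kW [f1 f2 f3] [oks' IH]; step; apply: exec_seq.
  rewrite /= sW in kW.
  apply: always_mono (dot_entry_spec (W := W) (j := k) _ _ _ _) => //; last first.
    by rewrite /= /upd /= f1.
  move=> s2 [ok2 e2] [g1 g2 g3]; fin.
  have v2 : sreg s2 1 = \sum_(i < W) arr s 2 i * arr s 4 (i * W + k)%N.
    by rewrite e2 /=; apply: eq_bigr => i _; rewrite !f3.
  split.
    rewrite /stored_ok /=; apply: stored_ok_cons; first exact: ok2.
    by rewrite v2 -(YE (Ordinal kW)); apply: okY.
  move=> j; rewrite ltnS /= /upd /= g1 //= /upd /= g3 //= leq_eqVlt.
  by case: eqP => [-> _|_ /= jk]; [|exact: IH].
- move=> s' _ [oks' IH]; split=> //; apply/rowP=> j.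
  by rewrite YE mxE IH //= sW.
Qed.

Definition pivot_spec W (y : nat -> F) (c : nat) :=
  (c = W /\ forall j, (j < W)%N -> y j = 0) \/
  [/\ (c < W)%N, y c != 0 & forall j, (c < j < W)%N -> y j = 0].

Lemma find_pivot_spec (s : st) W : ireg s 14 = W -> stored_ok s ->
  always (exec find_pivot s) (fun s' => stored_ok s' /\ pivot_spec W (arr s 3) (ireg s' 11)).
Proof.
move=> sW oks; step.
apply: (exec_for (I := fun k s' => stored_ok s' /\
  ((ireg s' 11 = W /\ forall j, (j < k)%N -> arr s 3 j = 0) \/
   [/\ (ireg s' 11 < k)%N, arr s 3 (ireg s' 11) != 0 &
       forall j, (ireg s' 11 < j < k)%N -> arr s 3 j = 0]))).
- by split=> //; left; rewrite /= /upd /= sW.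
- move=> k s' kW [f1 f2 f3] [oks' IH]; step; apply: exec_ifz => yk; fin; split=> //;
    move: yk; rewrite /= /upd /= f3 //= => yk.
    case: IH => [[-> IH]|[h1 h2 h3]]; [left|right].
      by split=> // j; rewrite ltnS leq_eqVlt => /predU1P[->|/IH].
    split=> // [|j]; first exact: ltnW.
    rewrite ltnS => /andP[cj]; rewrite leq_eqVlt => /predU1P[->//|jk].
    by apply: h3; rewrite cj.
  by right; split=> // j; lia.
- by move=> s' _ [oks' IH]; split=> //; move: IH; rewrite /= /upd /= sW.
Qed.

Lemma update_row_spec (s : st) W i (new := fun j =>
    (sreg s 5 * arr s 4 (i * W + j)%N - sreg s 4 * arr s 3 j) / sreg s 0) :
  ireg s 14 = W -> ireg s 8 = i -> stored_ok s -> (forall j, (j < W)%N -> ok (new j)) ->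
  always (exec update_row s) (fun s' => stored_ok s' /\
    forall i' j, (j < W)%N ->
      arr s' 4 (i' * W + j)%N = if i' == i then new j else arr s 4 (i' * W + j)%N).
Proof.
move=> sW si oks oknew.
apply: (exec_for (I := fun k s' => stored_ok s' /\ forall i' j, (j < W)%N ->
  arr s' 4 (i' * W + j)%N =
    if (i' == i) && (j < k)%N then new j else arr s 4 (i' * W + j)%N)).
- by split=> // i' j jW; rewrite ltn0 andbF.
- move=> k s' kW [f1 f2 f3] [oks' IH]; rewrite /= sW in kW.
  step; step; step; step; step; step; fin.
  have E : (sreg s' 5 * arr s' 4 (i * W + k)%N - sreg s' 4 * arr s' 3 k) / sreg s' 0 = new k.
    by rewrite IH // ltnn andbF !f2 // f3.
  split.
    rewrite /stored_ok /=; apply: stored_ok_cons; first exact: oks'.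
    by rewrite /= /upd /= !f1 // sW si E; apply: oknew.
  move=> i' j jW; rewrite /= /upd /= !f1 // sW si E flat_eq // ltnS.
  have [->|i'i] := eqVneq i' i => /=; last by rewrite IH // (negPf i'i).
  by rewrite [in RHS]leq_eqVlt; case: eqP => [->//|_] /=; rewrite IH // eqxx.
- move=> s' _ [oks' IH]; split=> // i' j jW; rewrite IH // /= sW jW andbT //.
Qed.

Lemma update_spec (s : st) W c (new := fun i j =>
    (arr s 3 c * arr s 4 (i * W + j)%N - arr s 4 (i * W + c)%N * arr s 3 j) / sreg s 0) :
  ireg s 14 = W -> ireg s 11 = c -> (c < W)%N -> stored_ok s ->
  (forall i j, (i < W)%N -> (j < W)%N -> ok (new i j)) ->
  always (exec update s) (fun s' => [/\ stored_ok s', sreg s' 0 = arr s 3 c &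
    forall i j, (i < W)%N -> (j < W)%N -> arr s' 4 (i * W + j)%N = new i j]).
Proof.
move=> sW sc cW oks oknew; step; apply: exec_seq.
set s1 := tick _ _.
apply: (exec_for (I := fun k s' => stored_ok s' /\ forall i j, (j < W)%N ->
  arr s' 4 (i * W + j)%N = if (i < k)%N then new i j else arr s 4 (i * W + j)%N)).
- by [].
- move=> k s' kW [f1 f2 f3] [oks' IH]; rewrite /= sW in kW; step.
  set s2 := tick _ _.
  have s14 : ireg s' 14 = W by rewrite f1.
  have s11 : ireg s' 11 = c by rewrite f1.
  have s5 : sreg s' 5 = arr s 3 c by rewrite f2 //= /upd /= sc.
  have s0 : sreg s' 0 = sreg s 0 by rewrite f2.
  have a3 : arr s' 3 = arr s 3 by rewrite f3.
  have E j : (j < W)%N -> (sreg s2 5 * arr s2 4 (k * W + j)%N - sreg s2 4 * arr s2 3 j) / sreg s2 0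
      = new k j.
    by move=> jW; rewrite /s2 /= /upd /= s14 s11 s5 s0 a3 !IH // ltnn.
  apply: always_mono (update_row_spec (W := W) (i := k) _ _ _ _) => //.
  + move=> s3 [ok3 IH3]; split=> // i j jW; rewrite IH3 // ltnS.
    have [->|ik] := eqVneq i k; first by rewrite E // leqnn.
    by rewrite /= IH // [in RHS]leq_eqVlt (negPf ik).
  + by move=> j jW; rewrite E //; apply: oknew.
- move=> s' [f1 f2 f3] [oks' IH] [g1 g2 g3]; step; fin; split=> //.
    by rewrite /= /upd /= f2 //= /upd /= addr0 sc.
  by move=> i j iW jW; rewrite /= IH //= sW iW.
Qed.

Lemma insert_spec (s : st) W (dl := sreg s 0) (Q : 'M[F]_W)
    (v := rowarr W (arr s 2)) :
  ireg s 14 = W -> stored_ok s -> dl != 0 -> mxarr W (arr s 4) = dl *: Q ->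
  (forall j, ok (dl * (v *m Q) 0 j)) ->
  (forall c, (v *m Q) 0 c != 0 -> forall i j, ok (dl * (v *m Q) 0 c * deflate Q v c i j)) ->
  always (exec insert s) (fun s' => stored_ok s' /\
    ([/\ v *m Q = 0, sreg s' 0 = dl, mxarr W (arr s' 4) = dl *: Q & ireg s' 11 = W] \/
     exists c : 'I_W, [/\ (v *m Q) 0 c != 0, forall j : 'I_W, (c < j)%N -> (v *m Q) 0 j = 0,
       sreg s' 0 = dl * (v *m Q) 0 c,
       mxarr W (arr s' 4) = (dl * (v *m Q) 0 c) *: deflate Q v c & ireg s' 11 = c])).
Proof.
move=> sW oks dl0 QE okY okQ; rewrite /dl in dl0 QE okY okQ *; apply: exec_seq.
have YE : v *m mxarr W (arr s 4) = sreg s 0 *: (v *m Q) by rewrite QE scalemxAr.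
apply: always_mono (dot_row_spec sW oks _) => [s1 [ok1 y1] [f1 f2 f3]|j]; last first.
  by rewrite YE mxE.
rewrite YE in y1; have y1E (j : 'I_W) : arr s1 3 j = sreg s 0 * (v *m Q) 0 j.
  by move/rowP/(_ j): y1; rewrite !mxE.
apply: exec_seq.
apply: always_mono (find_pivot_spec (W := W) _ _) => //; last by rewrite f1.
move=> s2 [ok2 piv] [g1 g2 g3].
have s2Q : mxarr W (arr s2 4) = sreg s 0 *: Q by rewrite g3 // f3.
have s20 : sreg s2 0 = sreg s 0 by rewrite g2 // f2.
have s2W : ireg s2 14 = W by rewrite g1 // f1.
apply: exec_ifle => cW; rewrite /= s2W addn1 in cW.
  case: piv => [[cE]|[_ yc ycmax]]; first by rewrite cE ltnn in cW.
  set c := Ordinal cW.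
  have yc0 : (v *m Q) 0 c != 0.
    by apply: contraNneq yc => h; rewrite (y1E c) h mulr0.
  have newE (i j : 'I_W) : (arr s2 3 c * arr s2 4 (i * W + j)%N -
      arr s2 4 (i * W + c)%N * arr s2 3 j) / sreg s2 0
      = sreg s 0 * (v *m Q) 0 c * deflate Q v c i j.
    have /matrixP/(_ i j) e1 := s2Q; have /matrixP/(_ i c) e2 := s2Q.
    rewrite !mxE in e1 e2; rewrite e1 e2.
    rewrite !g3 // !y1E s20 deflateE; move: ((v *m Q) 0 c) yc0 ((v *m Q) 0 j) (Q i j) (Q i c).
    by move=> a a0 b q z; field; rewrite a0 dl0.
  apply: always_mono (always_and (update_spec (W := W) (c := c) _ _ _ _ _) (exec_frame _ _)) => //.
    move=> s3 [[ok3 d3 Q3] [h1 _ _]]; split=> //; right; exists c; split=> //.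
    - by move=> j cj; have := ycmax j; rewrite (y1E j) cj ltn_ord => /(_ isT)/eqP;
        rewrite mulf_eq0 (negPf dl0) => /eqP.
    - by rewrite d3 g3 // y1E.
    - by apply/matrixP=> i j; rewrite !mxE Q3 // newE !mxE.
    - by rewrite h1.
  by move=> i j iW jW; have := newE (Ordinal iW) (Ordinal jW) => /= ->; exact: okQ.
case: piv => [[cE y0]|[h _ _]]; last by move: cW; rewrite ltnS leqNgt h.
fin; split=> //; left; split=> //.
apply/rowP=> j; rewrite [RHS]mxE; apply/eqP; have := y0 j (ltn_ord j).
by rewrite y1E => /eqP; rewrite mulf_eq0 (negPf dl0).
Qed.

End Insert.

(** * Selection of linearly independent matrices *)

Definition clear_square : cmd :=
  SCst 6 0 0 ;; For 8 $14 (For 9 $14 (Store 4 (ix $8 $14 $9) 6)).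
Definition identity_square : cmd :=
  clear_square ;; SCst 0 1 0 ;; For 8 $14 (Store 4 (ix $8 $14 $8) 0).
Definition load_matrix : cmd := For 8 $14 (Fetch 2 0 (ix $6 $14 $8) ;; Store 2 $8 2).
Definition keep_matrix : cmd :=
  For 8 $14 (Fetch 2 2 $8 ;; Store 5 (ix $5 $14 $8) 2) ;; ISet 5 (IAdd $5 (ICst 1)).
Definition select_one : cmd :=
  load_matrix ;; insert ;; IfLe (IAdd $11 (ICst 1)) $14 keep_matrix Skip.
Definition select : cmd :=
  ISet 14 (IMul $0 $0) ;; identity_square ;; For 6 $1 select_one.

Section Phases.
Variables (R : realType) (ok : R[i] -> Prop).
Local Notation F := R[i].
Local Notation st := (state F).
Hypothesis ok0 : ok 0.
Hypothesis ok1 : ok 1.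
Local Notation allok := (stored_ok ok).

Lemma clear_square_spec (s : st) W : ireg s 14 = W -> allok s ->
  always (exec clear_square s) (fun s' => allok s' /\
    forall i j, (i < W)%N -> (j < W)%N -> arr s' 4 (i * W + j)%N = 0).
Proof.
move=> sW oks; step.
apply: (exec_for (I := fun k s' => allok s' /\
  forall i j, (i < k)%N -> (j < W)%N -> arr s' 4 (i * W + j)%N = 0)) => //.
- move=> k s1 kW [f1 f2 f3] [oks1 IH1]; rewrite /= sW in kW.
  apply: (exec_for (I := fun l s' => allok s' /\
    forall i j, (i < k)%N || (i == k) && (j < l)%N -> (j < W)%N -> arr s' 4 (i * W + j)%N = 0)).
  + by split=> // i j; rewrite ltn0 andbF orbF; exact: IH1.
  + move=> l s2 lW [g1 g2 g3] [oks2 IH2]; rewrite /= /upd /= f1 //= sW in lW.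
    have z : sreg s2 6 = 0 by rewrite g2 //= f2.
    fin; split.
      by rewrite /stored_ok /=; apply: stored_ok_cons; [exact: oks2|rewrite z].
    move=> i j ij jW; rewrite /= /upd /= !g1 //= /upd /= f1 //= sW flat_eq // z.
    case: ifP => // /negbT; rewrite negb_and => /orP ij'; apply: IH2 => //.
    by move: ij; rewrite ltnS [(j <= l)%N]leq_eqVlt; case: ij' => /negPf->; rewrite ?orbF //= => ->.
  + move=> s2 [g1 g2 g3] [oks2 IH2]; split=> // i j ik jW; apply: IH2 => //.
    by rewrite [ieval _ _]/= /upd /= f1 //= sW jW andbT orbC -leq_eqVlt.
- by move=> s' _ [oks' IH]; split=> // i j iW jW; apply: IH; rewrite //= sW.
Qed.

Lemma mxarrP W (f : nat -> F) (Q : 'M[F]_W) :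
  (forall i j : 'I_W, f (i * W + j)%N = Q i j) -> mxarr W f = Q.
Proof. by move=> h; apply/matrixP=> i j; rewrite mxE h. Qed.

Lemma identity_square_spec (s : st) W : ireg s 14 = W -> allok s ->
  always (exec identity_square s) (fun s' => [/\ allok s', sreg s' 0 = 1 &
    mxarr W (arr s' 4) = 1%:M]).
Proof.
move=> sW oks; apply: exec_seq.
apply: always_mono (clear_square_spec sW oks) => s1 [oks1 z1] [f1 f2 f3].
step; set s2 := tick _ _.
apply: (exec_for (I := fun k s' => allok s' /\ forall i j, (i < W)%N -> (j < W)%N ->
    arr s' 4 (i * W + j)%N = ((i == j) && (i < k)%N)%:R)).
- by split=> // i j iW jW; rewrite ltn0 andbF; exact: z1.
- move=> k s' kW [g1 g2 g3] [oks' IH]; rewrite /= f1 // sW in kW.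
  have z : sreg s' 0 = 1 by rewrite g2.
  fin; split.
    by rewrite /stored_ok /=; apply: stored_ok_cons; [exact: oks'|rewrite z].
  move=> i j iW jW; rewrite /= /upd /= !g1 //= f1 // sW flat_eq // z IH // ltnS.
  have [->|ik] := eqVneq i k => /=; last by rewrite [(i <= k)%N]leq_eqVlt (negPf ik).
  by rewrite leqnn ltnn andbT andbF eq_sym; case: eqP.
- move=> s' [g1 g2 g3] [oks' IH]; split=> //; first by rewrite g2.
  apply: mxarrP => i j; rewrite IH //= f1 // sW ltn_ord andbT mxE.
  by rewrite -val_eqE.
Qed.

Lemma load_matrix_spec (s : st) W t : ireg s 14 = W -> ireg s 6 = t -> allok s ->
  (forall i, (i < W)%N -> ok (arr s 0 (t * W + i)%N)) ->
  always (exec load_matrix s) (fun s' => allok s' /\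
    forall i, (i < W)%N -> arr s' 2 i = arr s 0 (t * W + i)%N).
Proof.
move=> sW stt oks okA.
apply: (exec_for (I := fun k s' => allok s' /\ forall i, (i < k)%N ->
  arr s' 2 i = arr s 0 (t * W + i)%N)) => //; last first.
  by move=> s' _ [oks' IH]; split=> // i iW; apply: IH; rewrite /= sW.
move=> k s' kW [f1 f2 f3] [oks' IH]; rewrite /= sW in kW; step; fin.
split.
  rewrite /stored_ok /=; apply: stored_ok_cons; first exact: oks'.
  by rewrite /= /upd /= !f1 // sW stt f3 //; apply: okA.
move=> i; rewrite ltnS leq_eqVlt /= /upd /= !f1 // sW stt f3 //.
by case: eqP => [->//|_]; exact: IH.
Qed.

Lemma keep_matrix_spec (s : st) W m : ireg s 14 = W -> ireg s 5 = m -> allok s ->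
  (forall i, (i < W)%N -> ok (arr s 2 i)) ->
  always (exec keep_matrix s) (fun s' => [/\ allok s', ireg s' 5 = m.+1 &
    forall l i, (i < W)%N ->
      arr s' 5 (l * W + i)%N = if l == m then arr s 2 i else arr s 5 (l * W + i)%N]).
Proof.
move=> sW sm oks okv; apply: exec_seq.
apply: (exec_for (I := fun k s' => allok s' /\ forall l i, (i < W)%N ->
  arr s' 5 (l * W + i)%N = if (l == m) && (i < k)%N then arr s 2 i else arr s 5 (l * W + i)%N)).
- by split=> // l i iW; rewrite ltn0 andbF.
- move=> k s' kW [f1 f2 f3] [oks' IH]; rewrite /= sW in kW; step; fin.
  split.
    rewrite /stored_ok /=; apply: stored_ok_cons; first exact: oks'.
    by rewrite /= /upd /= f3 //; apply: okv.
  move=> l i iW; rewrite /= /upd /= !f1 // sW sm f3 // flat_eq // IH // ltnS.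
  have [->|lm] := eqVneq l m => //=.
  by rewrite [(i <= k)%N]leq_eqVlt; case: eqP => [->|].
- move=> s' [f1 f2 f3] [oks' IH] _; fin; split=> //.
    by rewrite /= /upd /= f1 // sm addn1.
  by move=> l i iW; rewrite /= IH //= sW iW andbT.
Qed.

Variables (okE : F -> Prop) (Dmax : nat).
Hypotheses (okE0 : okE 0) (okEok : forall z, okE z -> ok z).
(** The size estimates enter the correctness of the elimination through this interface only: [okE]
    restricts the entries of inserted rows, [ok] everything that is stored. *)
Hypothesis hwin : forall D W dl (Q : 'M[F]_W), (D <= Dmax)%N -> (W <= Dmax)%N ->
  windowed okE D dl Q ->
  [/\ dl != 0, ok dl, forall i j, ok (dl * Q i j) &
      forall v : 'rV[F]_W, (forall i, okE (v 0 i)) -> forall j, ok (dl * (v *m Q) 0 j)].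

Definition represents W (s : st) (Q : 'M[F]_W) :=
  mxarr W (arr s 4) = sreg s 0 *: Q /\ reflecting Q.

Lemma insert_win (s : st) D W (Q : 'M[F]_W) (v := rowarr W (arr s 2)) :
  (D <= Dmax)%N -> (W <= Dmax)%N -> ireg s 14 = W -> allok s ->
  represents s Q -> windowed okE D (sreg s 0) Q -> (forall i, okE (v 0 i)) ->
  always (exec insert s) (fun s' => allok s' /\ exists Q' : 'M[F]_W,
    [/\ represents s' Q', windowed okE D (sreg s' 0) Q',
        forall x : 'cV[F]_W, Q' *m x = x <-> Q *m x = x /\ v *m x = 0 &
        [/\ v *m Q = 0, Q' = Q & ireg s' 11 = W] \/
        exists c : 'I_W, [/\ (v *m Q) 0 c != 0, Q' = deflate Q v c, ireg s' 11 = c &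
          forall j : 'I_W, (c < j)%N -> (v *m Q) 0 j = 0]]).
Proof.
move=> DD WD sW oks [QE rQ] wQ okv.
have [dl0 okdl okQ okvQ] := hwin DD WD wQ.
have wQ' c (yc : (v *m Q) 0 c != 0) := windowed_deflate okE0 okv yc wQ.
apply: always_mono (insert_spec sW oks dl0 QE _ _) => [s' [oks']|j|c yc i j].
- case=> [[vQ e0 eQ e11]|[c [yc ycmax e0 eQ e11]]].
    split=> //; exists Q; split; last by left.
    - by split=> //; rewrite e0.
    - by rewrite e0.
    - move=> x; split=> [Qx|[]//]; split=> //; exact: fixed_kernel vQ Qx.
  split=> //; exists (deflate Q v c); split; last by right; exists c.
  - by split; [rewrite e0|exact: deflate_reflecting].
  - by rewrite e0; exact: wQ'.
  - by move=> x; exact: deflate_fixed.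
- exact: okvQ.
- by have [_ _ h _] := hwin DD WD (wQ' c yc); exact: h.
Qed.

Definition selmx m W (f : nat -> F) : 'M[F]_(m, W) := \matrix_(l, i) f (l * W + i)%N.

Lemma selmx_ext m W f g : (forall l i, (l < m)%N -> (i < W)%N -> f (l * W + i)%N = g (l * W + i)%N) ->
  selmx m W f = selmx m W g.
Proof. by move=> fg; apply/matrixP=> l i; rewrite !mxE fg. Qed.

Lemma selmxS m W f : (selmx m.+1 W f :=: selmx m W f + (\row_i f (m * W + i)%N))%MS.
Proof.
apply/eqmxP/andP; split.
  apply/row_subP=> l; have [lm|ml] := ltnP l m.
    have -> : row l (selmx m.+1 W f) = row (Ordinal lm) (selmx m W f).
      by apply/rowP=> i; rewrite !mxE.
    by apply: submx_trans (row_sub _ _) (addsmxSl _ _).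
  have -> : row l (selmx m.+1 W f) = \row_i f (m * W + i)%N.
    apply/rowP=> i; rewrite !mxE; congr (f (_ * _ + _)%N).
    by apply/eqP; rewrite eqn_leq ml andbT -ltnS.
  exact: addsmxSr.
rewrite addsmx_sub; apply/andP; split.
  apply/row_subP=> l.
  have -> : row l (selmx m W f) = row (widen_ord (leqnSn m) l) (selmx m.+1 W f).
    by apply/rowP=> i; rewrite !mxE.
  exact: row_sub.
have -> : \row_i f (m * W + i)%N = row ord_max (selmx m.+1 W f).
  by apply/rowP=> i; rewrite !mxE.
exact: row_sub.
Qed.

(** Testing on the columns of [cokermx S] turns vanishing on the kernel into membership in the row
    space; a rejected matrix is thus a combination of those kept. *)
Lemma sub_by_kernel m W (S : 'M[F]_(m, W)) (v : 'rV[F]_W) :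
  (forall x : 'cV[F]_W, S *m x = 0 -> v *m x = 0) -> (v <= S)%MS.
Proof.
move=> h; rewrite submxE; apply/eqP/rowP=> j.
have := h (cokermx S *m delta_mx j 0); rewrite (mulmxA S) (mulmxA v) mulmx_coker mul0mx.
by move=> /(_ erefl)/colP/(_ 0); rewrite -colE [LHS]mxE => ->; rewrite !mxE.
Qed.

Definition inrow W (f : nat -> F) t : 'rV[F]_W := \row_i f (t * W + i)%N.

Definition selected W (f : nat -> F) p t m (g : nat -> F) :=
  [/\ (m <= t)%N, \rank (selmx m W g) = m,
      forall l, (l < m)%N -> exists2 t', (t' < p)%N &
         forall i, (i < W)%N -> g (l * W + i)%N = f (t' * W + i)%N &
      forall t', (t' < t)%N -> (inrow W f t' <= selmx m W g)%MS].

(** Each matrix is flattened to a row of length [n * n]. The projection fixes exactly the common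
    kernel of the rows kept, so a pivot is found precisely when the new row is independent of
    them. *)
Lemma select_spec (s : st) n p : ireg s 0 = n -> ireg s 1 = p -> ireg s 5 = 0%N ->
  (n * n <= Dmax)%N -> allok s ->
  (forall t i, (t < p)%N -> (i < n * n)%N -> okE (arr s 0 (t * (n * n) + i)%N)) ->
  always (exec select s) (fun s' => allok s' /\
     selected (n * n) (arr s 0) p p (ireg s' 5) (arr s' 5)).
Proof.
move=> sn sp s5 WD oks okA; set W := (n * n)%N in WD okA *; step; set s1 := tick _ _.
have s1W : ireg s1 14 = W by rewrite /s1 /= /upd /= sn.
apply: exec_seq; apply: always_mono (identity_square_spec s1W _) => //.
move=> s2 [oks2 d2 Q2] [f1 f2 f3].
have s2W : ireg s2 14 = W by rewrite f1.
have a20 : arr s2 0 = arr s 0 by rewrite f3.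
have s2p : ireg s2 1 = p by rewrite f1.
apply: (exec_for (I := fun t s' => allok s' /\
  selected W (arr s 0) p t (ireg s' 5) (arr s' 5) /\
  exists Q : 'M[F]_W, [/\ represents s' Q, windowed okE W (sreg s' 0) Q &
    forall x : 'cV[F]_W, Q *m x = x <-> selmx (ireg s' 5) W (arr s' 5) *m x = 0])).
- have m0 : ireg (tick 1 s2) 5 = 0%N by rewrite /= f1.
  split=> //; split.
    by rewrite m0; split=> //; apply/eqP; rewrite -leqn0 rank_leq_row.
  exists 1%:M; split.
  + split; first by rewrite /= d2 scale1r.
    by move=> c; right.
  + by rewrite /= d2; exact: windowed_init.
  + by move=> x; rewrite m0 mul1mx; split=> // _; apply/matrixP=> -[].
- move=> t s3 tp [g1 g2 g3] [oks3 [sel3 [Q [rQ wQ kQ]]]]; rewrite /= s2p in tp.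
  have s3W : ireg s3 14 = W by rewrite g1.
  have a30 : arr s3 0 = arr s 0 by rewrite g3.
  apply: exec_seq.
  apply: always_mono (load_matrix_spec (W := W) (t := t) _ _ _ _) => //; last first.
    by move=> i iW; rewrite /= a30; apply/okEok/okA.
  move=> s4 [oks4 v4] [h1 h2 h3]; apply: exec_seq.
  have vE : rowarr W (arr s4 2) = inrow W (arr s 0) t.
    by apply/rowP=> i; rewrite !mxE v4 //= a30.
  have s4W : ireg s4 14 = W by rewrite h1.
  have rQ4 : represents s4 Q by case: rQ => ? ?; split=> //; rewrite h3 // h2.
  have wQ4 : windowed okE W (sreg s4 0) Q by rewrite h2.
  have okv i : okE (rowarr W (arr s4 2) 0 i) by rewrite vE mxE; exact: okA.
  have := insert_win WD WD s4W oks4 rQ4 wQ4 okv.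
  apply: always_mono => s5' [oks5 [Q' [rQ' wQ' kQ' cases]]] [i1 i2 i3].
  have s5W : ireg s5' 14 = W by rewrite i1.
  have m5 : ireg s5' 5 = ireg s3 5 by rewrite i1 // h1.
  have a55 : arr s5' 5 = arr s3 5 by rewrite i3 // h3.
  have a52 : arr s5' 2 = arr s4 2 by rewrite i3.
  set m := ireg s3 5 in sel3 kQ m5.
  case: sel3 => [mt rS orig sub3].
  apply: exec_ifle => c5; rewrite /= s5W addn1 in c5.
    case: cases => [[_ _ e]|[c [yc Q'E ec _]]]; first by rewrite e ltnn in c5.
    have := @keep_matrix_spec (tick 1 s5') W m s5W m5 oks5 _.
    have okv2 i : (i < W)%N -> ok (arr (tick 1 s5') 2 i).
      by move=> iW; rewrite /= a52; have := okv (Ordinal iW); rewrite mxE => /=; exact: okEok.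
    move=> /(_ okv2)/always_and/(_ (exec_frame _ _)).
    apply: always_mono => s6 [[oks6 m6 g6] [j1 j2 j3]].
    have ESm : selmx m W (arr s6 5) = selmx m W (arr s3 5).
      by apply: selmx_ext => l i lm iW; rewrite g6 // ltn_eqF //= a55.
    have Em : (\row_(i < W) arr s6 5 (m * W + i)%N) = inrow W (arr s 0) t.
      by rewrite -vE; apply/rowP=> i; rewrite !mxE g6 // eqxx /= a52.
    have ES := selmxS m W (arr s6 5); rewrite ESm Em in ES.
    have notin : ~~ (inrow W (arr s 0) t <= selmx m W (arr s3 5))%MS.
      apply/negP=> /submxP[D DE]; case/eqP: yc; rewrite vE DE -mulmxA.
      have -> : selmx m W (arr s3 5) *m Q = 0; last by rewrite mulmx0 mxE.
      apply/matrixP=> a b; have := (kQ (Q *m delta_mx b 0)).1.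
      rewrite !mulmxA (reflecting_idem rQ.2) => /(_ erefl)/matrixP/(_ a 0).
      by rewrite -colE [LHS]mxE => ->; rewrite !mxE.
    split=> //; split.
      rewrite m6; split.
      - by rewrite ltnS.
      - apply/eqP; rewrite eqn_leq rank_leq_row ES /= -{1}rS.
        exact: rank_adds_gt.
      - move=> l; rewrite ltnS leq_eqVlt => /predU1P[->|lm].
          by exists t => // i iW; rewrite g6 // eqxx /= a52 v4 //= a30.
        have [t' t'p e] := orig l lm; exists t' => // i iW.
        by rewrite g6 // ltn_eqF //= a55 e.
      - move=> t'; rewrite ltnS ES leq_eqVlt => /predU1P[->|t't]; first exact: addsmxSr.
        by apply: submx_trans (sub3 _ t't) (addsmxSl _ _).
    exists Q'; split.
    - by case: rQ' => e ?; split=> //; rewrite j3 // j2.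
    - by rewrite j2.
    - move=> x; rewrite m6; have SE : selmx m.+1 W (arr s6 5) *m x = 0 <->
          selmx m W (arr s3 5) *m x = 0 /\ rowarr W (arr s4 2) *m x = 0.
        rewrite vE; split=> [/sub_kermxP|[/sub_kermxP h /sub_kermxP h']].
          by rewrite ES addsmx_sub => /andP[/sub_kermxP ? /sub_kermxP ?].
        by apply/sub_kermxP; rewrite ES addsmx_sub h h'.
      by rewrite SE; split=> [/kQ'[/kQ]//|[/kQ ? ?]]; exact/kQ'.
  case: cases => [[_ Q'E _]|[c [_ _ ec _]]]; last first.
    by move: c5; rewrite ec ltnS leqNgt ltn_ord.
  fin; split=> //; split.
    rewrite /= m5 a55; split=> //; first exact: leqW.
    move=> t'; rewrite ltnS leq_eqVlt => /predU1P[->|/sub3//].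
    apply: sub_by_kernel => x /kQ Qx; rewrite -vE.
    by rewrite -Q'E in Qx; case/kQ': Qx.
  by exists Q'; rewrite /= m5 a55; split=> //; rewrite Q'E.
- by move=> s' _ [oks' [sel' _]]; split=> //; rewrite /= s2p in sel'.
Qed.

End Phases.

(** * Computation of the random blow-ups *)

Definition blowup_entry : cmd :=
  For 10 $5 (Fetch 2 5 (ix $10 (IMul $0 $0) (ix $8 $0 $9)) ;;
             Fetch 3 6 (ix (ix (ix $7 $5 $10) $2 $12) $2 $13) ;;
             SOp OMul 2 2 3 ;; SOp OAdd 1 1 2).
Definition blowup1 : cmd :=
  For 13 $2 (SCst 1 0 0 ;; blowup_entry ;;
             Store 7 (ix (ix $7 eN (ix $8 $2 $12)) eN (ix $9 $2 $13)) 1).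
Definition blowup2 : cmd := For 9 $0 blowup1.
Definition blowup3 : cmd := For 12 $2 blowup2.
Definition blowup4 : cmd := For 8 $0 blowup3.
Definition blowups : cmd := For 7 (IAdd eN (ICst 1)) blowup4.

Section Blowups.
Variables (R : realType) (ok : R[i] -> Prop).
Local Notation F := R[i].
Local Notation st := (state F).
Local Notation allok := (stored_ok ok).
Variables (n d m : nat) (a5 a6 : nat -> F).
Hypotheses (n0 : (0 < n)%N) (d0 : (0 < d)%N).

Definition blowup_val e : F :=
  let q := (e %% (n * d))%N in let r := (e %/ (n * d) %% (n * d))%N in
  let s := (e %/ (n * d) %/ (n * d))%N in
  \sum_(l < m) a5 (l * (n * n) + (r %/ d * n + q %/ d))%N *
               a6 (((s * m + l) * d + r %% d) * d + q %% d)%N.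

Lemma blowup_valE s r q : (r < n * d)%N -> (q < n * d)%N ->
  blowup_val ((s * (n * d) + r) * (n * d) + q)%N =
  \sum_(l < m) a5 (l * (n * n) + (r %/ d * n + q %/ d))%N *
               a6 (((s * m + l) * d + r %% d) * d + q %% d)%N.
Proof.
move=> rN qN; have N0 : (0 < n * d)%N by rewrite muln_gt0 n0.
have h1 : (((s * (n * d) + r) * (n * d) + q) %% (n * d) = q)%N.
  by rewrite modnMDl modn_small.
have h2 : (((s * (n * d) + r) * (n * d) + q) %/ (n * d) = s * (n * d) + r)%N.
  by rewrite divnMDl // divn_small // addn0.
by rewrite /blowup_val h1 h2 modnMDl (modn_small rN) divnMDl // (divn_small rN) addn0.
Qed.

Lemma small_pair i a : (i < n)%N -> (a < d)%N ->
  [/\ (i * d + a < n * d)%N, ((i * d + a) %/ d = i)%N & ((i * d + a) %% d = a)%N].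
Proof.
move=> iN ad; rewrite divnMDl // divn_small // modnMDl modn_small // addn0; split=> //.
have : (i.+1 * d <= n * d)%N by rewrite leq_mul2r iN orbT.
by rewrite mulSn; lia.
Qed.

Hypothesis okv : forall e, (e < (n * d).+1 * (n * d) * (n * d))%N -> ok (blowup_val e).

(** The five nested loops visit the addresses of array 7 in increasing order, so every stage is
    described by one initial segment. *)
Definition filled e (s : st) :=
  [/\ allok s, [/\ ireg s 0 = n, ireg s 2 = d & ireg s 5 = m], arr s 5 = a5 /\ arr s 6 = a6 &
      forall e', (e' < e)%N -> arr s 7 e' = blowup_val e'].

Lemma filledE e (s s' : st) : ireg s' 0 = ireg s 0 -> ireg s' 2 = ireg s 2 ->
  ireg s' 5 = ireg s 5 -> arr s' = arr s -> stored s' = stored s -> filled e s -> filled e s'.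
Proof.
move=> e1 e2 e3 e4 e5 [h1 [h2 h3 h4] [h5 h6] h7].
by split; rewrite ?e1 ?e2 ?e3 ?e4 //; rewrite /stored_ok e5.
Qed.

Lemma blowup_entry_spec (s : st) : sreg s 1 = 0 -> allok s -> ireg s 5 = m ->
  always (exec blowup_entry s) (fun s' => allok s' /\ sreg s' 1 =
    \sum_(l < m) arr s 5 (l * (ireg s 0 * ireg s 0) + (ireg s 8 * ireg s 0 + ireg s 9))%N *
      arr s 6 (((ireg s 7 * m + l) * ireg s 2 + ireg s 12) * ireg s 2 + ireg s 13)%N).
Proof.
move=> s1 oks sm.
apply: (exec_for (I := fun k s' => allok s' /\ sreg s' 1 = \sum_(0 <= l < k)
    arr s 5 (l * (ireg s 0 * ireg s 0) + (ireg s 8 * ireg s 0 + ireg s 9))%N *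
      arr s 6 (((ireg s 7 * m + l) * ireg s 2 + ireg s 12) * ireg s 2 + ireg s 13)%N)).
- by rewrite big_nil.
- move=> k s' _ [f1 f2 f3] [oks' IH]; step; step; step; fin; split=> //.
  by rewrite big_nat_recr //= /upd /= IH !f3 // !f1 // sm.
- by move=> s' _ [oks' ->]; rewrite /= sm big_mkord.
Qed.

Lemma blowup1_spec (s : st) sx i a j (e0 := ((sx * (n * d) + (i * d + a)) * (n * d) + j * d)%N) :
  (sx <= n * d)%N -> (i < n)%N -> (a < d)%N -> (j < n)%N ->
  ireg s 7 = sx -> ireg s 8 = i -> ireg s 12 = a -> ireg s 9 = j -> filled e0 s ->
  always (exec blowup1 s) (filled (e0 + d)).
Proof.
move=> sxN iN ad jN s7 s8 s12 s9 fs.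
have sd : ireg s 2 = d by case: fs => _ [].
apply: (exec_for (I := fun k s' => filled (e0 + k) s')).
- by rewrite addn0; apply: filledE fs.
- move=> k s' kd [f1 f2 f3] fs'; rewrite /= sd in kd; step; apply: exec_seq.
  have [oks' [r0 r2 r5] [b5 b6] fill'] := fs'.
  apply: always_mono (blowup_entry_spec _ _ _) => // s2 [ok2 v2] [g1 g2 g3]; fin.
  have [rN rd rm] := small_pair iN ad; have [qN qd qm] := small_pair jN kd.
  have e7 : ireg s2 7 = sx by rewrite g1 //= /upd /= f1.
  have e8 : ireg s2 8 = i by rewrite g1 //= /upd /= f1.
  have e12 : ireg s2 12 = a by rewrite g1 //= /upd /= f1.
  have e9 : ireg s2 9 = j by rewrite g1 //= /upd /= f1.
  have e13 : ireg s2 13 = k by rewrite g1.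
  have e0' : ireg s2 0 = n by rewrite g1.
  have e2 : ireg s2 2 = d by rewrite g1.
  have val : sreg s2 1 = blowup_val (e0 + k)%N.
    rewrite v2 /e0 -addnA blowup_valE // rd rm qd qm /= /upd /=.
    by apply: eq_bigr => l _; rewrite b5 b6 r0 r2 !f1 // s7 s8 s12 s9.
  have eE : (((sx * (n * d) + (i * d + a)) * (n * d) + (j * d + k)) = e0 + k)%N.
    by rewrite /e0 addnA.
  have okval : ok (blowup_val (e0 + k)%N).
    apply: okv; rewrite -eE; set N := (n * d)%N in rN qN sxN *.
    have : ((sx * N + (i * d + a)).+1 * N <= N.+1 * N * N)%N.
      rewrite leq_mul2r; apply/orP; right.
      apply: (@leq_trans (sx.+1 * N)); last by rewrite leq_mul2r ltnS sxN orbT.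
      by rewrite mulSn addnC ltn_add2r.
    by apply: leq_trans; rewrite mulSn addnC ltn_add2r.
  split.
  + by rewrite /stored_ok /=; apply: stored_ok_cons; [exact: ok2|rewrite val].
  + by rewrite /= e0' e2; split=> //; rewrite g1.
  + by rewrite /= /upd /= !g3.
  + move=> e' le'; rewrite /= /upd /= e7 e8 e9 e12 e13 e0' e2 eE val.
    case: eqP => [->//|ne]; rewrite g3 //; apply: fill'; lia.
- by move=> s' _; rewrite /= sd.
Qed.

Lemma blowup2_spec (s : st) sx i a (e0 := ((sx * (n * d) + (i * d + a)) * (n * d))%N) :
  (sx <= n * d)%N -> (i < n)%N -> (a < d)%N ->
  ireg s 7 = sx -> ireg s 8 = i -> ireg s 12 = a -> filled e0 s ->
  always (exec blowup2 s) (filled (e0 + n * d)).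
Proof.
move=> sxN iN ad s7 s8 s12 fs; have sn : ireg s 0 = n by case: fs => _ [].
apply: (exec_for (I := fun k s' => filled (e0 + k * d) s')).
- by rewrite addn0; apply: filledE fs.
- move=> k s' kn [f1 f2 f3] fs'; rewrite /= sn in kn.
  rewrite mulSn [(d + _)%N]addnC addnA.
  by apply: blowup1_spec; rewrite //= /upd /= ?f1 //; apply: filledE fs'.
- by move=> s' _; rewrite /= sn.
Qed.

Lemma blowup3_spec (s : st) sx i (e0 := ((sx * (n * d) + i * d) * (n * d))%N) :
  (sx <= n * d)%N -> (i < n)%N -> ireg s 7 = sx -> ireg s 8 = i -> filled e0 s ->
  always (exec blowup3 s) (filled (e0 + d * (n * d))).
Proof.
move=> sxN iN s7 s8 fs; have sd : ireg s 2 = d by case: fs => _ [].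
apply: (exec_for (I := fun k s' => filled (e0 + k * (n * d)) s')).
- by rewrite addn0; apply: filledE fs.
- move=> k s' kn [f1 f2 f3] fs'; rewrite /= sd in kn.
  have e : (e0 + k * (n * d) = (sx * (n * d) + (i * d + k)) * (n * d))%N.
    by rewrite /e0 addnA [in RHS]mulnDl.
  rewrite mulSn [(n * d + _)%N]addnC addnA e.
  by apply: blowup2_spec; rewrite //= /upd /= ?f1 // -e; apply: filledE fs'.
- by move=> s' _; rewrite /= sd.
Qed.

Lemma blowup4_spec (s : st) sx (e0 := (sx * (n * d) * (n * d))%N) :
  (sx <= n * d)%N -> ireg s 7 = sx -> filled e0 s ->
  always (exec blowup4 s) (filled (e0 + n * d * (n * d))).
Proof.
move=> sxN s7 fs; have sn : ireg s 0 = n by case: fs => _ [].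
apply: (exec_for (I := fun k s' => filled (e0 + k * (d * (n * d))) s')).
- by rewrite addn0; apply: filledE fs.
- move=> k s' kn [f1 f2 f3] fs'; rewrite /= sn in kn.
  have e : (e0 + k * (d * (n * d)) = (sx * (n * d) + k * d) * (n * d))%N.
    by rewrite /e0 [in RHS]mulnDl -[in RHS](mulnA k).
  rewrite mulSn [(d * _ + _)%N]addnC addnA e.
  by apply: blowup3_spec; rewrite //= /upd /= ?f1 // -e; apply: filledE fs'.
- by move=> s' _; rewrite /= sn mulnA.
Qed.

Lemma blowups_spec (s : st) : filled 0 s ->
  always (exec blowups s) (filled ((n * d).+1 * (n * d) * (n * d))).
Proof.
move=> fs; have [_ [sn sd _] _ _] := fs.
apply: (exec_for (I := fun k s' => filled (k * (n * d) * (n * d)) s')).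
- by apply: filledE fs.
- move=> k s' kN [f1 f2 f3] fs'; rewrite /= sn sd addn1 ltnS in kN.
  rewrite mulSn mulnDl [(n * d * (n * d) + _)%N]addnC.
  by apply: blowup4_spec => //; apply: filledE fs'.
- by move=> s' _; rewrite /= sn sd addn1.
Qed.

End Blowups.

(** * The chain of systems, solved in a sliding window *)

Definition shift_row : cmd :=
  For 9 eN (Fetch 2 4 (ix $8 $14 $9) ;; Store 4 (ix (IAdd eN $8) $14 (IAdd eN $9)) 2 ;;
            Store 4 (ix $8 $14 $9) 6 ;; Store 4 (ix $8 $14 (IAdd eN $9)) 6 ;;
            Store 4 (ix (IAdd eN $8) $14 $9) 6).
(** The projection for the unknowns just treated moves to the lower right block; the fresh unknowns
    start with the identity, which is stored as the common denominator on the diagonal. *)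
Definition shift_window : cmd :=
  SCst 6 0 0 ;; For 8 eN (shift_row ;; Store 4 (ix $8 $14 $8) 0).
Definition chain_row : cmd :=
  For 8 eN (Fetch 2 7 (ix $10 eN $8) ;; Store 2 $8 2 ;;
            Fetch 2 7 (ix (ix $7 eN $10) eN $8) ;; Store 2 (IAdd eN $8) 2).
Definition chain_block : cmd := shift_window ;; For 10 eN (chain_row ;; insert).
(** The cleared window encodes the zero space as predecessor of [F_0]. The first block combines
    [C_0] with itself, and as the previous unknowns are zero it computes [ker C_0]. *)
Definition chains : cmd :=
  ISet 14 (IAdd eN eN) ;; clear_square ;; SCst 0 1 0 ;;
  For 7 (IAdd eN (ICst 1)) chain_block.

Section Chains.
Variables (R : realType) (ok : R[i] -> Prop).
Local Notation F := R[i].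
Local Notation st := (state F).
Local Notation allok := (stored_ok ok).
Hypothesis ok0 : ok 0.
Hypothesis ok1 : ok 1.
Variables (n d : nat).
Local Notation N := (n * d)%N.

Definition regs (s : st) := [/\ ireg s 0 = n, ireg s 2 = d & ireg s 14 = (N + N)%N].

Lemma regsE (s s' : st) : ireg s' 0 = ireg s 0 -> ireg s' 2 = ireg s 2 ->
  ireg s' 14 = ireg s 14 -> regs s -> regs s'.
Proof. by rewrite /regs => -> -> ->. Qed.

Definition shifted (g : nat -> nat -> F) (f : nat -> F) k j :=
  [/\ f (k * (N + N) + (N + j))%N = 0, f ((N + k) * (N + N) + j)%N = 0 &
      f ((N + k) * (N + N) + (N + j))%N = g k j].

Lemma shift_row_spec (s : st) k g : regs s -> allok s -> ireg s 8 = k -> (k < N)%N ->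
  sreg s 6 = 0 -> (forall j, (j < N)%N -> ok (g k j)) ->
  (forall j, (j < N)%N -> arr s 4 (k * (N + N) + j)%N = g k j) ->
  always (exec shift_row s) (fun s' => [/\ allok s',
    forall i j, (j < N + N)%N -> i != k -> i != (N + k)%N ->
       arr s' 4 (i * (N + N) + j)%N = arr s 4 (i * (N + N) + j)%N &
    forall j, (j < N)%N -> shifted g (arr s' 4) k j /\ arr s' 4 (k * (N + N) + j)%N = 0]).
Proof.
move=> [r0 r2 r14] oks s8 kN s6 okg gE.
apply: (exec_for (I := fun l s' => [/\ allok s',
    forall i j, (j < N + N)%N -> i != k -> i != (N + k)%N ->
       arr s' 4 (i * (N + N) + j)%N = arr s 4 (i * (N + N) + j)%N,
    forall j, (l <= j < N)%N -> arr s' 4 (k * (N + N) + j)%N = g k j &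
    forall j, (j < l)%N -> (j < N)%N -> shifted g (arr s' 4) k j /\ arr s' 4 (k * (N + N) + j)%N = 0])).
- by split.
- move=> l s' lN [f1 f2 f3] [oks' h1 h2 h3]; rewrite /= r0 r2 in lN.
  step; step; step; step; fin.
  have e0 : ireg s' 0 = n by rewrite f1.
  have e2 : ireg s' 2 = d by rewrite f1.
  have e14 : ireg s' 14 = (N + N)%N by rewrite f1.
  have e8 : ireg s' 8 = k by rewrite f1.
  have z6 : sreg s' 6 = 0 by rewrite f2.
  have gl : arr s' 4 (k * (N + N) + l)%N = g k l by apply: h2; rewrite leqnn lN.
  set s2 := tick 1 _.
  have aE : forall i j, (j < N + N)%N -> arr s2 4 (i * (N + N) + j)%N =
     if (i == N + k)%N && (j == l) then 0 else
     if (i == k) && (j == N + l)%N then 0 else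
     if (i == k) && (j == l) then 0 else
     if (i == N + k)%N && (j == N + l)%N then g k l else arr s' 4 (i * (N + N) + j)%N.
    move=> i j jW; rewrite /s2 /= /upd /= e0 e2 e14 e8 z6 gl.
    have lW : (l < N + N)%N by lia.
    have NlW : (N + l < N + N)%N by lia.
    by rewrite !flat_eq.
  have kF : (k == N + k)%N = false by lia.
  have NkF : (N + k == k)%N = false by lia.
  have jF j : (j < N)%N -> (j == N + l)%N = false by lia.
  have NjF j : (N + j == l)%N = false by lia.
  have jW j : (j < N)%N -> (j < N + N)%N by lia.
  have NjW j : (j < N)%N -> (N + j < N + N)%N by lia.
  split.
  + rewrite /stored_ok /s2 /= /upd /= e14 e8 z6 gl.
    apply: stored_ok_cons ok0; apply: stored_ok_cons ok0; apply: stored_ok_cons ok0.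
    by apply: stored_ok_cons; [exact: oks'|exact: okg].
  + by move=> i j jWW ik iNk; rewrite aE // (negPf ik) (negPf iNk) h1.
  + move=> j /andP[lj jN]; rewrite (aE _ _ (jW _ jN)) kF (jF _ jN) andbF /=.
    rewrite (_ : (j == l) = false) ?andbF; last by lia.
    by apply: h2; rewrite jN (ltnW lj).
  + move=> j jl jN; have [->|jnl] := eqVneq j l.
      split; last by rewrite (aE _ _ (jW _ lN)) kF /= !eqxx /= if_same.
      split.
      - by rewrite (aE _ _ (NjW _ lN)) kF !eqxx.
      - by rewrite (aE _ _ (jW _ lN)) !eqxx.
      - by rewrite (aE _ _ (NjW _ lN)) NjF NkF andbF /= !eqxx.
    have jl2 : (j < l)%N by lia.
    have jlF : (N + j == N + l)%N = false by lia.
    have [[q1 q2 q3] q4] := h3 j jl2 jN.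
    split; last by rewrite (aE _ _ (jW _ jN)) kF (jF _ jN) (negPf jnl) !andbF.
    split.
    - by rewrite (aE _ _ (NjW _ jN)) kF jlF NjF !andbF.
    - by rewrite (aE _ _ (jW _ jN)) NkF (negPf jnl) (jF _ jN) !andbF.
    - by rewrite (aE _ _ (NjW _ jN)) NkF NjF jlF !andbF.
- move=> s' _ [oks' h1 h2 h3]; split=> // j jN; apply: h3 => //.
  by rewrite /= r0 r2.
Qed.

Lemma shift_window_spec (s : st) g : regs s -> allok s -> ok (sreg s 0) ->
  (forall i j, (i < N)%N -> (j < N)%N -> ok (g i j)) ->
  (forall i j, (i < N)%N -> (j < N)%N -> arr s 4 (i * (N + N) + j)%N = g i j) ->
  always (exec shift_window s) (fun s' => allok s' /\
    forall i j, (i < N)%N -> (j < N)%N -> shifted g (arr s' 4) i j /\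
      arr s' 4 (i * (N + N) + j)%N = sreg s 0 *+ (i == j)).
Proof.
move=> rs oks okd okg gE; step; set s1 := tick _ _; have [r0 r2 r14] := rs.
apply: (exec_for (I := fun k s' => [/\ allok s',
    forall i j, (k <= i < N)%N -> (j < N)%N -> arr s' 4 (i * (N + N) + j)%N = g i j &
    forall i j, (i < k)%N -> (i < N)%N -> (j < N)%N -> shifted g (arr s' 4) i j /\
      arr s' 4 (i * (N + N) + j)%N = sreg s 0 *+ (i == j)])).
- by split=> // i j iN jN; apply: gE.
- move=> k s' kN [f1 f2 f3] [oks' h1 h2]; rewrite /= r0 r2 in kN.
  apply: exec_seq; apply: always_mono (shift_row_spec (k := k) (g := g) _ _ _ _ _ _ _) => //.
  + move=> s2 [oks2 q1 q2] [g1 g2 g3]; fin.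
    have e14 : ireg s2 14 = (N + N)%N by rewrite g1 //= /upd /= f1.
    have e8 : ireg s2 8 = k by rewrite g1.
    have e0 : sreg s2 0 = sreg s 0 by rewrite g2 //= f2.
    set s3 := tick 1 _.
    have aE : forall i j, (j < N + N)%N -> arr s3 4 (i * (N + N) + j)%N =
        if (i == k) && (j == k) then sreg s 0 else arr s2 4 (i * (N + N) + j)%N.
      by move=> i j jW; rewrite /s3 /= /upd /= e14 e8 e0 flat_eq //; lia.
    have jW j : (j < N)%N -> (j < N + N)%N by lia.
    have NjW j : (j < N)%N -> (N + j < N + N)%N by lia.
    split.
    * by rewrite /stored_ok /=; apply: stored_ok_cons; [exact: oks2|rewrite e0].
    * move=> i j /andP[ki iN] jN; rewrite (aE _ _ (jW _ jN)).
      have ik : (i == k) = false by lia.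
      have iNk : i != (N + k)%N by lia.
      rewrite ik /= (q1 _ _ (jW _ jN)) //=; last by rewrite ik.
      by apply: h1 => //; rewrite iN (ltnW ki).
    * have aE' i' j' : (j' < N + N)%N -> (i' != k) || (N <= j')%N ->
          arr s3 4 (i' * (N + N) + j')%N = arr s2 4 (i' * (N + N) + j')%N.
        move=> j'W h; rewrite aE // (_ : _ && _ = false) //; lia.
      move=> i j; rewrite ltnS leq_eqVlt => /predU1P[->|ik] iN jN.
        have [[p1 p2 p3] p4] := q2 j jN; split.
          split; rewrite aE' ?leq_addr ?orbT ?NjW ?jW //; lia.
        by rewrite (aE _ _ (jW _ jN)) eqxx /= eq_sym; case: eqP => // _; rewrite p4.
      have [[p1 p2 p3] p4] := h2 i j ik iN jN.
      have c1 : i != k by lia.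
      have c2 : i != (N + k)%N by lia.
      have c3 : (N + i != k)%N by lia.
      have c4 : (N + i != N + k)%N by lia.
      split; first by split; rewrite aE' ?c1 ?c3 ?q1 ?NjW ?jW //=.
      by rewrite aE' ?c1 ?q1 ?jW //=.
  + by apply: regsE rs; rewrite //= /upd /= f1.
  + by rewrite /= f2.
  + by move=> j jN; apply: okg.
  + by move=> j jN; apply: h1 => //; rewrite leqnn.
- move=> s' _ [oks' h1 h2]; split=> // i j iN jN; apply: h2 => //.
  by rewrite /= r0 r2.
Qed.

Lemma chain_row_spec (s : st) r sx : regs s -> allok s -> ireg s 10 = r -> ireg s 7 = sx ->
  (forall i, (i < N)%N -> ok (arr s 7 (r * N + i)%N)) ->
  (forall i, (i < N)%N -> ok (arr s 7 ((sx * N + r) * N + i)%N)) ->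
  always (exec chain_row s) (fun s' => allok s' /\ forall i, (i < N)%N ->
    arr s' 2 i = arr s 7 (r * N + i)%N /\
    arr s' 2 (N + i)%N = arr s 7 ((sx * N + r) * N + i)%N).
Proof.
move=> [r0 r2 r14] oks s10 s7 okB okC.
apply: (exec_for (I := fun k s' => allok s' /\ forall i, (i < k)%N -> (i < N)%N ->
    arr s' 2 i = arr s 7 (r * N + i)%N /\
    arr s' 2 (N + i)%N = arr s 7 ((sx * N + r) * N + i)%N)).
- by [].
- move=> k s' kN [f1 f2 f3] [oks' IH]; rewrite /= r0 r2 in kN; step; step; step; fin.
  have e0 : ireg s' 0 = n by rewrite f1.
  have e2 : ireg s' 2 = d by rewrite f1.
  have e7 : ireg s' 7 = sx by rewrite f1.
  have e10 : ireg s' 10 = r by rewrite f1.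
  have a7 : arr s' 7 = arr s 7 by rewrite f3.
  split.
    rewrite /stored_ok /= /upd /= e0 e2 e7 e10 a7.
    by apply: stored_ok_cons (okC _ kN); apply: stored_ok_cons (okB _ kN).
  move=> i ik iN; rewrite /= /upd /= e0 e2 e7 e10 a7.
  have c1 : (i == N + k)%N = false by lia.
  have c2 : (N + i == k)%N = false by lia.
  rewrite c1 c2 eqn_add2l; have [->//|ink] := eqVneq i k.
  by apply: IH => //; lia.
- by move=> s' _ [oks' IH]; split=> // i iN; apply: IH; rewrite //= r0 r2.
Qed.

Variables (okE : F -> Prop) (Dmax : nat).
Hypotheses (okE0 : okE 0) (okE1 : okE 1) (okEok : forall z, okE z -> ok z).
Hypothesis hwin : forall D W dl (Q : 'M[F]_W), (D <= Dmax)%N -> (W <= Dmax)%N ->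
  windowed okE D dl Q ->
  [/\ dl != 0, ok dl, forall i j, ok (dl * Q i j) &
      forall v : 'rV[F]_W, (forall i, okE (v 0 i)) -> forall j, ok (dl * (v *m Q) 0 j)].
Variable Cs : nat -> 'M[F]_N.
Hypothesis okC : forall s i j, (s <= N)%N -> okE (Cs s i j).

Definition holds_chain (s : st) := forall sx (r q : 'I_N), (sx <= N)%N ->
  arr s 7 ((sx * N + r) * N + q)%N = Cs sx r q.

Definition corner (s : st) (P : 'M[F]_N) := forall i j : 'I_N,
  arr s 4 (i * (N + N) + j)%N = sreg s 0 * P i j.

Definition shiftmx (P : 'M[F]_N) : 'M[F]_(N + N) :=
  block_mx (1%:M : 'M[F]_N) (0 : 'M[F]_N) (0 : 'M[F]_N) P.

Lemma reflecting_shiftmx P : reflecting P -> reflecting (shiftmx P).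
Proof.
move=> rP c; case: (split_ordP c) => c' ->.
  right; apply/rowP=> j; case: (split_ordP j) => j' ->; rewrite mxE [RHS]mxE.
    by rewrite block_mxEul !mxE (inj_eq (@lshift_inj _ _)).
  by rewrite block_mxEur !mxE eq_lrshift.
case: (rP c') => [/colP h|/rowP h]; [left; apply/colP=> j|right; apply/rowP=> j].
  rewrite mxE [RHS]mxE; case: (split_ordP j) => j' ->; first by rewrite block_mxEur mxE.
  by rewrite block_mxEdr; have := h j'; rewrite !mxE.
rewrite mxE [RHS]mxE; case: (split_ordP j) => j' ->.
  by rewrite block_mxEdl !mxE eq_rlshift.
by rewrite block_mxEdr [RHS]mxE (inj_eq (@rshift_inj _ _)); have := h j'; rewrite !mxE.
Qed.

Lemma reflecting_ulsubmx (Q : 'M[F]_(N + N)) : reflecting Q -> reflecting (ulsubmx Q).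
Proof.
move=> rQ c; case: (rQ (lshift N c)) => [/colP h|/rowP h].
  by left; apply/colP=> i; have := h (lshift N i); rewrite !mxE.
right; apply/rowP=> j; have := h (lshift N j); rewrite !mxE => ->.
by rewrite (inj_eq (@lshift_inj _ _)).
Qed.

(** The upper right block of the projection stays zero during the [N] insertions. Hence the upper
    left block is itself the projection onto those [x] that extend to a solution, and it is all that
    [windowed_shift] has to carry on. *)
Lemma chain_block_spec (s : st) sx D (P : 'M[F]_N) :
  regs s -> ireg s 7 = sx -> (sx <= N)%N -> (D + N <= Dmax)%N -> (N + N <= D)%N ->
  allok s -> holds_chain s -> corner s P -> reflecting P ->
  windowed okE D (sreg s 0) (shiftmx P) ->
  always (exec chain_block s) (fun s' => allok s' /\ exists P' : 'M[F]_N,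
    [/\ corner s' P', reflecting P', windowed okE (D + N) (sreg s' 0) (shiftmx P') &
        forall x : 'cV[F]_N, P' *m x = x <->
          exists x0 : 'cV[F]_N, P *m x0 = x0 /\ Cs 0 *m x + Cs sx *m x0 = 0]).
Proof.
move=> rs s7 sxN DD ND oks hC cP rP wP.
have DD' : (D <= Dmax)%N by apply: leq_trans DD; exact: leq_addr.
have WD : (N + N <= Dmax)%N by apply: leq_trans ND DD'.
have [dl0 okdl okP _] := hwin DD' WD wP.
have okg (i j : 'I_N) : ok (sreg s 0 * P i j).
  by have := okP (rshift N i) (rshift N j); rewrite block_mxEdr.
pose g i j := arr s 4 (i * (N + N) + j)%N.
apply: exec_seq.
apply: always_mono (shift_window_spec (g := g) rs oks okdl _ _) => //; last first.
  by move=> i j iN jN; rewrite /g (cP (Ordinal iN) (Ordinal jN)).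
move=> s1 [oks1 sh] [f1 f2 f3].
have rs1 : regs s1 by apply: regsE rs; rewrite f1.
have s17 : ireg s1 7 = sx by rewrite f1.
have s10 : sreg s1 0 = sreg s 0 by rewrite f2.
have hC1 : holds_chain s1 by move=> u r q; rewrite f3 //; exact: hC.
have rep1 : represents s1 (shiftmx P).
  split; last exact: reflecting_shiftmx.
  apply: mxarrP => i j; rewrite s10 mxE.
  case: (split_ordP i) => i' ->; case: (split_ordP j) => j' -> /=;
    have [[h1 h2 h3] h4] := sh i' j' (ltn_ord _) (ltn_ord _).
  - by rewrite block_mxEul h4 mxE mulr_natr -val_eqE.
  - by rewrite block_mxEur h1 mxE mulr0.
  - by rewrite block_mxEdl h2 mxE mulr0.
  - by rewrite block_mxEdr h3 /g cP.
pose sys r (x : 'cV[F]_(N + N)) := P *m dsubmx x = dsubmx x /\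
  forall r' : 'I_N, (r' < r)%N -> (Cs 0 *m usubmx x + Cs sx *m dsubmx x) r' 0 = 0.
have [r0 r2 r14] := rs1.
apply: (exec_for (I := fun r s' => allok s' /\ exists Q : 'M[F]_(N + N),
  [/\ represents s' Q, windowed okE D (sreg s' 0) Q, ursubmx Q = 0 &
      forall x, Q *m x = x <-> sys r x])).
- split=> //; exists (shiftmx P); split=> //; first by rewrite /= s10.
    by rewrite block_mxKur.
  move=> x; rewrite -{1 2}[x]vsubmxK mul_block_col !mul0mx mul1mx add0r addr0.
  by split=> [/eq_col_mx[_ e]|[-> _]] //; split.
- move=> r s2 rN [g1 g2 g3] [oks2 [Q [rQ wQ uQ kQ]]]; rewrite /= r0 r2 in rN.
  set ro := Ordinal rN.
  have a27 : arr s2 7 = arr s1 7 by rewrite g3.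
  have hC2 : holds_chain s2 by move=> u a b; rewrite a27; exact: hC1.
  have rs2 : regs s2 by apply: regsE rs1; rewrite g1.
  have s27 : ireg s2 7 = sx by rewrite g1.
  have rowB i : (i < N)%N -> arr s2 7 (r * N + i)%N = Cs 0 ro (insubd ro i).
    move=> iN; have := hC2 0%N ro (Ordinal iN) (leq0n _); rewrite mul0n add0n /= => ->.
    by congr (Cs 0 _ _); apply/val_inj; rewrite val_insubd iN.
  have rowC i : (i < N)%N -> arr s2 7 ((sx * N + r) * N + i)%N = Cs sx ro (insubd ro i).
    move=> iN; have := hC2 sx ro (Ordinal iN) sxN => /= ->.
    by congr (Cs sx _ _); apply/val_inj; rewrite val_insubd iN.
  apply: exec_seq.
  apply: always_mono (chain_row_spec (r := r) (sx := sx) _ _ _ _ _ _) => //.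
  + move=> s3 [oks3 v3] [h1 h2 h3].
    have vE : rowarr (N + N) (arr s3 2) = row_mx (row ro (Cs 0)) (row ro (Cs sx)).
      apply/rowP=> j; case: (split_ordP j) => j' ->; rewrite mxE.
        have [-> _] := v3 j' (ltn_ord _); rewrite /= rowB // row_mxEl mxE.
        by congr (Cs 0 _ _); apply/val_inj; rewrite val_insubd ltn_ord.
      have [_ ->] := v3 j' (ltn_ord _); rewrite /= rowC // row_mxEr mxE.
      by congr (Cs sx _ _); apply/val_inj; rewrite val_insubd ltn_ord.
    have s3W : ireg s3 14 = (N + N)%N by rewrite h1 //= /upd /= g1.
    have rQ3 : represents s3 Q by case: rQ => ? ?; split=> //; rewrite h3 // h2.
    have wQ3 : windowed okE D (sreg s3 0) Q by rewrite h2.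
    have okv i : okE (rowarr (N + N) (arr s3 2) 0 i).
      rewrite vE; case: (split_ordP i) => i' ->; rewrite ?row_mxEl ?row_mxEr mxE.
        exact: okC.
      exact: okC.
    have := insert_win okE0 hwin DD' WD s3W oks3 rQ3 wQ3 okv; rewrite vE.
    apply: always_mono => s4 [oks4 [Q' [rQ' wQ' kQ' cases]]].
    split=> //; exists Q'; split=> //.
      (* The correction is a multiple of a column entry times an entry of [v *m Q]. For a pivot in
         the left half the latter is zero, since the pivot is the last nonzero entry; for a pivot in
         the right half the former is zero by the invariant. *)
      case: cases => [[_ -> _]//|[c [yc -> _ ymax]]].
      apply/matrixP=> i j; rewrite [LHS]mxE [in LHS]mxE deflateE [RHS]mxE.
      have uQ0 a b : Q (lshift N a) (rshift N b) = 0.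
        by have /matrixP/(_ a b) := uQ; rewrite !mxE.
      rewrite uQ0 sub0r; apply/eqP; rewrite oppr_eq0 mulf_eq0; apply/orP; right.
      move: yc ymax; case: (split_ordP c) => c' -> yc ymax.
        rewrite ymax ?mulr0 //=; apply: (leq_trans (ltn_ord c')); exact: leq_addr.
      by rewrite uQ0 mul0r.
    move=> x; rewrite kQ' kQ /sys.
    have -> : row_mx (row ro (Cs 0)) (row ro (Cs sx)) *m x = 0 <->
        (Cs 0 *m usubmx x + Cs sx *m dsubmx x) ro 0 = 0.
      rewrite -{1}[x]vsubmxK mul_row_col -!row_mul -[_ + _](linearD (row ro)).
      split=> [/matrixP/(_ 0 0)|e]; first by rewrite mxE => ->; rewrite mxE.
      by apply/matrixP=> a b; rewrite !ord1 mxE e mxE.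
    split=> [[[Px h] e]|[Px h]].
      split=> // r'; rewrite ltnS leq_eqVlt => /predU1P[rE|/h//].
      by rewrite (_ : r' = ro) //; apply/val_inj.
    by split; [split=> // r' r'r; apply: h; exact: ltnW|exact: h].
  + by move=> i iN; rewrite /= rowB //; apply/okEok/okC.
  + by move=> i iN; rewrite /= rowC //; apply/okEok/okC.
- move=> s2 [g1 g2 g3] [oks2 [Q [[Qarr rQ] wQ uQ kQ]]]; rewrite /= r0 r2 in kQ.
  split=> //; exists (ulsubmx Q).
  have QB : Q = block_mx (ulsubmx Q) 0 (dlsubmx Q) (drsubmx Q).
    by rewrite -uQ submxK.
  split.
  + move=> i j; have /matrixP/(_ (lshift N i) (lshift N j)) := Qarr.
    by rewrite !mxE.
  + exact: reflecting_ulsubmx.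
  + by apply: (windowed_shift okE0 (Q21 := dlsubmx Q) (Q22 := drsubmx Q)); rewrite -QB.
  + have fixE (x : 'cV[F]_(N + N)) : sys N x <-> P *m dsubmx x = dsubmx x /\
        Cs 0 *m usubmx x + Cs sx *m dsubmx x = 0.
      split=> [[Px h]|[Px h]]; split=> //.
        by apply/matrixP=> a b; rewrite !ord1 h ?mxE.
      by move=> r' _; rewrite h mxE.
    move=> x; split=> [Px|[x0 [Px0 e]]].
      (* The previous unknowns that go with [x] are supplied by the lower left block. *)
      have Qx : Q *m col_mx x 0 = col_mx x (dlsubmx Q *m x).
        by rewrite {1}QB mul_block_col !mulmx0 !addr0 Px.
      have := (kQ (col_mx x (dlsubmx Q *m x))).1.
      rewrite -{1 2}Qx mulmxA (reflecting_idem rQ) => /(_ erefl)/fixE.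
      by rewrite col_mxKu col_mxKd => h; exists (dlsubmx Q *m x).
    have /kQ : sys N (col_mx x x0) by apply/fixE; rewrite col_mxKu col_mxKd.
    by rewrite {1}QB mul_block_col !mul0mx addr0 => /eq_col_mx[].
Qed.

(** The virtual system begins with [2 N] unknowns and each of the [N + 1] blocks appends [N], which
    gives the order [N (N + 3)]. *)
Lemma chains_spec (s : st) : ireg s 0 = n -> ireg s 2 = d -> (N * (N + 3) <= Dmax)%N ->
  allok s -> holds_chain s ->
  always (exec chains s) (fun s' => allok s' /\ exists P : 'M[F]_N,
    [/\ corner s' P, reflecting P, sreg s' 0 != 0 &
        forall x, P *m x = x <-> in_chain Cs N x]).
Proof.
move=> r0 r2 DD oks hC; step; set s1 := tick _ _.
have s1W : ireg s1 14 = (N + N)%N by rewrite /s1 /= /upd /= r0 r2.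
apply: exec_seq; apply: always_mono (clear_square_spec ok0 s1W _) => //.
move=> s2 [oks2 z2] [f1 f2 f3]; step; set s3 := tick _ _.
have rs3 : regs s3 by split; rewrite /= f1.
have hC3 : holds_chain s3 by move=> u a b; rewrite /= f3 //; exact: hC.
have eE : ieval (ireg s3) (IAdd eN (ICst 1)) = N.+1.
  by case: rs3 => /= -> -> _; rewrite addn1.
apply: (exec_for (I := fun k s' => allok s' /\ exists P : 'M[F]_N,
  [/\ corner s' P, reflecting P, windowed okE (k * N + (N + N)) (sreg s' 0) (shiftmx P) &
      forall x, P *m x = x <-> if k is k'.+1 then in_chain Cs k' x else x = 0])).
- split=> //; exists 0; split.
  + by move=> i j; rewrite mxE mulr0; apply: z2; apply: leq_trans (ltn_ord _) (leq_addr _ _).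
  + by move=> c; left; apply/colP=> i; rewrite !mxE.
  + exact: windowed_start.
  + by move=> x; rewrite mul0mx; split=> [<-|->].
- move=> k s4 kN [g1 g2 g3] [oks4 [P [cP rP wP kP]]]; rewrite eE ltnS in kN.
  have rs4 : regs (tick 1 (set_ireg s4 7 k)) by apply: regsE rs3; rewrite /= /upd /= g1.
  have hC4 : holds_chain (tick 1 (set_ireg s4 7 k)).
    by move=> u a b; rewrite /= g3 //; exact: hC3.
  have DD4 : (k * N + (N + N) + N <= Dmax)%N.
    apply: leq_trans DD; rewrite mulnDr.
    have : (k * N <= N * N)%N by rewrite leq_mul2r kN orbT.
    by lia.
  apply: always_mono (chain_block_spec (sx := k) rs4 _ _ DD4 _ _ hC4 cP rP wP) => //; last first.
    exact: leq_addl.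
  move=> s5 [oks5 [P' [cP' rP' wP' kP']]]; split=> //; exists P'; split=> //.
    by rewrite mulSn [(N + k * N)%N]addnC -addnA [(N + (N + N))%N]addnC addnA.
  move=> x; rewrite kP'; case: k {kN g1 rs4 hC4 DD4 wP kP' wP'} kP => [|k] kP.
    split=> [[x0 [/kP-> ]]|e]; first by rewrite mulmx0 addr0.
    by exists 0; split; rewrite mulmx0 // addr0.
  by split=> -[x0 [/kP h e]]; exists x0.
- move=> s4 _ [oks4 [P [cP rP wP kP]]]; split=> //; exists P.
  rewrite eE in kP wP; split=> //.
  have WD : (N + N <= Dmax)%N by apply: leq_trans DD; rewrite mulnDr; lia.
  have D5 : (N.+1 * N + (N + N) <= Dmax)%N.
    by apply: leq_trans DD; rewrite mulnDr mulSn; lia.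
  by have [] := hwin D5 WD wP.
Qed.

End Chains.

(** * Output and random draws *)

Definition emit_vector : cmd :=
  For 8 $0 (Fetch 2 4 (ix (IMul $8 $2) $14 (IMul $9 $2)) ;; Store 1 (ix $4 $0 $8) 2).
(** Only rows and columns with second tensor index 0 are read, hence the stride [$2]. A zero on the
    diagonal marks a pivot, whose column vanishes. *)
Definition emit : cmd :=
  For 9 $0 (Fetch 2 4 (ix (IMul $9 $2) $14 (IMul $9 $2)) ;;
            IfZero 2 Skip (emit_vector ;; ISet 4 (IAdd $4 (ICst 1)))).

Definition ndraws : iexp := IMul (IMul (IMul (IAdd eN (ICst 1)) $5) $2) $2.
Definition draw_range : iexp := IMul (ICst 4) (IMul (IMul (IMul (IMul eN eN) eN) eN) eN).
(* The range [4 N^5] makes [b T / range <= 1 / 2] for [T <= 2 N^3] draws with [b = N^2] bad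
   values each. *)
Definition draw_one : cmd := Rand 2 draw_range ;; Store 6 $6 2.
Definition draws : cmd := For 6 ndraws draw_one.

Lemma prob_mono S (t : rtree S) (E E' : S -> Prop) :
  (forall s, E s -> E' s) -> prob t E <= prob t E'.
Proof.
move=> EE'; elim: t => [s|m f IH] /=.
  by rewrite ler_nat; case: asboolP => // /EE' h; rewrite asboolT.
by rewrite ler_pM2r ?invr_gt0 ?ltr0n //; apply: ler_sum.
Qed.

Lemma prob_and_always S (t : rtree S) (E E' : S -> Prop) :
  always t E' -> prob t E <= prob t (fun s => E s /\ E' s).
Proof.
elim: t => [s Es|m f IH hf] /=.
  by rewrite ler_nat; case: asboolP => // h; rewrite asboolT.
by rewrite ler_pM2r ?invr_gt0 ?ltr0n //; apply: ler_sum => j _; apply: IH.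
Qed.

Lemma prob_draw S m (f : 'I_m.+1 -> S) (E : S -> Prop) b :
  (#|[pred j : 'I_m.+1 | ~~ `[< E (f j) >]]| <= b)%N ->
  1 - b%:R / m.+1%:R <= prob (Draw (fun j => Done (f j))) E.
Proof.
move=> hb /=; rewrite -natr_sum.
have -> : (\sum_(j < m.+1) `[< E (f j) >])%N = #|[pred j : 'I_m.+1 | `[< E (f j) >]]|.
  by rewrite -sum1_card [RHS]big_mkcond; apply: eq_bigr => j _; rewrite inE; case: ifP.
have := cardC [pred j : 'I_m.+1 | `[< E (f j) >]]; rewrite card_ord => cE.
rewrite ler_pdivlMr ?ltr0n // mulrBl mul1r divfK ?pnatr_eq0 // lerBlDr -natrD ler_nat.
apply: leq_trans (eq_leq (esym cE)) _; rewrite leq_add2l; apply: leq_trans hb.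
by rewrite subset_leq_card //; apply/fintype.subsetP=> j; rewrite !inE.
Qed.

Section Emit.
Variables (R : realType) (ok : R[i] -> Prop).
Local Notation F := R[i].
Local Notation st := (state F).
Local Notation allok := (stored_ok ok).

Lemma emit_vector_spec (s : st) n d W j c : ireg s 0 = n -> ireg s 2 = d -> ireg s 14 = W ->
  ireg s 9 = j -> ireg s 4 = c -> allok s ->
  (forall i, (i < n)%N -> ok (arr s 4 (i * d * W + j * d)%N)) ->
  always (exec emit_vector s) (fun s' => allok s' /\ forall l i, (i < n)%N ->
    arr s' 1 (l * n + i)%N = if l == c then arr s 4 (i * d * W + j * d)%N
                             else arr s 1 (l * n + i)%N).
Proof.
move=> s0 s2 s14 s9 s4 oks okv.
apply: (exec_for (I := fun k s' => allok s' /\ forall l i, (i < n)%N ->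
    arr s' 1 (l * n + i)%N = if (l == c) && (i < k)%N then arr s 4 (i * d * W + j * d)%N
                             else arr s 1 (l * n + i)%N)).
- by split=> // l i iN; rewrite ltn0 andbF.
- move=> k s' kn [f1 f2 f3] [oks' IH]; rewrite /= s0 in kn; step; fin.
  have a4 : arr s' 4 = arr s 4 by rewrite f3.
  split.
    rewrite /stored_ok /=; apply: stored_ok_cons; first exact: oks'.
    by rewrite /= /upd /= !f1 // a4 s2 s14 s9; apply: okv.
  move=> l i iN; rewrite /= /upd /= !f1 // a4 s0 s2 s14 s9 s4 flat_eq // IH // ltnS.
  have [->|lc] := eqVneq l c => //=.
  by rewrite [(i <= k)%N]leq_eqVlt; case: eqP => [->|].
- by move=> s' _ [oks' IH]; split=> // l i iN; rewrite IH //= s0 iN andbT.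
Qed.

Lemma emit_spec (s : st) n d W : ireg s 0 = n -> ireg s 2 = d -> ireg s 14 = W ->
  ireg s 4 = 0%N -> allok s ->
  (forall i j, (i < n)%N -> (j < n)%N -> ok (arr s 4 (i * d * W + j * d)%N)) ->
  always (exec emit s) (fun s' => allok s' /\
    output n s' = [seq \col_(i < n) arr s 4 (i * d * W + j * d)%N |
                     j <- iota 0 n & arr s 4 (j * d * W + j * d)%N != 0]).
Proof.
move=> s0 s2 s14 s4 oks okv.
apply: (exec_for (I := fun k s' => allok s' /\
    output n s' = [seq \col_(i < n) arr s 4 (i * d * W + j * d)%N |
                     j <- iota 0 k & arr s 4 (j * d * W + j * d)%N != 0])).
- by split=> //; rewrite /output /= s4.
- move=> k s' kn [f1 f2 f3] [oks' IH]; rewrite /= s0 in kn; step.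
  have a4 : arr s' 4 = arr s 4 by rewrite f3.
  have iS : iota 0 k.+1 = rcons (iota 0 k) k by rewrite -cats1 -addn1 iotaD.
  apply: exec_ifz => h; rewrite /= /upd /= !f1 // a4 s2 s14 in h.
    by fin; split=> //; rewrite iS filter_rcons h eqxx /=; exact: IH.
  apply: exec_seq; set t1 := tick 2 _.
  have e0 : ireg t1 0 = n by rewrite /t1 /= /upd /= f1.
  have e2 : ireg t1 2 = d by rewrite /t1 /= /upd /= f1.
  have e14 : ireg t1 14 = W by rewrite /t1 /= /upd /= f1.
  have e9 : ireg t1 9 = k by [].
  have oke i : (i < n)%N -> ok (arr t1 4 (i * d * W + k * d)%N).
    by move=> iN; rewrite /t1 /= a4; apply: okv.
  have := emit_vector_spec e0 e2 e14 e9 (erefl _) oks' oke; apply: always_mono.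
  move=> s3 [oks3 h3] [g1 g2 g3]; fin; split=> //.
  rewrite iS filter_rcons h map_rcons -IH /output /= /upd /= g1 //= addn1.
  have iS' m : iota 0 m.+1 = rcons (iota 0 m) m by rewrite -cats1 -addn1 iotaD.
  rewrite iS' map_rcons; congr rcons.
    apply/eq_in_map => l; rewrite mem_iota add0n /= => lc.
    by apply/colP=> i; rewrite !mxE h3 // ltn_eqF.
  by apply/colP=> i; rewrite !mxE h3 // eqxx /= a4.
- by move=> s' _ [oks' IH]; rewrite /= s0 in IH.
Qed.

Definition drawn (E : nat) (z : F) := exists2 j : nat, (j <= E)%N & z = j%:R.

Lemma exec_rand x e c (s : st) Q :
  (forall j : nat, (j <= ieval (ireg s) e)%N ->
     always (exec c (tick 1 (set_sreg s x j%:R))) Q) ->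
  always (exec (Rand x e ;; c) s) Q.
Proof. by move=> h j; apply: h; rewrite -ltnS; exact: ltn_ord. Qed.

Lemma draws_spec (s : st) T E : ieval (ireg s) ndraws = T -> ieval (ireg s) draw_range = E ->
  allok s -> (forall z, drawn E z -> ok z) ->
  always (exec draws s) (fun s' => allok s' /\ forall e, (e < T)%N -> drawn E (arr s' 6 e)).
Proof.
move=> sT sE oks okd.
apply: (exec_for (I := fun k s' => allok s' /\ forall e, (e < k)%N -> drawn E (arr s' 6 e))).
- by [].
- move=> k s' kT [f1 f2 f3] [oks' IH]; apply: exec_rand => j.
  have sE' : ieval (ireg (tick 1 (set_ireg s' 6 k))) draw_range = E.
    by rewrite -sE; apply: ieval_eq => x /=; rewrite !inE /upd => xr; rewrite ifN ?f1 //=;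
       [rewrite inE|]; apply: contraTneq xr => ->.
  rewrite sE' => jE; have dj : drawn E (j%:R : F) by exists j.
  fin; split.
    by rewrite /stored_ok /=; apply: stored_ok_cons; [exact: oks'|rewrite /upd /=; exact: okd].
  move=> e; rewrite ltnS leq_eqVlt /= /upd /=.
  by case: eqP => [_ _|_] //=; exact: IH.
- by move=> s' _; rewrite sT.
Qed.

(** [Pre k x] stands for the first [k] numbers still admitting a success; each draw spoils it with
    probability at most [b / (E + 1)]. *)
Lemma draws_prob (s : st) T E (b : nat) (Pre : nat -> (nat -> F) -> Prop) :
  ieval (ireg s) ndraws = T -> ieval (ireg s) draw_range = E ->
  Pre 0%N (arr s 6) ->
  (forall k x, (k < T)%N -> Pre k x ->
     (#|[pred j : 'I_E.+1 | ~~ `[< Pre k.+1 (upd x k (nat_of_ord j)%:R) >]]| <= b)%N) ->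
  1 - (T * b)%:R / E.+1%:R <= prob (exec draws s) (fun s' => Pre T (arr s' 6)).
Proof.
move=> sT sE P0 PS.
suff main k : (k <= T)%N ->
    1 - (k * b)%:R / E.+1%:R <= prob (iteri k (fun j t => rbind t (fun s' =>
      exec draw_one (tick 1 (set_ireg s' 6 j)))) (Done (tick 1 s)))
      (fun s' => Pre k (arr s' 6) /\ frame draws s s').
  have -> : exec draws s = iteri T (fun j t => rbind t (fun s' =>
      exec draw_one (tick 1 (set_ireg s' 6 j)))) (Done (tick 1 s)) by rewrite -sT.
  apply: le_trans (main T (leqnn T)) _.
  by apply: prob_mono => s' [].
elim: k => [_|k IHk kT] /=; first by rewrite mul0r subr0 asboolT.
have := IHk (ltnW kT) => {}IHk.
set t := iteri k _ _ in IHk *; set P1 := (fun s' => Pre k _ /\ _) in IHk.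
suff step : prob t P1 - b%:R / E.+1%:R <=
    prob (rbind t (fun s' => exec draw_one (tick 1 (set_ireg s' 6 k))))
         (fun s' => Pre k.+1 (arr s' 6) /\ frame draws s s').
  apply: le_trans step; rewrite mulSn natrD mulrDl opprD addrA.
  by rewrite [1 - _ - _]addrAC lerD2r.
apply: prob_rbind_ge.
  by rewrite divr_ge0 ?ler0n.
move=> s' [Pk fr]; have [f1 _ _] := fr.
  have fr' : always (exec draw_one (tick 1 (set_ireg s' 6 k))) (frame draws s).
    apply: always_mono (exec_frame _ _) => s2 [h1 h2 h3]; apply: frame_trans fr _.
    split=> [x|x|x] xc; [|exact: h2|exact: h3].
    by rewrite h1 //= /upd; move: xc; rewrite inE => /negPf->.
  apply: le_trans (prob_and_always _ fr').
  have sE' : ieval (ireg (tick 1 (set_ireg s' 6 k))) draw_range = E.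
    by rewrite -sE; apply: ieval_eq => x /=; rewrite !inE /upd => xr; rewrite ifN ?f1 //=;
       [rewrite inE|]; apply: contraTneq xr => ->.
  pose g (j : nat) := tick 1 (store (tick 1 (set_sreg (tick 1 (set_ireg s' 6 k)) 2 j%:R)) 6 k j%:R).
  have -> : exec draw_one (tick 1 (set_ireg s' 6 k)) =
      @Draw _ (ieval (ireg (tick 1 (set_ireg s' 6 k))) draw_range) (fun j => Done (g (nat_of_ord j))).
    by [].
  have gen m : m = E -> 1 - b%:R / E.+1%:R <=
      prob (@Draw _ m (fun j => Done (g (nat_of_ord j)))) (fun s2 => Pre k.+1 (arr s2 6)).
    move=> ->; apply: prob_draw; exact: PS.
  exact: gen sE'.
Qed.

End Emit.

(** * Subspaces of column vectors *)

Section RowSpaceVspace.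
Variables (F : fieldType) (n : nat).

Definition rowvs q (M : 'M[F]_(q, n)) : {vspace 'cV[F]_n} :=
  limg (linfun (trmx \o mulmxr M : 'rV[F]_q -> 'cV[F]_n)).

Lemma mem_rowvs q (M : 'M[F]_(q, n)) v : (v \in rowvs M) = (v^T <= M)%MS.
Proof.
apply/memv_imgP/submxP => [[x _ ->]|[x xE]].
  by exists x; rewrite lfunE /= trmxK.
by exists x; rewrite ?memvf // lfunE /= -xE trmxK.
Qed.

Lemma rowvs_sub q q' (M : 'M[F]_(q, n)) (M' : 'M[F]_(q', n)) :
  (rowvs M <= rowvs M')%VS = (M <= M')%MS.
Proof.
apply/subvP/idP => [h|h v]; last by rewrite !mem_rowvs => /submx_trans; apply.
by apply/row_subP => i; rewrite -[row i M]trmxK -mem_rowvs h // mem_rowvs trmxK row_sub.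
Qed.

Lemma dim_rowvs q (M : 'M[F]_(q, n)) : \dim (rowvs M) = \rank M.
Proof.
have -> : rowvs M = rowvs (row_base M).
  by apply/vspaceP=> v; rewrite !mem_rowvs eq_row_base.
rewrite limg_dim_eq ?dimvf /dim /= ?mul1n //.
apply/eqP; rewrite -subv0; apply/subvP=> x; rewrite memv_cap memvf memv_ker lfunE /=.
move=> /eqP/(congr1 trmx); rewrite trmxK trmx0 memv0 => e.
by apply/eqP/(row_free_inj (row_base_free M)); rewrite e mul0mx.
Qed.

Lemma rowvs_surj (V : {vspace 'cV[F]_n}) : exists M : 'M[F]_n, V = rowvs M.
Proof.
pose M := \matrix_(i < \dim V) ((vbasis V)`_i)^T.
exists (genmx M); apply/vspaceP=> v; rewrite mem_rowvs genmxE; apply/idP/idP.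
  move=> /coord_vbasis ->; rewrite linear_sum summx_sub // => i _.
  by rewrite linearZ scalemx_sub // (submx_trans _ (row_sub i M)) // rowK.
case/submxP=> x /(congr1 trmx); rewrite trmxK => ->.
rewrite mulmx_sum_row linear_sum; apply: rpred_sum => i _.
by rewrite linearZ rowK /= trmxK rpredZ // vbasis_mem // mem_nth // size_tuple.
Qed.

Section Span.
Variables (p : nat) (A : 'I_p -> 'M[F]_n).
Let a t := (A t)^T.

Lemma mem_mxspan t : A t \in mxspan A.
Proof. by apply: memv_span; apply: map_f; rewrite mem_enum. Qed.

Lemma mxact_rowvs (U : 'M[F]_n) : mxact (mxspan A) (rowvs U) = rowvs (act a U).
Proof.
apply/eqP; rewrite eqEsubv; apply/andP; split; last first.
  apply/subvP => v; rewrite mem_rowvs => /sub_sumsmxP[u vE].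
  rewrite -[v]trmxK vE linear_sum; apply: rpred_sum => t _ /=.
  rewrite mulmxA trmx_mul trmxK.
  apply: (mxact_sub _ _ _).1 (subvv _) _ _ (mem_mxspan t) _.
  by rewrite mem_rowvs trmxK submxMl.
apply/mxact_sub => B u BA; rewrite !mem_rowvs => uU; rewrite trmx_mul.
have /allP/= hs : all (fun B : 'M[F]_n => (U *m B^T <= act a U)%MS) [seq A t | t <- enum 'I_p].
  by apply/allP => _ /mapP[t _ ->]; exact: (act_subP _ _ _ (submx_refl _)).
apply: submx_trans (submxMr _ uU) _.
rewrite (coord_span BA) linear_sum mulmx_sumr summx_sub // => i _.
by rewrite linearZ /= -scalemxAr scalemx_sub // hs // mem_nth // size_tuple.
Qed.

Lemma ncrankP : is_ncrank a (ncrank (mxspan A)).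
Proof.
rewrite /ncrank; case: ex_minnP => r /asboolP[V rE] rmin; split.
  by have [M VE] := rowvs_surj V; exists M; rewrite rE VE mxact_rowvs !dim_rowvs.
move=> U; apply: rmin; apply/asboolP; exists (rowvs U).
by rewrite mxact_rowvs !dim_rowvs.
Qed.

Lemma min_shrunkP c U : is_min_shrunk a c U -> min_shrunk (mxspan A) c (rowvs U).
Proof.
case=> sU mU; split; first by rewrite /shrunk mxact_rowvs !dim_rowvs.
move=> V; have [M ->] := rowvs_surj V; rewrite /shrunk mxact_rowvs !dim_rowvs.
by rewrite rowvs_sub => /mU.
Qed.

Lemma blowupT d (X : 'I_p -> 'M[F]_d) : (blowup A X)^T = blowup a (fun t => (X t)^T).
Proof. by rewrite linear_sum; apply: eq_bigr => t _; exact: trmx_tens. Qed.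

End Span.

Lemma bl_span p m d (a : 'I_p -> 'M[F]_n) (a' : 'I_m -> 'M[F]_n) c (X : 'I_p -> 'M[F]_d) :
  (forall t, a t = \sum_l c t l *: a' l) -> blowup a X = blowup a' (fun l => \sum_t c t l *: X t).
Proof.
move=> aE; apply/matrixP=> i j.
case: (mxtens_indexP i) => i1 i2; case: (mxtens_indexP j) => j1 j2; rewrite !summxE.
under eq_bigr => t _ do rewrite tensmxE aE summxE mulr_suml.
rewrite exchange_big; apply: eq_bigr => l _; rewrite tensmxE summxE mulr_sumr.
by apply: eq_bigr => t _; rewrite !mxE [RHS]mulrCA mulrA.
Qed.

End RowSpaceVspace.

Lemma attains_attaining (R : realType) n p d (A : 'I_p -> 'M[R[i]]_n) :
  (0 < d)%N -> blowup_attains A d -> exists X : 'I_p -> 'M[R[i]]_d,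
    attaining (fun t => (A t)^T) X.
Proof.
move=> d0 [X XE]; exists (fun t => (X t)^T) => d' Y.
have [e|d'0] := posnP d'.
  have := rank_leq_col (blowup (fun t => (A t)^T) Y); move: (\rank (blowup _ Y)) => x.
  by rewrite e !muln0 leqn0 => /eqP->; rewrite mul0n.
rewrite -blowupT mxrank_tr.
have -> : blowup (fun t => (A t)^T) Y = (blowup A (fun t => (Y t)^T))^T.
  by rewrite blowupT; apply: eq_bigr => t _; rewrite trmxK.
rewrite mxrank_tr; set Z := fun t => (Y t)^T.
have sE : has_sup (blowup_ratios A).
  split; first by exists ((\rank (blowup A X))%:R / d%:R), d, X.
  exists n%:R => _ [e [W [e0 ->]]].
  by rewrite ler_pdivrMr ?ltr0n // -natrM ler_nat rank_leq_col.
have : (\rank (blowup A Z))%:R / d'%:R <= sup (blowup_ratios A).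
  by apply: sup_upper_bound => //; exists d', Z.
by rewrite -XE ler_pdivrMr ?ltr0n // mulrAC ler_pdivlMr ?ltr0n // -!natrM ler_nat.
Qed.

Section Span2.
Variables (F : fieldType) (n p m : nat) (A : 'I_p -> 'M[F]_n) (A' : 'I_m -> 'M[F]_n).
Hypothesis AA' : forall t, exists c : 'I_m -> F, A t = \sum_l c l *: A' l.
Hypothesis A'A : forall l, exists t, A' l = A t.

Lemma mxspan_eq : mxspan A = mxspan A'.
Proof.
apply/eqP; rewrite eqEsubv; apply/andP; split; apply/span_subvP=> _ /mapP[t _ ->].
  by have [c ->] := AA' t; apply: rpred_sum => l _; rewrite rpredZ // mem_mxspan.
by have [u ->] := A'A t; exact: mem_mxspan.
Qed.

Lemma attaining_span d (X : 'I_p -> 'M[F]_d) : attaining (fun t => (A t)^T) X ->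
  exists X' : 'I_m -> 'M[F]_d, attaining (fun l => (A' l)^T) X'.
Proof.
have /fin_all_exists[c cE] := AA'; have /fin_all_exists[g gE] := A'A.
move=> aX; exists (fun l => \sum_t c t l *: X t) => d' Y.
rewrite -(@bl_span _ _ _ _ _ (fun t => (A t)^T)) => [|t]; last first.
  by rewrite cE linear_sum; apply: eq_bigr => l _; rewrite linearZ.
rewrite (@bl_span _ _ _ _ _ _ (fun t => (A t)^T) (fun l t => (t == g l)%:R)) => [|l]; first exact: aX.
rewrite gE (bigD1 (g l)) //= eqxx scale1r big1 ?addr0 // => t /negPf ->; exact: scale0r.
Qed.

End Span2.

(** * Magnitudes, costs and probability *)

Section Gauss.
Variable R : realType.
Local Notation F := R[i].

Lemma gaussintD (x y : F) : gaussint x -> gaussint y -> gaussint (x + y).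
Proof.
by case=> a [b ->] [a' [b' ->]]; exists (a + a'), (b + b'); rewrite !rmorphD.
Qed.

Lemma gaussintN (x : F) : gaussint x -> gaussint (- x).
Proof. by case=> a [b ->]; exists (- a), (- b); rewrite !rmorphN. Qed.

Lemma gaussintM (x y : F) : gaussint x -> gaussint y -> gaussint (x * y).
Proof.
case=> a [b ->] [a' [b' ->]]; exists (a * a' - b * b'), (a * b' + b * a').
by rewrite !rmorphB !rmorphD !rmorphM.
Qed.

Lemma gaussint0 : gaussint (0 : F). Proof. by exists 0, 0. Qed.

Lemma gaussint1 : gaussint (1 : F). Proof. by exists 1, 0. Qed.

Lemma gaussint_nat k : gaussint (k%:R : F).
Proof.
by elim: k => [|k IHk]; [exact: gaussint0|rewrite -natr1; apply: gaussintD IHk gaussint1].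
Qed.

Lemma magnitude_ge0 (x : F) : 0 <= magnitude x.
Proof. by case: x => a b; exact: sqrtr_ge0. Qed.

Lemma magnitude_nat k : magnitude (k%:R : F) = k%:R.
Proof. by rewrite /magnitude (normcMn (1 : Rcomplex R)) Normc.normc1. Qed.

Lemma magnitudeD (x y : F) : magnitude (x + y) <= magnitude x + magnitude y.
Proof. exact: le_normcD. Qed.

Lemma magnitudeM (x y : F) : magnitude (x * y) = magnitude x * magnitude y.
Proof. exact: Normc.normcM. Qed.

Variables (H : R) (Dmax : nat).
Hypotheses (H1 : 1 <= H) (D0 : (0 < Dmax)%N).

Definition minor_bound : R := (Dmax.+1 ^ Dmax.+1)%:R * H ^+ Dmax.

Definition entry_ok (z : F) := gaussint z /\ magnitude z <= H.

(** The factor before [minor_bound] covers the products of an inserted row with the projection: at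
    most [Dmax] terms, each with a factor at most [H]. *)
Definition value_ok (z : F) := gaussint z /\ magnitude z <= Dmax%:R * H * minor_bound.

Lemma minor_bound_ge1 : 1 <= minor_bound.
Proof. by rewrite mulr_ege1 ?exprn_ege1 // ler1n expn_gt0. Qed.

Lemma minor_bound_le D : (D <= Dmax)%N -> (D.+1 ^ D.+1)%:R * H ^+ D <= minor_bound.
Proof.
move=> DD; rewrite ler_pM ?ler0n ?exprn_ge0 ?ler_weXn2l // ?(le_trans _ H1) //.
rewrite ler_nat; apply: (@leq_trans (Dmax.+1 ^ D.+1)); first by rewrite leq_exp2r.
by rewrite leq_pexp2l.
Qed.

Lemma entry_ok_value z : entry_ok z -> value_ok z.
Proof.
case=> gz zH; split=> //; apply: le_trans zH _.
have H0 : 0 <= H by apply: le_trans H1.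
rewrite -[leLHS]mulr1 ler_pM ?minor_bound_ge1 // -[leLHS]mul1r ler_wpM2r //.
by rewrite ler1n.
Qed.

Lemma minor_value z : gaussint z -> magnitude z <= minor_bound -> value_ok z.
Proof.
move=> gz zB; split=> //; apply: le_trans zB _.
rewrite -[leLHS]mul1r ler_wpM2r ?(le_trans _ minor_bound_ge1) //.
by rewrite mulr_ege1 // ler1n.
Qed.

Lemma windowed_values D W dl (Q : 'M[F]_W) : (D <= Dmax)%N -> (W <= Dmax)%N ->
  windowed entry_ok D dl Q ->
  [/\ dl != 0, value_ok dl, forall i j, value_ok (dl * Q i j) &
      forall v : 'rV[F]_W, (forall i, entry_ok (v 0 i)) ->
        forall j, value_ok (dl * (v *m Q) 0 j)].
Proof.
move=> DD WD wQ.
have [dl0 Gdl ndl hQ] := @windowed_bounds F R (@gaussint R) (@magnitude R) gaussint0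
  gaussint1 gaussintD gaussintN gaussintM (Normc.normc0 R) (Normc.normc1 R)
  magnitude_ge0 magnitudeD (@normcN R) magnitudeM H D W dl Q H1 wQ.
have leZ := minor_bound_le DD; split=> //.
- by apply: minor_value => //; apply: le_trans ndl leZ.
- by move=> i j; have [g nQ] := hQ i j; apply: minor_value => //; apply: le_trans nQ leZ.
move=> v okv j.
have -> : dl * (v *m Q) 0 j = \sum_i v 0 i * (dl * Q i j).
  by rewrite mxE mulr_sumr; apply: eq_bigr => i _; rewrite mulrCA.
split.
  apply: (G_sum (G := @gaussint R) gaussint0 gaussintD) => i _; apply: gaussintM.
    exact: (okv i).1.
  exact: (hQ i j).1.
have := @nm_sum F R (@magnitude R) (Normc.normc0 R) magnitudeD _
  (fun i => v 0 i * (dl * Q i j)) (H * minor_bound).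
rewrite card_ord => /(_ _)/le_trans; apply.
  move=> i; rewrite magnitudeM ler_pM ?magnitude_ge0 ?(okv i).2 //.
  exact: le_trans (hQ i j).2 leZ.
rewrite -mulrA ler_wpM2r ?ler_nat // mulr_ge0 ?(le_trans _ H1) //.
exact: le_trans minor_bound_ge1.
Qed.

End Gauss.

(** Every factor is replaced by a power of [x], with [4 <= x^2]. So [H <= x^10] and [Dmax <= x^4],
    while [Dmax + 1 <= x^5] gives [minor_bound] the exponent [15 Dmax + 5 = 60 N^2 + 5]. The total
    [60 N^2 + 19] is at most [79 N^2]. *)
Lemma value_bound (R : realType) (M x : R) N (H := (N ^ 2)%:R * M * (4 * N ^ 5)%:R)
  (Dmax := (4 * N ^ 2)%N) : (0 < N)%N -> 1 <= M -> 2 <= x -> M <= x -> N%:R <= x ->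
  Dmax%:R * H * minor_bound H Dmax <= x ^+ (79 * N ^ 2).
Proof.
move=> N0 M1 x2 Mx Nx.
have M0 : 0 <= M by apply: le_trans M1.
have x1 : 1 <= x by apply: le_trans x2; rewrite ler1n.
have x0 : 0 <= x by apply: le_trans x1.
have NX k : (N ^ k)%:R <= x ^+ k by rewrite natrX lerXn2r ?nnegrE ?ler0n.
have x4 : 4 <= x ^+ 2.
  have -> : (4 : R) = 2 ^+ 2 by rewrite -natrX.
  by rewrite lerXn2r ?nnegrE ?ler0n.
have HX : H <= x ^+ 10.
  rewrite (_ : x ^+ 10 = x ^+ 2 * x * (x ^+ 2 * x ^+ 5)); last by rewrite -!exprD -!exprSr -exprD.
  by rewrite /H natrM !ler_pM ?mulr_ge0 ?ler0n ?NX.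
have H0 : 0 <= H by rewrite !mulr_ge0 ?ler0n.
have DX : Dmax%:R <= x ^+ 4.
  by rewrite /Dmax natrM (exprD _ 2 2) ler_pM ?ler0n ?NX.
have DX' : Dmax.+1%:R <= x ^+ 5.
  rewrite -natr1 exprS; apply: (@le_trans _ _ (x ^+ 4 + x ^+ 4)).
    by rewrite lerD // exprn_ege1.
  by rewrite -mulr2n -mulr_natl ler_wpM2r ?exprn_ge0.
have MB : minor_bound H Dmax <= x ^+ (5 * Dmax.+1 + 10 * Dmax).
  rewrite /minor_bound exprD (exprM x 5) (exprM x 10) natrX ler_pM ?exprn_ge0 ?ler0n //.
    by rewrite lerXn2r ?nnegrE ?ler0n ?exprn_ge0.
  by rewrite lerXn2r ?nnegrE ?exprn_ge0.
apply: (@le_trans _ _ (x ^+ (4 + 10 + (5 * Dmax.+1 + 10 * Dmax)))).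
  rewrite !exprD -!exprD 2!exprD ler_pM ?mulr_ge0 ?ler0n ?exprn_ge0 //.
  by rewrite ler_pM ?ler0n.
rewrite ler_weXn2l // /Dmax; have : (0 < N ^ 2)%N by rewrite expn_gt0 N0.
by lia.
Qed.

(** * Reading off a basis of [U] from the projection onto [U (x) C^d] *)

Lemma tens1_slice (F : fieldType) n d (U : 'M[F]_n) (b : 'I_d) :
  (U *t (1%:M : 'M[F]_d)) *m slice F n b = slice F n b *m U.
Proof.
apply/matrixP=> i j; rewrite mul_slice; case: (mxtens_indexP i) => i1 b1.
rewrite tensmxE !mxE (bigD1 i1) //= big1 ?addr0 => [|k ki]; last first.
  by rewrite !mxE mxtens_index_eq eq_sym (negPf ki) mul0r.
by rewrite mxE mxtens_index_eq eqxx /= mulrC.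
Qed.

Section ReadOff.
Variables (F : fieldType) (n d : nat) (b : 'I_d) (P : 'M[F]_(n * d)) (U : 'M[F]_n) (dl : F).
Hypotheses (rP : reflecting P) (dl0 : dl != 0).
Hypothesis hP : forall x : 'cV[F]_(n * d), P *m x = x <-> (x^T <= U *t (1%:M : 'M[F]_d))%MS.

Let idx (i : 'I_n) : 'I_(n * d) := mxtens_index (i, b).

Lemma idx_eq i j : (idx i == idx j) = (i == j).
Proof. by rewrite mxtens_index_eq eqxx andbT. Qed.

Definition readoff (j : 'I_n) : 'cV[F]_n := \col_i (dl * P (idx i) (idx j)).

Lemma readoff_sub j : ((readoff j)^T <= U)%MS.
Proof.
have : ((col (idx j) P)^T <= U *t (1%:M : 'M[F]_d))%MS.
  by apply/hP; rewrite colE mulmxA reflecting_idem.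
case/submxP=> D DE.
have -> : (readoff j)^T = dl *: ((col (idx j) P)^T *m slice F n b).
  by apply/rowP=> i; rewrite [RHS]mxE mul_slice !mxE.
by rewrite DE -mulmxA tens1_slice mulmxA scalemx_sub // submxMl.
Qed.

Lemma readoff_free j : P (idx j) (idx j) != 0 -> forall i, P (idx j) (idx i) = (i == j)%:R.
Proof.
move=> Pj i; case: (rP (idx j)) => [/colP/(_ (idx j))|/rowP/(_ (idx i))].
  by rewrite !mxE => e; rewrite e eqxx in Pj.
by rewrite !mxE idx_eq eq_sym.
Qed.

Lemma readoff0 j : P (idx j) (idx j) = 0 -> readoff j = 0.
Proof.
move=> Pj; case: (rP (idx j)) => [/colP h|/rowP/(_ (idx j))].
  by apply/colP=> i; have := h (idx i); rewrite !mxE => ->; rewrite mulr0.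
by rewrite !mxE Pj eqxx => /eqP; rewrite eq_sym oner_eq0.
Qed.

(** The vector [u (x) e_b] is fixed by [P], so it is the combination of the columns [(j, b)] of [P]
    with coefficients [u j]; its slice [b] is the claim. *)
Lemma readoff_decomp u : (u^T <= U)%MS -> u = \sum_j (dl^-1 * u j 0) *: readoff j.
Proof.
move=> uU; pose x : 'cV[F]_(n * d) := slice F n b *m u.
have xE i : x (idx i) 0 = u i 0.
  rewrite mxE (bigD1 i) //= big1 ?addr0 => [|k ki]; rewrite mxE mxtens_index_eq ?eqxx ?mul1r //.
  by rewrite eq_sym (negPf ki) mul0r.
have Px : P *m x = x.
  apply/hP; case/submxP: uU => D uE; rewrite trmx_mul uE -mulmxA mulmx_sub //.
  exact: (tens1_subP _ _ (submx_refl _)).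
apply/colP=> i; rewrite -xE -Px summxE.
have -> : (P *m x) (idx i) 0 = ((P *m slice F n b) *m u) (idx i) 0 by rewrite mulmxA.
rewrite mxE; apply: eq_bigr => j _; rewrite mul_slice !mxE.
by rewrite [RHS]mulrACA mulVf // mul1r mulrC.
Qed.

(** [readoff_decomp] gives generation. For independence, a nonzero diagonal entry belongs to a unit
    row of [P], so each vector kept has a coordinate at which all the others vanish. *)
Lemma readoff_basis :
  basis_of (rowvs U) [seq readoff j | j <- enum 'I_n & dl * P (idx j) (idx j) != 0].
Proof.
set js := [seq j <- _ | _]; rewrite /basis_of; apply/andP; split.
  rewrite eqEsubv; apply/andP; split.
    by apply/span_subvP=> _ /mapP[j _ ->]; rewrite mem_rowvs readoff_sub.
  apply/subvP=> u; rewrite mem_rowvs => /readoff_decomp ->.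
  apply: rpred_sum => j _; apply: rpredZ; have [e|Pj] := eqVneq (P (idx j) (idx j)) 0.
    by rewrite readoff0 // rpred0.
  by apply: memv_span; apply: map_f; rewrite mem_filter mem_enum mulf_neq0.
have ujs : uniq js by rewrite filter_uniq // enum_uniq.
pose j0 := fun i : 'I_(size js) => tnth (in_tuple js) i.
have j0P i : P (idx (j0 i)) (idx (j0 i)) != 0.
  have := mem_tnth i (in_tuple js); rewrite mem_filter => /andP[+ _].
  by rewrite mulf_eq0 negb_or => /andP[].
have -> : [seq readoff j | j <- js] = map_tuple readoff (in_tuple js) by [].
apply/freeP=> k kE i; have := congr1 (fun v : 'cV[F]_n => v (j0 i) 0) kE.
have nthE (i' : 'I_(size js)) : (map_tuple readoff (in_tuple js))`_i' = readoff (j0 i').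
  by rewrite -tnth_nth tnth_map.
rewrite summxE (bigD1 i) // big1 ?addr0 => [|i' i'i].
  rewrite [RHS]mxE nthE !mxE readoff_free // eqxx mulr1 [X in X = _]addr0 => /eqP.
  by rewrite mulf_eq0 (negPf dl0) orbF => /eqP.
rewrite nthE !mxE readoff_free // /j0 !(tnth_nth (j0 i)) nth_uniq //.
by rewrite -val_eqE in i'i; rewrite (negPf i'i) !mulr0.
Qed.

End ReadOff.

(** * Operation counts of the phases *)

Section Costs.
Variable R : realType.
Local Notation st := (state R[i]).

Lemma exec_cost_self c (s : st) : all (fun x => x \notin imod c) (bvars c) ->
  always (exec c s) (fun s' => (cost s' <= cbound (ireg s) c + cost s)%N).
Proof. by move=> /allP dj; apply: exec_cost. Qed.

Lemma monomials p W : (0 < p)%N -> (0 < W)%N -> [/\ (1 <= p * W * W)%N, (W <= p * W * W)%N,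
  (W * W <= p * W * W)%N, (p <= p * W * W)%N & (p * W <= p * W * W)%N].
Proof.
move=> p0 W0; have WW : (0 < W * W)%N by rewrite muln_gt0 W0.
split; rewrite -?mulnA ?muln_gt0 ?p0 ?W0 ?leq_pmull ?leq_pmulr //.
  by apply: leq_trans (leq_pmull _ p0); rewrite leq_pmulr.
by rewrite leq_mul2l leq_pmulr ?orbT.
Qed.

Lemma insert_cbound r W : (0 < W)%N -> r 14%N = W -> (cbound r insert <= 100 * (W * W))%N.
Proof.
move=> W0 rW; rewrite [cbound _ _]/= !rW.
have : (W <= W * W)%N by nia.
have : (1 <= W * W)%N by nia.
by lia.
Qed.

Lemma select_cost (s : st) n p : ireg s 0 = n -> ireg s 1 = p -> (0 < n)%N -> (0 < p)%N ->
  always (exec select s) (fun s' => (cost s' <= 300 * (p * (n * n) * (n * n)) + cost s)%N).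
Proof.
move=> sn sp n0 p0; step; set s1 := tick 1 _; set W := (n * n)%N.
have W0 : (0 < W)%N by rewrite muln_gt0 n0.
have r14 : ireg s1 14 = W by rewrite /s1 /= /upd /= sn.
have r1 : ireg s1 1 = p by rewrite /s1 /= /upd /= sp.
have c1 : (cost s1 = 1 + cost s)%N by [].
have := @exec_cost_self (identity_square ;; For 6 $1 select_one) s1 isT.
apply: always_mono => s'; rewrite c1; move: (cost s') (cost s) => x y.
have := insert_cbound W0 r14; move: r14 r1; generalize (ireg s1) => r r14 r1 hi.
rewrite [cbound _ _]/= -/(cbound r insert) r14 r1; move: (cbound r insert) hi => ci hi.
have : (p * ci <= p * (100 * (W * W)))%N by rewrite leq_mul2l hi orbT.
have [h1 h2 h3 h4 h5] := monomials p0 W0.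
by lia.
Qed.

Lemma draws_cost (s : st) n d m : ireg s 0 = n -> ireg s 2 = d -> ireg s 5 = m ->
  always (exec draws s) (fun s' => (cost s' <= 1 + 3 * ((n * d + 1) * m * d * d) + cost s)%N).
Proof.
move=> r0 r2 r5; apply: always_mono (exec_cost_self _ _) => // s'.
by rewrite [cbound _ _]/= r0 r2 r5; move: (cost s') (cost s) => x y; lia.
Qed.

Lemma blowups_cost (s : st) n d m : ireg s 0 = n -> ireg s 2 = d -> ireg s 5 = m ->
  (0 < n)%N -> (0 < d)%N ->
  always (exec blowups s) (fun s' =>
    (cost s' <= 1 + (n * d + 1) * (n * d * (n * d) * (20 + 20 * m)) + cost s)%N).
Proof.
move=> r0 r2 r5 n0 d0; apply: always_mono (exec_cost_self _ _) => // s'.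
rewrite [cbound _ _]/= r0 r2 r5; move: (cost s') (cost s) => x y h.
apply: leq_trans h _; rewrite leq_add2r.
set c1 := (X in (_ * X)%N); suff : (c1 <= n * d * (n * d) * (20 + 20 * m))%N.
  by move=> hc; rewrite add1n ltnS leq_mul2l hc orbT.
by rewrite /c1; nia.
Qed.

Lemma chains_cost (s : st) n d (N := (n * d)%N) : ireg s 0 = n -> ireg s 2 = d -> (0 < N)%N ->
  always (exec chains s) (fun s' => (cost s' <= 2000 * (N * N * N * N) + cost s)%N).
Proof.
move=> r0 r2 N0; step; set s1 := tick 1 _.
have r14 : ireg s1 14 = (N + N)%N by rewrite /s1 /= /upd /= r0 r2.
have q0 : ireg s1 0 = n by rewrite /s1 /= /upd.
have q2 : ireg s1 2 = d by rewrite /s1 /= /upd.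
have c1 : (cost s1 = 1 + cost s)%N by [].
have := @exec_cost_self (clear_square ;; SCst 0 1 0 ;; For 7 (IAdd eN (ICst 1)) chain_block) s1 isT.
apply: always_mono => s'; rewrite c1; move: (cost s') (cost s) => x y.
have NN0 : (0 < N + N)%N by rewrite addn_gt0 N0.
have := insert_cbound NN0 r14; move: r14 q0 q2; generalize (ireg s1) => r r14 q0 q2 hi.
rewrite [cbound _ _]/= -/(cbound r insert) r14 q0 q2 -/N; move: (cbound r insert) hi => ci hi.
have : (N * N * ci <= N * N * (100 * ((N + N) * (N + N))))%N by rewrite leq_mul2l hi orbT.
have : (N * ci <= N * N * ci)%N by nia.
have : (N <= N * N)%N by nia.
have : (N * N <= N * N * N)%N by nia.
have : (N * N * N <= N * N * N * N)%N by nia.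
by lia.
Qed.

Lemma emit_cost (s : st) n : ireg s 0 = n -> (0 < n)%N ->
  always (exec emit s) (fun s' => (cost s' <= 20 * (n * n) + cost s)%N).
Proof.
move=> r0 n0; apply: always_mono (exec_cost_self _ _) => // s'.
rewrite [cbound _ _]/= r0; move: (cost s') (cost s) => x y.
have : (n <= n * n)%N by nia.
by lia.
Qed.

Definition shrunk_program : cmd := select ;; draws ;; blowups ;; chains ;; emit.

Lemma total_cost n p d m : (0 < n)%N -> (0 < d)%N -> (0 < p)%N -> (m <= p)%N ->
  (20 * (n * n) + (2000 * (n * d * (n * d) * (n * d) * (n * d)) +
   ((1 + (n * d + 1) * (n * d * (n * d) * (20 + 20 * m))) +
    ((1 + 3 * ((n * d + 1) * m * d * d)) + 300 * (p * (n * n) * (n * n))))) <=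
   3000 * (p * d ^ 4 * n ^ 4))%N.
Proof.
move=> n0 d0 p0 mp.
have -> : (p * d ^ 4 * n ^ 4 = p * (n * d * (n * d) * (n * d) * (n * d)))%N by lia.
set N := (n * d)%N; have N0 : (0 < N)%N by rewrite muln_gt0 n0.
have nN : (n <= N)%N by rewrite leq_pmulr.
have dN : (d <= N)%N by rewrite leq_pmull.
set T := (N * N * N * N)%N.
have NN : (N * N <= T)%N by rewrite /T -mulnA leq_pmulr // muln_gt0 N0.
have NNN : (N * N * N <= T)%N by rewrite /T leq_pmulr.
have T0 : (0 < T)%N by rewrite /T /N !muln_gt0 n0 d0.
have Tp : (T <= p * T)%N by rewrite leq_pmull.
have t1 : (n * n <= N * N)%N by rewrite leq_mul.
have t2 : (p * (n * n) * (n * n) <= p * T)%N.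
  by rewrite -mulnA leq_mul2l /T -(mulnA (N * N)) leq_mul ?orbT.
have pN : (p * (N * N * N) <= p * T)%N by rewrite leq_mul2l NNN orbT.
have t3 : ((N + 1) * m * d * d <= 2 * (p * T))%N.
  apply: (@leq_trans (2 * N * p * N * N)); first by rewrite !leq_mul //; lia.
  by move: pN; move: (p * T)%N => w; clearbody N; lia.
have t4 : ((N + 1) * (N * N * (20 + 20 * m)) <= 80 * (p * T))%N.
  apply: (@leq_trans (2 * N * (N * N * (40 * p)))); first by rewrite !leq_mul //; lia.
  by move: pN; move: (p * T)%N => w; clearbody N; lia.
by lia.
Qed.

End Costs.

Lemma input_arrE (F : fieldType) n p (A : 'I_p -> 'M[F]_n) (t : 'I_p) (i j : 'I_n) :
  input_arr A 0 (t * (n * n) + (i * n + j))%N = A t i j.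
Proof.
rewrite /input_arr eqxx; have -> : (t * (n * n) + (i * n + j) = (t * n + i) * n + j)%N by lia.
have E t' (i' j' : 'I_n) : (((t * n + i) * n + j)%N == ((t' * n + i') * n + j')%N) =
    [&& t' == t :> nat, i' == i & j' == j].
  by rewrite !flat_eq // -!val_eqE /= eq_sym [(i == i' :> nat)]eq_sym [(j == j' :> nat)]eq_sym andbA.
rewrite (bigD1 t) //= (bigD1 i) //= (bigD1 j) //= E !eqxx mulr1n !big1 ?addr0 //.
- move=> t' /negPf tt; rewrite big1 // => i' _; rewrite big1 // => j' _.
  by rewrite E val_eqE tt.
- by move=> i' /negPf ii; rewrite big1 // => j' _; rewrite E ii andbF.
- by move=> j' /negPf jj; rewrite E jj !andbF.
Qed.

(** * Passing from all matrices to the selected ones *)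

Section Selected.
Variables (R : realType) (n p m : nat) (A : 'I_p -> 'M[R[i]]_n) (a5 : nat -> R[i]).
Hypothesis sel : selected (n * n) (input_arr A 0) p p m a5.

Definition selA (l : 'I_m) : 'M[R[i]]_n := \matrix_(i, j) a5 (l * (n * n) + (i * n + j))%N.

Lemma pair_lt (i j : 'I_n) : (i * n + j < n * n)%N.
Proof.
apply: (@leq_trans (i.+1 * n)); first by rewrite mulSn addnC ltn_add2r.
by rewrite leq_mul2r ltn_ord orbT.
Qed.

Lemma selA_mem l : exists t, selA l = A t.
Proof.
case: sel => _ _ h _; have [t tp tE] := h l (ltn_ord l); exists (Ordinal tp).
by apply/matrixP=> i j; rewrite mxE tE ?pair_lt // -(input_arrE A (Ordinal tp)).
Qed.

Lemma selA_span t : exists c, A t = \sum_l c l *: selA l.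
Proof.
case: sel => _ _ _ h; have /submxP[D DE] := h t (ltn_ord t).
exists (D 0); apply/matrixP=> i j; rewrite -input_arrE summxE.
have /rowP/(_ (Ordinal (pair_lt i j))) := DE; rewrite !mxE /= => ->.
by apply: eq_bigr => l _; rewrite !mxE.
Qed.

Lemma selected_le : (m <= n * n)%N.
Proof. by have := rank_leq_col (selmx m (n * n) a5); case: sel => _ -> _ _. Qed.

Lemma sel_mxspan : mxspan selA = mxspan A.
Proof. exact/esym/(mxspan_eq selA_span selA_mem). Qed.

(** The selection changes neither the matrix space nor the ranks its blow-ups can attain. A closed
    subspace for an attaining blow-up then yields both the minimum shrunk subspace and the value of
    the rank. *)
Lemma sel_min_shrunk d (r := ncrank (mxspan A)) (a := fun l => (selA l)^T) :
  (0 < d)%N -> blowup_attains A d ->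
  [/\ is_ncrank a r, exists U, is_min_shrunk a (n - r) U &
      exists X : 'I_m -> 'M[R[i]]_d, \rank (blowup a X) = (r * d)%N].
Proof.
move=> d0 /(attains_attaining d0)[X0 /(attaining_span selA_span selA_mem)[X aX]].
have hr : is_ncrank a r by rewrite /r -sel_mxspan; exact: ncrankP.
have [K cK] := attaining_closed d0 aX; split=> //.
  exact: exists_min_shrunk d0 hr cK.
by exists X; exact: closed_is_ncrank hr cK.
Qed.

End Selected.

(** * Correctness of the whole program *)

Section Main.
Variables (R : realType) (n p d k : nat) (M : R) (A : 'I_p -> 'M[R[i]]_n).
Hypotheses (n0 : (0 < n)%N) (p0 : (0 < p)%N) (d0 : (0 < d)%N) (M1 : 1 <= M).
Hypothesis hA : forall t i j, gaussint (A t i j) /\ magnitude (A t i j) <= M.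
Hypothesis hd : blowup_attains A d.
Local Notation F := R[i].
Local Notation st := (state F).
Local Notation N := (n * d)%N.
(** An entry of a blow-up is a sum of at most [n^2 <= N^2] products of an input entry and a random
    number at most [4 N^5]. The virtual systems have order [n^2] for the selection and
    [N (N + 3) <= 4 N^2] for the chain. *)
Local Notation H := ((N ^ 2)%:R * M * (4 * N ^ 5)%:R).
Local Notation Dmax := (4 * N ^ 2)%N.
Local Notation ok := (value_ok H Dmax).
Local Notation okE := (entry_ok H).
Local Notation r := (ncrank (mxspan A)).
Local Notation s0 := (input d k A).
Local Notation E := (4 * N ^ 5)%N.

Let N0 : (0 < N)%N. Proof. by rewrite muln_gt0 n0. Qed.

Lemma M_ge0 : 0 <= M. Proof. exact: le_trans M1. Qed.

Lemma E_ge1 : 1 <= E%:R :> R.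
Proof. by rewrite ler1n muln_gt0 expn_gt0 N0. Qed.

Lemma MH : M <= H.
Proof.
rewrite -[leLHS]mulr1 ler_pM ?M_ge0 ?E_ge1 // -[leLHS]mul1r ler_wpM2r ?M_ge0 //.
by rewrite ler1n expn_gt0 N0.
Qed.

Lemma H_ge1 : 1 <= H. Proof. exact: le_trans M1 MH. Qed.

Lemma EH : E%:R <= H.
Proof.
rewrite -[leLHS]mul1r ler_wpM2r ?ler0n // mulr_ege1 //.
by rewrite ler1n expn_gt0 N0.
Qed.

Lemma Dmax_gt0 : (0 < Dmax)%N. Proof. by rewrite muln_gt0 expn_gt0 N0. Qed.

Let okEok z : okE z -> ok z. Proof. by move=> h; exact: (entry_ok_value H_ge1 Dmax_gt0 h). Qed.

Let okE0 : okE 0.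
Proof. by split; [exact: gaussint0|rewrite /magnitude Normc.normc0 (le_trans _ H_ge1)]. Qed.

Let okE1 : okE 1.
Proof. by split; [exact: gaussint1|rewrite /magnitude Normc.normc1 H_ge1]. Qed.

Lemma drawn_okE z : drawn E z -> okE z.
Proof.
case=> j jE ->; split; first exact: gaussint_nat.
by rewrite magnitude_nat (le_trans _ EH) // ler_nat.
Qed.

Lemma A_okE t i j : okE (A t i j).
Proof. by have [g b] := hA t i j; split=> //; exact: le_trans b MH. Qed.

Lemma nn_Dmax : (n * n <= Dmax)%N.
Proof.
apply: (@leq_trans (N ^ 2)); last by rewrite leq_pmull.
by rewrite -mulnn leq_mul // leq_pmulr.
Qed.

Lemma NN3_Dmax : (N * (N + 3) <= Dmax)%N.
Proof. by move: N N0 => x; rewrite -mulnn; nia. Qed.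

Definition chosen (s : st) :=
  [/\ stored_ok ok s, selected (n * n) (input_arr A 0) p p (ireg s 5) (arr s 5),
      [/\ ireg s 0 = n, ireg s 2 = d & ireg s 4 = 0%N], archived s0 s &
      (cost s <= 300 * (p * (n * n) * (n * n)))%N].

Lemma select_chosen : always (exec select s0) chosen.
Proof.
have h := @select_spec R ok (okEok okE0) (okEok okE1) okE Dmax okE0 okEok
  (@windowed_values R H Dmax H_ge1 Dmax_gt0) s0 n p erefl erefl erefl nn_Dmax.
have okin t i : (t < p)%N -> (i < n * n)%N -> okE (arr s0 0 (t * (n * n) + i)%N).
  move=> tp iW; have i1 : (i %/ n < n)%N by rewrite ltn_divLR.
  have i2 : (i %% n < n)%N by rewrite ltn_mod.
  have := A_okE (Ordinal tp) (Ordinal i1) (Ordinal i2); rewrite -(input_arrE A).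
  by rewrite [nat_of_ord (Ordinal i1)]/(i %/ n)%N [nat_of_ord (Ordinal i2)]/(i %% n)%N -divn_eq.
have ok_s0 : stored_ok ok s0 by move=> z; rewrite in_nil.
have := always_and (h ok_s0 okin) (always_and (exec_frame select s0)
  (always_and (exec_archived select s0) (select_cost (s := s0) erefl erefl n0 p0))).
apply: always_mono => s [[oks sel] [[f1 _ _] [ar cs]]]; split=> //.
- by split; rewrite f1.
- by rewrite /= addn0 in cs.
Qed.

Definition sampled m a5 (s : st) :=
  [/\ stored_ok ok s, [/\ ireg s 0 = n, ireg s 2 = d, ireg s 4 = 0%N, ireg s 5 = m & arr s 5 = a5],
      forall e, (e < N.+1 * m * d * d)%N -> drawn E (arr s 6 e), archived s0 s &
      (cost s <= 1 + 3 * ((N + 1) * m * d * d) + 300 * (p * (n * n) * (n * n)))%N].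

Lemma ndraws_eq (s : st) : chosen s -> ieval (ireg s) ndraws = (N.+1 * ireg s 5 * d * d)%N.
Proof. by case=> _ _ [r0 r2 _] _ _; rewrite /= r0 r2 addn1. Qed.

Lemma draw_range_eq (s : st) : chosen s -> ieval (ireg s) draw_range = E.
Proof.
case=> _ _ [r0 r2 _] _ _; rewrite /= r0 r2; move: N => x.
by rewrite !expnS expn0 muln1 !mulnA.
Qed.

Lemma draws_sampled s : chosen s -> always (exec draws s) (sampled (ireg s 5) (arr s 5)).
Proof.
move=> cs; have [oks _ [r0 r2 r4] ar c0] := cs.
have okd z : drawn E z -> ok z by move=> /drawn_okE/okEok.
have := always_and (draws_spec (ndraws_eq cs) (draw_range_eq cs) oks okd)
  (always_and (exec_frame draws s) (always_and (exec_archived draws s)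
     (draws_cost r0 r2 (erefl (ireg s 5))))).
apply: always_mono => s' [[oks' dr] [[f1 f2 f3] [ar' c']]]; split=> //.
- by split; rewrite ?f1 ?f3.
- exact: archived_trans ar ar'.
- by apply: leq_trans c' _; rewrite leq_add2l.
Qed.

Section Chosen.
Variables (m : nat) (a5 : nat -> F).
Hypothesis sel : selected (n * n) (input_arr A 0) p p m a5.
Local Notation a := (fun l : 'I_m => (selA n a5 l)^T).
Variable U : 'M[F]_n.
Hypotheses (hr : is_ncrank a r) (hU : is_min_shrunk a (n - r) U).

Lemma blowup_okE a6 e : (forall e, (e < N.+1 * m * d * d)%N -> drawn E (a6 e)) ->
  (e < N.+1 * N * N)%N -> okE (blowup_val n d m a5 a6 e).
Proof.
move=> dr eN; rewrite /blowup_val.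
set q := (e %% N)%N; set rr := (e %/ N %% N)%N; set s := (e %/ N %/ N)%N.
have qN : (q < N)%N by rewrite ltn_mod.
have rN : (rr < N)%N by rewrite ltn_mod.
have sN : (s <= N)%N by rewrite -ltnS !ltn_divLR.
have term (l : 'I_m) : gaussint (a5 (l * (n * n) + (rr %/ d * n + q %/ d))%N *
      a6 (((s * m + l) * d + rr %% d) * d + q %% d)%N) /\
    magnitude (a5 (l * (n * n) + (rr %/ d * n + q %/ d))%N *
      a6 (((s * m + l) * d + rr %% d) * d + q %% d)%N) <= M * E%:R.
  have r1 : (rr %/ d < n)%N by rewrite ltn_divLR.
  have q1 : (q %/ d < n)%N by rewrite ltn_divLR.
  have [t tE] := selA_mem sel l.
  have -> : a5 (l * (n * n) + (rr %/ d * n + q %/ d))%N = A t (Ordinal r1) (Ordinal q1).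
    by rewrite -tE mxE.
  have [|j jE ->] := dr (((s * m + l) * d + rr %% d) * d + q %% d)%N.
    have h1 : (s * m + l < N.+1 * m)%N.
      apply: (@leq_trans (s.+1 * m)); first by rewrite mulSn addnC ltn_add2r.
      by rewrite leq_mul2r ltnS sN orbT.
    have h2 : ((s * m + l) * d + rr %% d < N.+1 * m * d)%N.
      apply: (@leq_trans ((s * m + l).+1 * d)); last by rewrite leq_mul2r h1 orbT.
      by rewrite mulSn addnC ltn_add2r ltn_mod.
    apply: (@leq_trans (((s * m + l) * d + rr %% d).+1 * d)); last by rewrite leq_mul2r h2 orbT.
    by rewrite mulSn addnC ltn_add2r ltn_mod.
  have [g b] := hA t (Ordinal r1) (Ordinal q1); split.
    by apply: gaussintM g (gaussint_nat R j).
  by rewrite magnitudeM magnitude_nat ler_pM ?magnitude_ge0 ?ler0n ?ler_nat.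
split.
  apply: (G_sum (G := @gaussint R) (gaussint0 R) (@gaussintD R)) => l _.
  by case: (term l).
apply: le_trans (nm_sum (nm := @magnitude R) (Normc.normc0 R) (@magnitudeD R)
   (fun l => (term l).2)) _.
rewrite card_ord -mulrA ler_wpM2r ?mulr_ge0 ?M_ge0 ?ler0n // ler_nat.
apply: leq_trans (selected_le sel) _.
by rewrite -mulnn leq_mul // leq_pmulr.
Qed.

Definition chainmx a6 s : 'M[F]_N :=
  \matrix_(i, j) blowup_val n d m a5 a6 ((s * N + i) * N + j)%N.

Lemma chainmxT a6 s : (chainmx a6 s)^T = drawC d a a6 s.
Proof.
apply/matrixP=> i j; rewrite 2!mxE blowup_valE //.
case: (mxtens_indexP i) => i1 i2; case: (mxtens_indexP j) => j1 j2.
rewrite summxE; apply: eq_bigr => l _; rewrite tensmxE !mxE /didx /=.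
by rewrite !divnMDl // !divn_small // !addn0 !modnMDl !modn_small.
Qed.

Lemma chains_width (s : st) : ireg s 0 = n -> ireg s 2 = d ->
  always (exec chains s) (fun s' => ireg s' 14 = (N + N)%N).
Proof.
move=> r0 r2; step; apply: always_mono (exec_frame _ _) => s' [f1 _ _].
by rewrite f1 //= /upd /= r0 r2.
Qed.

Definition succeeds (s : st) := exists V : {vspace 'cV[F]_n},
  min_shrunk (mxspan A) (n - r) V /\ basis_of V (output n s).

Definition finished (s : st) :=
  [/\ stored_ok ok s, archived s0 s & (cost s <= 3000 * (p * d ^ 4 * n ^ 4))%N].

(** After the draws everything is deterministic: the bounds hold whatever was drawn, and success
    follows once the numbers are good. *)
Lemma rest_spec (s : st) : sampled m a5 s ->
  always (exec (blowups ;; chains ;; emit) s)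
    (fun s' => finished s' /\ (good d a r U (arr s 6) -> succeeds s')).
Proof.
case=> oks [r0 r2 r4 r5 a5E] dr ar cs.
have okb e : (e < N.+1 * N * N)%N -> okE (blowup_val n d m a5 (arr s 6) e).
  exact: blowup_okE.
have fill0 : filled ok n d m a5 (arr s 6) 0 s by split.
apply: exec_seq.
have := always_and (blowups_spec n0 d0 (fun e he => okEok (okb e he)) fill0)
  (always_and (exec_archived blowups s) (blowups_cost r0 r2 r5 n0 d0)).
apply: always_mono => s1 [[oks1 [q0 q2 q5] _ fill1] [ar1 cs1]] [f1 _ _].
have q4 : ireg s1 4 = 0%N by rewrite f1.
pose Cs := chainmx (arr s 6).
have pos_lt sx (i j : 'I_N) : (sx <= N)%N -> ((sx * N + i) * N + j < N.+1 * N * N)%N.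
  move=> sN; apply: (@leq_trans ((sx * N + i).+1 * N)).
    by rewrite mulSn addnC ltn_add2r.
  rewrite leq_mul2r; apply/orP; right; apply: (@leq_trans (sx.+1 * N)).
    by rewrite mulSn addnC ltn_add2r.
  by rewrite leq_mul2r ltnS sN orbT.
have okC sx (i j : 'I_N) : (sx <= N)%N -> okE (Cs sx i j).
  by move=> sN; rewrite mxE; apply: okb; exact: pos_lt.
have hC : holds_chain Cs s1.
  by move=> sx i j sN; rewrite fill1 ?mxE //; exact: pos_lt.
apply: exec_seq.
have := always_and (chains_spec (okEok okE0) okE0 okE1 okEok
    (@windowed_values R H Dmax H_ge1 Dmax_gt0) okC q0 q2 NN3_Dmax oks1 hC)
  (always_and (chains_width q0 q2) (always_and (exec_archived chains s1)
    (chains_cost q0 q2 N0))).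
apply: always_mono => s2 [[oks2 [P [cP rP dl0 hP]]] [w2 [ar2 cs2]]] [g1 _ _].
have e0 : ireg s2 0 = n by rewrite g1.
have e2 : ireg s2 2 = d by rewrite g1.
have e4 : ireg s2 4 = 0%N by rewrite g1.
have ar02 : archived s0 s2 := archived_trans ar (archived_trans ar1 ar2).
have ok4 e : ok (arr s2 4 e).
  by case: ar02 => _ /(_ 4 e)[/oks2 //|->]; exact: okEok okE0.
have := always_and (emit_spec e0 e2 w2 e4 oks2 (fun i j _ _ => ok4 _))
  (always_and (exec_archived emit s2) (emit_cost e0 n0)).
apply: always_mono => s3 [[oks3 out] [ar3 cs3]]; split.
  split=> //; first exact: archived_trans ar02 ar3.
  have mp : (m <= p)%N by case: sel.
  apply: leq_trans (total_cost n0 d0 p0 mp); apply: leq_trans cs3 _; rewrite leq_add2l.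
  apply: leq_trans cs2 _; rewrite leq_add2l; apply: leq_trans cs1 _; rewrite leq_add2l.
  exact: cs.
move=> gd; exists (rowvs U); split.
  by rewrite -(sel_mxspan sel); apply: min_shrunkP; rewrite (sel_mxspan sel).
have hP' (x : 'cV[F]_N) : P *m x = x <-> (x^T <= U *t (1%:M : 'M[F]_d))%MS.
  rewrite hP; apply: (in_chain_tens d0 hr hU _ gd) => sx _; exact: chainmxT.
have := readoff_basis (Ordinal d0) rP dl0 hP'; rewrite out.
have aE (i j : 'I_n) : arr s2 4 (i * d * (N + N) + j * d)%N =
    sreg s2 0 * P (mxtens_index (i, Ordinal d0)) (mxtens_index (j, Ordinal d0)).
  by rewrite -cP /= !addn0.
rewrite -val_enum_ord filter_map -map_comp; congr (basis_of _ _).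
have -> : [seq j <- enum 'I_n | sreg s2 0 * P (mxtens_index (j, Ordinal d0))
    (mxtens_index (j, Ordinal d0)) != 0] =
  [seq j <- enum 'I_n | preim val (fun j => arr s2 4 (j * d * (N + N) + j * d)%N != 0) j].
  by apply: eq_filter => j /=; rewrite aE.
by apply: eq_map => j; apply/colP=> i; rewrite !mxE aE.
Qed.

Lemma draws_good (s : st) : chosen s -> ireg s 5 = m ->
  (exists X : 'I_m -> 'M[F]_d, \rank (blowup a X) = (r * d)%N) ->
  1 / 2 <= prob (exec draws s) (fun s' => good d a r U (arr s' 6)).
Proof.
move=> cs sm hX; have [x0 gx0] := exists_good d0 hr hU hX.
(* The first [k] numbers have a good completion. This holds at the start by [exists_good], and at
   the end it is goodness of the drawn numbers by [good_ext]. *)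
pose Pre k x := exists y, (forall e, (e < k)%N -> y e = x e) /\ good d a r U y.
have := @draws_prob R s (N.+1 * m * d * d)%N E (N * N)%N Pre.
rewrite -{1}sm ndraws_eq // draw_range_eq // => /(_ erefl erefl) h.
have {}h := h (ex_intro _ x0 (conj (fun e (he : (e < 0)%N) => False_ind _ (notF he)) gx0)).
have half : (1 / 2 : rat) <= 1 - (N.+1 * m * d * d * (N * N))%:R / E.+1%:R.
  rewrite lerBrDr -lerBrDl ler_pdivrMr ?ltr0n //.
  have -> : (1 - 1 / 2 : rat) = 2^-1 by [].
  rewrite mulrC ler_pdivlMr ?ltr0n // -natrM ler_nat.
  have mN : (m * d * d <= N * N)%N.
    by have := selected_le sel; move=> mn; rewrite -mulnA mulnACA leq_mul2r mn orbT.
  have NN : (N.+1 <= 2 * N)%N by move: N0; lia.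
  have e1 : (N.+1 * m * d * d <= 2 * N * (N * N))%N.
    have -> : (N.+1 * m * d * d = N.+1 * (m * d * d))%N by rewrite !mulnA.
    exact: leq_mul NN mN.
  apply: leq_trans (leq_mul (leq_mul e1 (leqnn (N * N))) (leqnn 2)) _.
  by apply/leqW/eq_leq; rewrite !expnS expn0; generalize N => x; lia.
apply: le_trans half _; apply: le_trans (h _) _.
  move=> i x iT [y [yx gy]]; apply: leq_trans (good_step d0 hr hU i E gy).
  apply: subset_leq_card; apply/fintype.subsetP=> j; rewrite !inE; apply: contra => /asboolP[z [zy zi gz]].
  apply/asboolP; exists z; split=> // e; rewrite ltnS leq_eqVlt /upd.
  by case: eqP => [->//|_] /= ei; rewrite zy // yx.
apply: prob_mono => s' [y [yx gy]]; apply: good_ext gy => // e he; apply: yx.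
by rewrite -!mulnA in he *.
Qed.

End Chosen.

Lemma run_always : always (exec shrunk_program s0) finished.
Proof.
apply: exec_seq; apply: always_mono select_chosen => s cs _; have [_ sel _ _ _] := cs.
have [hr [U hU] _] := sel_min_shrunk sel d0 hd.
apply: exec_seq; apply: always_mono (draws_sampled cs) => s' ss _.
by apply: always_mono (rest_spec sel hr hU ss) => s2 [].
Qed.

Lemma run_prob : 1 / 2 <= prob (exec shrunk_program s0) succeeds.
Proof.
change (1 / 2 <= prob (rbind (exec select s0)
  (exec (draws ;; blowups ;; chains ;; emit))) succeeds).
apply: prob_rbind_always select_chosen _ => s cs; have [_ sel _ _ _] := cs.
have [hr [U hU] hX] := sel_min_shrunk sel d0 hd.
have h1 := draws_good sel hr hU cs erefl hX.
have h2 := prob_and_always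
  (fun s' : st => good d (fun l : 'I_(ireg s 5) => (selA n (arr s 5) l)^T) r U (arr s' 6))
  (draws_sampled cs).
change (1 / 2 <= prob (rbind (exec draws s) (exec (blowups ;; chains ;; emit))) succeeds).
apply: le_trans (le_trans h1 h2) _.
rewrite -[leLHS]subr0.
apply: prob_rbind_ge => // s' [gd ss]; rewrite subr0; apply: prob_always.
by apply: always_mono (rest_spec sel hr hU ss) => s2 [_]; apply.
Qed.

End Main.

Theorem theorem6p7 :
  exists (P : cmd) (K L : nat),
  forall (R : realType) (n p d k : nat) (M : R) (A : 'I_p -> 'M[R[i]]_n),
    (0 < n)%N -> (0 < p)%N -> 1 <= M ->
    (forall t i j, gaussint (A t i j) /\ magnitude (A t i j) <= M) ->
    min_blowup_size A d ->
    (ncrank (mxspan A) <= k)%N ->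
    let c := (n - ncrank (mxspan A))%N in
    let run := exec P (input d k A) in
    [/\ 1 / 2 <= prob run (fun s =>
          exists U : {vspace 'cV[R[i]]_n},
            min_shrunk (mxspan A) c U /\ basis_of U (output n s)),
        always run (fun s => (cost s <= K * (p * d ^ 4 * n ^ 4))%N) &
        always run (fun s => forall z : R[i], vector_entry n s z ->
          gaussint z /\
          (2 <= M * (n * d * k)%:R ->
           magnitude z <=
             expR (L%:R * ((n ^ 2 * d ^ 2)%:R * ln (M * (n * d * k)%:R)
                           + (n * d)%:R * ln M))))].
Proof.
(* The constants are those of [total_cost] and [value_bound]. *)
exists shrunk_program, 3000, 79 => R n p d k M A n0 p0 M1 hA [d0 hd _] _ c run.
have hrun := run_always k n0 p0 d0 M1 hA hd; split.
- exact: run_prob n0 p0 d0 M1 hA hd.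
- by apply: always_mono hrun => s [].
apply: always_mono hrun => s [oks ar _] z zs.
have N0 : (0 < n * d)%N by rewrite muln_gt0 n0.
set H := ((n * d) ^ 2)%:R * M * (4 * (n * d) ^ 5)%:R in oks.
have [gz bz] : value_ok H (4 * (n * d) ^ 2) z.
  case: zs => [/oks//|[v /mapP[l _ ->] [j ->]]]; rewrite mxE.
  (* An output cell that was never written still holds its initial value 0. *)
  case: ar => _ /(_ 1%N (l * n + j)%N)[/oks//|->].
  split; first exact: gaussint0.
  rewrite /magnitude Normc.normc0 !mulr_ge0 ?ler0n ?exprn_ge0 ?mulr_ge0 ?ler0n ?(le_trans _ M1) //.
split=> // x2; apply: le_trans bz _; set x := M * _ in x2 *.
have M0 : 0 <= M by apply: le_trans M1.
(* The assumption [2 <= x] excludes [k = 0]; so [x] dominates both [M] and [n d], as [value_bound]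
   requires. *)
have k0 : (0 < k)%N.
  by rewrite lt0n; apply/eqP=> k0; move: x2; rewrite /x k0 muln0 mulr0 lern0.
have ndk1 : (n * d <= n * d * k)%N by rewrite leq_pmulr.
have Mx : M <= x by rewrite /x -[leLHS]mulr1 ler_wpM2l // ler1n (leq_trans N0).
have Nx : (n * d)%:R <= x.
  by rewrite /x -[leLHS]mul1r ler_pM ?ler0n // ler_nat.
apply: le_trans (value_bound N0 M1 x2 Mx Nx) _.
have x0 : 0 < x by apply: lt_le_trans x2; rewrite ltr0n.
have -> : x ^+ (79 * (n * d) ^ 2) = expR ((79 * (n * d) ^ 2)%:R * ln x).
  by rewrite -[in LHS](lnK x0) -expRM_natl.
rewrite ler_expR natrM -mulrA ler_wpM2l ?ler0n // -expnMn lerDl mulr_ge0 ?ler0n //.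
exact: ln_ge0.
Qed.
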